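(* Let $G$ be a planar graph with maximum degree $\Delta\geq 12$. Then $\Delta+1\leq\lambda_2^T(G)\leq\Delta+2$.
   Context: All graphs are finite, simple and undirected. For a positive integer $k$, a $k$-(2,1)-total labelling of a graph $G$ is a function $c: V(G)\cup E(G)\to\{0,1,\dots,k\}$ such that $c(u)\neq c(v)$ whenever $uv\in E(G)$; $c(e)\neq c(e')$ whenever $e$ and $e'$ are two adjacent edges (distinct edges sharing an endpoint); and $|c(u)-c(e)|\geq 2$ whenever the vertex $u$ is incident with the edge $e$. The (2,1)-total labelling number $\lambda_2^T(G)$ is the minimum $k$ such that $G$ has a $k$-(2,1)-total labelling. *)

(* Defs.v *)
From HB Require Import structures.
From mathcomp Require Import all_boot all_order all_algebra.
From mathcomp Require Import zify.
From mathcomp Require Import all_classical all_reals all_analysis.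

Set Implicit Arguments.
Unset Strict Implicit.
Unset Printing Implicit Defensive.

Import numFieldNormedType.Exports.

Record sgraph := SGraph {
  vertex :> finType;
  adj : rel vertex;
  adj_sym : symmetric adj;
  adj_irrefl : irreflexive adj }.

Definition degree (G : sgraph) (x : G) : nat := #|[set y | adj x y]|.

Definition max_degree (G : sgraph) : nat := \max_(x : G) degree x.

Definition edge_set (G : sgraph) : {set {set G}} :=
  [set [set p.1; p.2] | p : G * G & adj p.1 p.2].

(* E(G): an edge is the set of its two ends. *)
Definition edge (G : sgraph) := {A : {set G} | A \in edge_set G}.

Definition incident (G : sgraph) (x : G) (a : edge G) : bool := x \in val a.

Definition adjacent_edges (G : sgraph) (a b : edge G) : bool :=
  (a != b) && [exists x : G, incident x a && incident x b].

(* The disjoint sum G + edge G is V(G) \cup E(G); the labels 0, ..., k are the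
   elements of 'I_k.+1.  The distance `|i - j|%N is that of the integers, not
   truncated subtraction. *)
Definition is_labelling21 (G : sgraph) (k : nat)
    (c : {ffun G + edge G -> 'I_k.+1}) : bool :=
  [&& [forall x : G, forall y : G, adj x y ==> (c (inl x) != c (inl y))],
      [forall a : edge G, forall b : edge G,
        adjacent_edges a b ==> (c (inr a) != c (inr b))]
    & [forall x : G, forall a : edge G,
        incident x a ==> (2 <= `|c (inl x) - c (inr a)|)%N]].

Definition has_labelling21 (G : sgraph) (k : nat) : bool :=
  (0 < k) && [exists c : {ffun G + edge G -> 'I_k.+1}, is_labelling21 c].

Lemma has_labelling21_ex (G : sgraph) : exists k, has_labelling21 G k.
Proof.
pose N := #|{: G + edge G}|.
exists N.*2.+1; apply/andP; split=> //; apply/existsP.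
have rank_lt (z : G + edge G) : (enum_rank z).*2 < N.*2.+2.
  by rewrite (@leq_trans N.*2) ?ltn_double// ltnW.
exists [ffun z => Ordinal (rank_lt z)].
have inj z t : z != t -> Ordinal (rank_lt z) != Ordinal (rank_lt t).
  apply: contra_neq => /(congr1 val)/= /double_inj zt.
  exact/enum_rank_inj/val_inj.
apply/and3P; split; apply/forallP => x; apply/forallP => y; apply/implyP.
- move=> xy; rewrite !ffunE inj//; apply/eqP => -[exy].
  by rewrite exy adj_irrefl in xy.
- by case/andP=> neq_xy _; rewrite !ffunE inj.
have dist m n : m != n -> (1 < `|m.*2 - n.*2|)%N by lia.
move=> _; rewrite !ffunE /= dist//.
by apply/eqP => /val_inj/enum_rank_inj.
Qed.

Definition lambda2T (G : sgraph) : nat := ex_minn (has_labelling21_ex G).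

Local Open Scope classical_set_scope.
Local Open Scope ring_scope.

(* A crossing-free drawing of G in the plane R^2: distinct points for the
   vertices, and for each edge a simple arc, parametrized by [0, 1], joining the
   points of its two ends; the interior of an arc meets no vertex and no other
   arc.  An arc has no preferred direction, hence the equation on the sets of
   endpoints. *)
Definition plane_drawing (R : realType) (G : sgraph)
    (pos : G -> R * R) (arc : edge G -> R -> R * R) : Prop :=
  [/\ injective pos,
      forall a, {within `[0, 1], continuous (arc a)} /\
                {in `[0, 1] &, injective (arc a)},
      forall a, [set arc a 0; arc a 1] = [set pos x | x in [set x | incident x a]],
      forall a x t, t \in `]0, 1[ -> arc a t <> pos x
    & forall a b s t, a != b -> s \in `]0, 1[ -> t \in `]0, 1[ ->
        arc a s <> arc b t].

Definition planar (R : realType) (G : sgraph) : Prop :=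
  exists (pos : G -> R * R) (arc : edge G -> R -> R * R),
    plane_drawing pos arc.

(* Main.v *)
Require Import Defs.
From mathcomp Require Import all_boot zify.
From mathcomp Require boolp.
Set Implicit Arguments.
Unset Strict Implicit.
Unset Printing Implicit Defensive.

(** The lower bound is local: the edges at a vertex of maximum degree have distinct labels, and
    the label of the vertex excludes itself and at least one neighbouring label from them.

    For the upper bound, put M = Delta >= 12 and use the labels 0, ..., M + 2.  Take a planar
    graph of maximum degree at most M that has no labelling although every graph obtained by
    deleting edges has one.  Its sparse places are restricted, and discharging shows that the
    restrictions contradict planarity.

    Reducible configurations.  Deleting one edge uv and recolouring u shows that a vertex of
    degree at most 3 has only neighbours of degree at least M - 1 ([deg_sum_le3]) and a vertex of
    degree 4 only neighbours of degree at least M - 4 ([deg_nb4]).  Call a vertex light if its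
    degree is at most 3, or if it is a vertex of degree 5 most of whose neighbours are small
    ([light]).  If there were more than two light vertices for each vertex of degree M and one
    for each vertex of degree M - 1, then Hall's theorem would provide a set X of light vertices
    in which each vertex of degree M has two private neighbours and each one of degree M - 1 has
    one; delete the edges at X, label the rest, put labels on the edges between X and the big
    vertices by Galvin's list colouring of bipartite graphs, and complete X vertex by vertex.
    So light vertices are few ([card_light]).  The same argument with one private neighbour
    forbids two vertices of degree 2 with the same neighbours ([no_twins]).

    Planarity is used through MacLane's criterion ([maclane_faces]): there are at least
    #|E| - #|V| + 1 distinct nonempty even sets of edges, called faces, such that every edge lies
    in at most two of them.  To obtain them, sample the arcs of the drawing finely enough to see
    the graph as a minor of a square grid ([grid_model_of_drawing]).  In the grid every even edge
    set is a sum of unit squares, as one sees by counting the edges below each square, and the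
    property passes to minors by merging the squares that are not separated by the minor.

    Discharging.  Give 8 (d - 6) units to a vertex of degree d, 8 (2 l - 6) to a face with l
    edges and 16 to each missing side of an edge; the total is at most -48.  Every vertex of
    degree at most 5 receives what it lacks: 12 units per light vertex from the vertices of degree
    M and M - 1, which [card_light] pays for, and the rest through the faces around it, from
    large faces and from its neighbours of degree at least 7 ([low_vertex_demand]).  Nothing ends
    negative ([face_pays], [high_vertex_budget]), a contradiction
    ([discharging_contradiction]). *)

(** * Systems of representatives and list edge colouring of bipartite graphs *)

Section Hall.
Variables (A B : finType) (b0 : B).
Implicit Types (D S : {set A}) (N : A -> {set B}).

(** Hall's theorem, by induction on D: the two cases are whether or not some proper part of D
    has no spare representative. *)
Lemma hall_marriage N D :
    (forall S, S \subset D -> #|S| <= #|\bigcup_(a in S) N a|) ->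
  exists2 f : A -> B, {in D &, injective f} & {in D, forall a, f a \in N a}.
Proof.
have [n] := ubnP #|D|; elim: n => // n IHn in N D * => /ltnSE-leDn hallD.
have [->|[a aD]] := set_0Vmem D.
  by exists (fun=> b0) => [x y|x]; rewrite inE.
case: (pickP (fun S : {set A} => [&& S \proper D, S != set0
         & #|\bigcup_(c in S) N c| <= #|S|])) => [S|no_tight].
  (* A tight set S is matched inside its own neighbourhood, the rest outside. *)
  case/and3P=> ltSD S0 tight; have sSD := proper_sub ltSD.
  have [|f finj fN] := IHn N S (leq_trans (proper_card ltSD) leDn).
    by move=> T sTS; apply: hallD; apply: subset_trans sTS sSD.
  pose U := \bigcup_(c in S) N c.
  have [||g ginj gN] := IHn (fun c => N c :\: U) (D :\: S).
  - apply: leq_trans leDn; rewrite cardsD (setIidPr sSD).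
    have := subset_leq_card sSD; have : 0 < #|S| by rewrite card_gt0.
    lia.
  - move=> T sTDS.
    have sTD : T \subset D by apply: subset_trans sTDS (subsetDl _ _).
    have dis : [disjoint T & S].
      by rewrite disjoint_subset; apply/subsetP => x /(subsetP sTDS); rewrite !inE => /andP[].
    have := hallD (T :|: S); rewrite subUset sTD sSD => /(_ isT).
    rewrite cardsU (eqP (_ : T :&: S == set0)); last by rewrite setI_eq0.
    rewrite cards0 subn0 bigcup_setU -/U.
    have -> : \bigcup_(c in T) N c :|: U = (\bigcup_(c in T) (N c :\: U)) :|: U.
      apply/setP => y; rewrite !inE; case: (boolP (y \in U)) => [|yU]; first by rewrite !orbT.
      rewrite !orbF; apply/bigcupP/bigcupP => -[c cT yc]; exists c => //.
        by rewrite inE yU yc.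
      by move: yc; rewrite inE => /andP[].
    move=> h; have := leq_trans h (leq_card_setU _ _).1; move: tight; rewrite -/U; lia.
  exists (fun x => if x \in S then f x else g x) => [x y xD yD|x xD] /=.
    have fU z : z \in S -> f z \in U by move=> zS; apply/bigcupP; exists z; rewrite ?fN.
    have gU z : z \in D -> z \notin S -> g z \notin U.
      by move=> zD zS; have := gN z; rewrite !inE zD zS => /(_ isT) /andP[].
    case: ifPn => xS; case: ifPn => yS eqxy.
    - exact: finj.
    - by have := gU y yD yS; rewrite -eqxy fU.
    - by have := gU x xD xS; rewrite eqxy fU.
    - by apply: ginj eqxy; rewrite inE ?xS ?yS.
  case: ifPn => xS; first exact: fN.
  by have := gN x; rewrite !inE xS xD => /(_ isT) /andP[].
(* No tight proper subset: any choice for a leaves enough room. *)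
have [b bNa] : exists b, b \in N a.
  have := hallD [set a]; rewrite sub1set aD cards1 big_set1 => /(_ isT).
  by rewrite card_gt0 => /set0Pn.
have [||f finj fN] := IHn (fun c => N c :\ b) (D :\ a).
- have cD := cardsD1 a D; rewrite aD in cD; lia.
- move=> T sTD.
  have [->|T0] := eqVneq T set0; first by rewrite cards0.
  have ltTD : T \proper D by apply: sub_proper_trans sTD (properD1 aD).
  have := no_tight T; rewrite ltTD T0 /= => /negbT; rewrite -ltnNge => big.
  have -> : \bigcup_(c in T) (N c :\ b) = (\bigcup_(c in T) N c) :\ b.
    apply/setP => y; rewrite !inE; apply/bigcupP/andP => [[c cT]|[yb /bigcupP[c cT yc]]].
      by rewrite !inE => /andP[-> yc]; split=> //; apply/bigcupP; exists c.
    by exists c; rewrite // !inE yb.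
  by move: big (cardsD1 b (\bigcup_(c in T) N c)); case: (b \in _) => /=; lia.
exists (fun x => if x == a then b else f x) => [x y xD yD|x xD] /=.
  have fb z : z \in D -> z != a -> f z != b.
    by move=> zD za; have := fN z; rewrite !inE za zD => /(_ isT) /andP[].
  case: eqP => [->|/eqP xa]; case: eqP => [->|/eqP ya] // eqxy.
  - by have := fb y yD ya; rewrite -eqxy eqxx.
  - by have := fb x xD xa; rewrite eqxy eqxx.
  - by apply: finj eqxy; rewrite !inE ?xa ?ya.
case: eqP => [->//|/eqP xa].
by have := fN x; rewrite !inE xa xD => /(_ isT) /andP[].
Qed.

(** The element with the longest list is served last: by hypothesis its list then has more
    elements than there are representatives already in use. *)
Lemma greedy_sdr N D :
    (forall j, #|[set a in D | #|N a| <= j]| <= j) ->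
  exists2 f : A -> B, {in D &, injective f} & {in D, forall a, f a \in N a}.
Proof.
have [n] := ubnP #|D|; elim: n => // n IHn in D * => /ltnSE-leDn few.
have [->|[a0 a0D]] := set_0Vmem D.
  by exists (fun=> b0) => [x y|x]; rewrite inE.
case: (arg_maxnP (fun a => #|N a|) a0D) => a /= aD' amax.
have aD : a \in D by [].
have cardD := cardsD1 a D; rewrite aD in cardD.
have [||f finj fN] := IHn (D :\ a); first by lia.
  move=> j; apply: leq_trans (few j); apply: subset_leq_card.
  by apply/subsetP => x; rewrite !inE => /andP[/andP[_ ->] ->].
have /subsetPn[b bN bf] : ~~ (N a \subset f @: (D :\ a)).
  apply/negP => /subset_leq_card leNf; have := leq_imset_card f (D :\ a).
  have := few #|D :\ a|; suff -> : [set x in D | #|N x| <= #|D :\ a|] = D by lia.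
  apply/setP => x; rewrite inE; case xD: (x \in D) => //=.
  have /= := amax x xD; have := leq_imset_card f (D :\ a); lia.
have fb z : z \in D -> z != a -> f z != b.
  move=> zD za; apply: contraNneq bf => <-; apply: imset_f; by rewrite !inE za.
exists (fun x => if x == a then b else f x) => [x y xD yD|x xD] /=.
  case: eqP => [->|/eqP xa]; case: eqP => [->|/eqP ya] // eqxy.
  - by have := fb y yD ya; rewrite -eqxy eqxx.
  - by have := fb x xD xa; rewrite eqxy eqxx.
  - by apply: finj eqxy; rewrite !inE ?xa ?ya.
case: eqP => [->//|/eqP xa].
by apply: fN; rewrite !inE xa.
Qed.

End Hall.

Section Galvin.
Variables (E X Y C : finType) (c0 : C) (px : E -> X) (py : E -> Y).
Variables (ox oy : E -> nat).
Hypothesis ox_inj : forall e e', px e = px e' -> ox e = ox e' -> e = e'.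
Hypothesis oy_inj : forall e e', py e = py e' -> oy e = oy e' -> e = e'.

(** Small ranks are preferred. *)
Definition prefx k e := (px k == px e) && (ox k < ox e).
Definition prefy k e := (py k == py e) && (oy k < oy e).

(** Every edge is proposed to its Y-end by its X-end, in the order of preference.  If a Y-end
    has two proposals, the one that it likes less may be deleted: whatever dominates the other
    one at this Y-end dominates both. *)
Lemma stable_matching (A : {set E}) :
  exists2 K : {set E}, K \subset A &
    {in K &, forall e e', e != e' -> px e != px e' /\ py e != py e'} /\
    {in A :\: K, forall e, exists2 k, k \in K & prefx k e || prefy k e}.
Proof.
have [n] := ubnP #|A|; elim: n => // n IHn in A * => /ltnSE-leAn.
pose top e := [forall k in A, ~~ prefx k e].
have topP e : e \in A -> exists2 t, t \in A & top t && ((t == e) || prefx t e).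
  move=> eA; pose P k := (k \in A) && (px k == px e).
  have Pe : P e by rewrite /P eA eqxx.
  case: (arg_minnP ox Pe) => t /andP[tA /eqP pt] tmin.
  exists t => //; apply/andP; split.
    apply/forall_inP => k kA; apply/andP => -[/eqP pk]; rewrite ltnNge tmin //.
    by rewrite /P kA pk pt eqxx.
  have := tmin e Pe; rewrite leq_eqVlt => /orP[/eqP eo|lt].
    by rewrite (ox_inj pt eo) eqxx.
  by rewrite /prefx pt eqxx lt orbT.
case: (boolP [exists e1 in A, exists e2 in A, top e2 && prefy e2 e1]); last first.
  move=> none; exists [set e in A | top e]; first by apply/subsetP => x; rewrite inE => /andP[].
  split=> [e e'|e].
    rewrite !inE => /andP[eA te] /andP[e'A te'] ne.
    split; apply/negP => /eqP peq.
      case: (ltngtP (ox e) (ox e')) => [lt|lt|eqo]; last by rewrite (ox_inj peq eqo) eqxx in ne.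
        by have /forall_inP/(_ e eA) := te'; rewrite /prefx peq eqxx lt.
      by have /forall_inP/(_ e' e'A) := te; rewrite /prefx peq eqxx lt.
    case: (ltngtP (oy e) (oy e')) => [lt|lt|eqo]; last by rewrite (oy_inj peq eqo) eqxx in ne.
      move/negP: none; apply; apply/existsP; exists e'; rewrite e'A; apply/existsP; exists e.
      by rewrite eA te /prefy peq eqxx lt.
    move/negP: none; apply; apply/existsP; exists e; rewrite eA; apply/existsP; exists e'.
    by rewrite e'A te' /prefy peq eqxx lt.
  rewrite !inE negb_and => /andP[+ eA]; rewrite eA /= => nte.
  have [t tA /andP[tt]] := topP e eA.
  case/orP => [/eqP te|pr]; first by rewrite -te tt in nte.
  by exists t; rewrite ?inE ?tA ?tt ?pr.
(* The edge e1 is rejected by its Y-end in favour of e2, the first choice of its X-end. *)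
case/exists_inP => e1 e1A /exists_inP[e2 e2A /andP[te2 pr]].
have := cardsD1 e1 A; rewrite e1A => cA.
have [|K sKA [Kind Kdom]] := IHn (A :\ e1); first by lia.
exists K; first by apply: subset_trans sKA (subsetDl _ _).
split=> // e; rewrite !inE => /andP[eK eA].
have [ee1|ee1] := eqVneq e e1; last by apply: Kdom; rewrite !inE eK ee1.
have e21 : e2 != e1 by apply: contraTneq pr => ->; rewrite /prefy ltnn andbF.
rewrite ee1; case: (boolP (e2 \in K)) => e2K; first by exists e2 => //; rewrite pr orbT.
have [|k kK] := Kdom e2; first by rewrite !inE e2K e21.
have kA : k \in A by have := subsetP sKA k kK; rewrite !inE => /andP[].
case/orP => [px2|/andP[/eqP pk ok]].
  by have /forall_inP/(_ k kA) := te2; rewrite px2.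
exists k => //; case/andP: pr => /eqP p21 o21.
by rewrite /prefy pk p21 eqxx (ltn_trans ok o21) orbT.
Qed.

Definition dominators (D : {set E}) e :=
  #|[set k in D | prefx k e]| + #|[set k in D | prefy k e]|.

(** Give the label a to a stable matching of the edges that have a in their lists.  An edge that
    loses a from its list also loses a dominating edge, so the inequality between dominators and
    list sizes persists. *)
Lemma galvin_list_colouring (L : E -> {set C}) (D : {set E}) :
    {in D, forall e, dominators D e < #|L e|} ->
  exists2 c : E -> C, {in D, forall e, c e \in L e} &
    {in D &, forall e e', e != e' -> (px e == px e') || (py e == py e') -> c e != c e'}.
Proof.
have [n] := ubnP #|D|; elim: n => // n IHn in D L * => /ltnSE-leDn big.
have [->|[d dD]] := set_0Vmem D.
  by exists (fun=> c0) => [x|x y]; rewrite inE.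
have [a aLd] : exists a, a \in L d.
  by apply/set0Pn; rewrite -card_gt0; apply: leq_ltn_trans (big d dD).
have [K sKD [Kind Kdom]] := stable_matching [set e in D | a \in L e].
have [k0 k0K] : exists k, k \in K.
  case: (boolP (d \in K)) => [dK|dK]; first by exists d.
  by have [|k kK _] := Kdom d; [rewrite !inE dK dD aLd | exists k].
have KD k : k \in K -> k \in D by move/(subsetP sKD); rewrite inE => /andP[].
have Ka k : k \in K -> a \in L k by move/(subsetP sKD); rewrite inE => /andP[].
have [||c cL cprop] := IHn (D :\: K) (fun e => L e :\ a).
- have sub : D :\: K \subset D :\ k0.
    by apply/subsetP => x; rewrite !inE => /andP[xK ->]; rewrite andbT; apply: contraNneq xK => ->.
  by move: (subset_leq_card sub) (cardsD1 k0 D) leDn; rewrite (KD _ k0K); lia.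
- move=> e; rewrite inE => /andP[eK eD].
  have := big e eD; have := cardsD1 a (L e).
  have subx : [set k in D :\: K | prefx k e] \subset [set k in D | prefx k e].
    by apply/subsetP => x; rewrite !inE => /andP[/andP[_ ->] ->].
  have suby : [set k in D :\: K | prefy k e] \subset [set k in D | prefy k e].
    by apply/subsetP => x; rewrite !inE => /andP[/andP[_ ->] ->].
  rewrite /dominators; case: (boolP (a \in L e)) => [aLe|_] /=; last first.
    by move: (subset_leq_card subx) (subset_leq_card suby); clear; lia.
  have [|k kK /orP[pk|pk]] := Kdom e; first by rewrite !inE eK eD aLe.
    have : [set k in D :\: K | prefx k e] \proper [set k in D | prefx k e].
      by apply/properP; split=> //; exists k; rewrite !inE ?KD ?kK ?pk.
    by move/proper_card; move: (subset_leq_card suby); clear; lia.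
  have : [set k in D :\: K | prefy k e] \proper [set k in D | prefy k e].
    by apply/properP; split=> //; exists k; rewrite !inE ?KD ?kK ?pk.
  by move/proper_card; move: (subset_leq_card subx); clear; lia.
have ca e : e \in D -> e \notin K -> c e != a.
  by move=> eD eK; have := cL e; rewrite !inE eK eD => /(_ isT) /andP[].
exists (fun e => if e \in K then a else c e) => [e eD|e e' eD e'D ne adj] /=.
  case: ifPn => eK; first exact: Ka.
  by have := cL e; rewrite !inE eK eD => /(_ isT) /andP[].
case: ifPn => eK; case: ifPn => e'K.
- by have [/negPf px' /negPf py'] := Kind e e' eK e'K ne; rewrite px' py' in adj.
- by rewrite eq_sym ca.
- exact: ca.
- by apply: cprop => //; rewrite !inE ?eK ?e'K ?eD ?e'D.
Qed.

End Galvin.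

(** * Partial labellings and available labels *)

Definition far (a b : nat) := (a + 2 <= b) || (b + 2 <= a).

Lemma farC a b : far a b = far b a.
Proof. by rewrite /far orbC. Qed.

Definition nears n (a : 'I_n) : {set 'I_n} := [set b : 'I_n | ~~ far a b].

Lemma card_ord_le1 n (P : pred 'I_n) :
  (forall a b, P a -> P b -> a = b :> nat) -> #|P| <= 1.
Proof.
move=> uniqP; apply/card_le1P => a aP b; rewrite [b \in pred1 a]inE.
apply/idP/eqP => [bP|->//]; exact/val_inj/uniqP.
Qed.

Lemma nears_sub n (a : 'I_n) :
  nears a = [set b : 'I_n | b == a :> nat] :|: [set b : 'I_n | b == a.+1 :> nat]
            :|: [set b : 'I_n | b.+1 == a :> nat].
Proof. by apply/setP => b; rewrite !inE /far; lia. Qed.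

Lemma card_nears n (a : 'I_n) : #|nears a| <= 3.
Proof.
have one (P : pred 'I_n) : (forall a b, P a -> P b -> a = b :> nat) -> #|[set b | P b]| <= 1.
  by rewrite cardsE; apply: card_ord_le1.
rewrite nears_sub; apply: leq_trans (leq_card_setU _ _).1 _.
have h1 : #|[set b : 'I_n | b == a :> nat]| <= 1 by apply: one => *; lia.
have h2 : #|[set b : 'I_n | b == a.+1 :> nat]| <= 1 by apply: one => *; lia.
have h3 : #|[set b : 'I_n | b.+1 == a :> nat]| <= 1 by apply: one => *; lia.
by apply: (leq_add (leq_trans (leq_card_setU _ _).1 (leq_add h1 h2)) h3).
Qed.

(** If the window around every label of S lay inside W, then W would contain S together with the
    successor of its maximum and the predecessor of its minimum. *)
Lemma good_interval n (W S : {set 'I_n}) s0 :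
    s0 \in S -> #|W| < #|S| + 2 ->
  exists2 s, s \in S & #|W| <= #|W :\: nears s| + 2.
Proof.
move=> s0S ltWS; case: (boolP [exists s in S, #|W| <= #|W :\: nears s| + 2]).
  by case/exists_inP => s; exists s.
rewrite negb_exists_in => /forall_inP bad.
have {}bad s : s \in S -> [&& s \in W, [exists b in W, b == s.+1 :> nat]
                           & [exists b in W, b.+1 == s :> nat]].
  move=> sS; have := bad s sS; rewrite -ltnNge -(cardsID (nears s) W) [X in _ < X]addnC ltn_add2l.
  move=> ge3; have one (P Q : pred 'I_n) : (forall a b, P a -> P b -> a = b :> nat) ->
      (forall a b, Q a -> Q b -> a = b :> nat) ->
      W :&: nears s \subset [set b | P b || Q b] -> False.
    move=> uP uQ /subset_leq_card; apply/negP; rewrite -ltnNge.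
    apply: leq_ltn_trans ge3; apply: (@leq_trans (#|[set b | P b]| + #|[set b | Q b]|)).
      apply: leq_trans (leq_card_setU _ _).1; apply: subset_leq_card.
      by apply/subsetP => b; rewrite !inE.
    by rewrite !cardsE -(addn1 1); apply: leq_add; apply: card_ord_le1.
  apply/and3P; split; apply: contraT => no.
  - case: (one (fun b => b == s.+1 :> nat) (fun b => b.+1 == s :> nat)); [lia|lia|].
    apply/subsetP => b; rewrite nears_sub !inE => /andP[bW].
    case/orP=> [/orP[/eqP/val_inj bs|->]|->]; rewrite ?orbT //.
    by rewrite -bs bW in no.
  - case: (one (fun b => b == s :> nat) (fun b => b.+1 == s :> nat)); [lia|lia|].
    apply/subsetP => b; rewrite nears_sub !inE => /andP[bW].
    case/orP=> [/orP[->|bs]|->]; rewrite ?orbT //.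
    by case/existsP: no; exists b; rewrite bW.
  - case: (one (fun b => b == s :> nat) (fun b => b == s.+1 :> nat)); [lia|lia|].
    apply/subsetP => b; rewrite nears_sub !inE => /andP[bW].
    case/orP=> [/orP[->|->]|bs]; rewrite ?orbT //.
    by case/existsP: no; exists b; rewrite bW.
have /= := arg_maxnP (fun i : 'I_n => i : nat) s0S; case=> hi hiS himax.
have /= := arg_minnP (fun i : 'I_n => i : nat) s0S; case=> lo loS lomin.
have /and3P[_ /existsP[b /andP[bW /eqP bhi]] _] := bad hi hiS.
have /and3P[_ _ /existsP[c /andP[cW /eqP clo]]] := bad lo loS.
have : b |: (c |: S) \subset W.
  by rewrite !subUset !sub1set bW cW; apply/subsetP => s /bad/and3P[].
move/subset_leq_card; rewrite !cardsU1 !inE.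
have -> : c \in S = false by apply: contraTF isT => /lomin /=; lia.
have -> : b \in S = false by apply: contraTF isT => /himax /=; lia.
have -> : b == c = false.
  by have /= := himax lo loS; move: bhi clo; rewrite -val_eqE /=; clear; lia.
by move: ltWS; clear; lia.
Qed.

(** A list L0 of available labels of an edge at x loses the labels Phi of the other edges at x and
    a window of three around the label of x.  When x has five neighbours and f of its edges are
    labelled, the set S of available labels of x has at least 15 - 5 - 3 f elements, enough to
    choose the window so that only two labels are lost. *)
Lemma good_vertex_label n (L0 Phi S : {set 'I_n}) f l :
    f <= 2 -> l <= 7 -> 10 - 3 * f <= #|S| -> l <= #|L0| -> #|Phi| <= f ->
  exists2 s, s \in S & l - f - 2 <= #|(L0 :\: Phi) :\: nears s|.
Proof.
move=> f2 l7 Sbig L0big Phif.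
have [s0 s0S] : exists s, s \in S by apply/set0Pn; rewrite -card_gt0; move: f2 Sbig; clear; lia.
set W := L0 :\: Phi.
have Wbig : l - f <= #|W|.
  have := cardsD L0 Phi; rewrite -/W => ->.
  by have := subset_leq_card (subsetIr L0 Phi); move: L0big Phif; clear; lia.
case: (ltnP #|W| (#|S| + 2)) => [small|big].
  by have [s sS le] := good_interval s0S small; exists s => //; move: le Wbig; clear; lia.
exists s0 => //; have := cardsD W (nears s0); have := card_nears s0.
have := subset_leq_card (subsetIr W (nears s0)); move: big Sbig f2 l7; clear; lia.
Qed.

Section Labelling.
Variables (V : finType) (n : nat).
Implicit Types (U : {set V}) (q : rel V) (cv : V -> 'I_n) (ce : V -> V -> 'I_n).

Definition nbhd q x : {set V} := [set y | q x y].
Definition rdeg q x := #|nbhd q x|.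

(** A labelling of the graph q up to the labels of the vertices in U: these are not subject to any
    constraint, nor do they constrain the rest. *)
Definition plabel U q cv ce :=
  [/\ forall x y, q x y -> ce x y = ce y x,
      forall x y z, q x y -> q x z -> y != z -> ce x y != ce x z,
      forall x y, q x y -> x \notin U -> far (cv x) (ce x y)
    & forall x y, q x y -> x \notin U -> y \notin U -> cv x != cv y].

Lemma eq_plabel U q q' cv ce : q =2 q' -> plabel U q cv ce -> plabel U q' cv ce.
Proof.
move=> eqq [c1 c2 c3 c4]; split=> [x y|x y z|x y|x y]; rewrite -!eqq; auto.
Qed.

Lemma plabel_sub U U' q cv ce : U \subset U' -> plabel U q cv ce -> plabel U' q cv ce.
Proof.
move=> /subsetP sU [c1 c2 c3 c4]; split=> // [x y qxy xU|x y qxy xU yU].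
  by apply: c3 => //; apply: contraNN xU => /sU.
by apply: c4 => //; [apply: contraNN xU => /sU | apply: contraNN yU => /sU].
Qed.

Definition avail_edge q cv ce z : {set 'I_n} :=
  [set a : 'I_n | far (cv z) a & [forall t, q z t ==> (a != ce z t)]].

Lemma card_avail_edge q cv ce z : n <= #|avail_edge q cv ce z| + 3 + rdeg q z.
Proof.
rewrite -[leqLHS]card_ord -(cardsC (avail_edge q cv ce z)) -addnA leq_add2l.
have sub : ~: avail_edge q cv ce z \subset nears (cv z) :|: ce z @: nbhd q z.
  apply/subsetP => a; rewrite !inE negb_and => /orP[->//|].
  rewrite negb_forall => /existsP[t]; rewrite negb_imply negbK => /andP[qzt /eqP ->].
  by rewrite imset_f ?orbT // inE.
apply: leq_trans (subset_leq_card sub) _; apply: leq_trans (leq_card_setU _ _).1 _.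
by rewrite leq_add ?card_nears ?leq_imset_card.
Qed.

Definition avail_vertex (N : {set V}) q cv ce x : {set 'I_n} :=
  [set s : 'I_n | [forall y in N, s != cv y] & [forall y, q x y ==> far s (ce x y)]].

Lemma card_avail_vertex N q cv ce x :
  n <= #|avail_vertex N q cv ce x| + #|N| + 3 * rdeg q x.
Proof.
rewrite -[leqLHS]card_ord -(cardsC (avail_vertex N q cv ce x)) -addnA leq_add2l.
have sub : ~: avail_vertex N q cv ce x \subset
    cv @: N :|: \bigcup_(y in nbhd q x) nears (ce x y).
  apply/subsetP => a; rewrite !inE negb_and => /orP[|].
    by rewrite negb_forall_in => /exists_inP[y yN /negPn/eqP ->]; rewrite imset_f.
  rewrite negb_forall => /existsP[y]; rewrite negb_imply => /andP[qxy nf].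
  by apply/orP; right; apply/bigcupP; exists y; rewrite !inE // farC.
apply: leq_trans (subset_leq_card sub) _; apply: leq_trans (leq_card_setU _ _).1 _.
rewrite leq_add ?leq_imset_card //.
apply: leq_trans (_ : \sum_(y in nbhd q x) 3 <= _); last by rewrite sum_nat_const mulnC.
elim/big_ind2: _ => [|A m B k Am Bk|y _]; rewrite ?cards0 ?card_nears //.
by apply: leq_trans (leq_card_setU _ _).1 _; rewrite leq_add.
Qed.

Lemma label_vertex U q cv ce x (s : 'I_n) :
    symmetric q -> irreflexive q -> plabel U q cv ce ->
    (forall y, q x y -> far s (ce x y)) ->
    (forall y, q x y -> y \notin U -> s != cv y) ->
  plabel (U :\ x) q (fun z => if z == x then s else cv z) ce.
Proof.
move=> qs qi [c1 c2 c3 c4] sfar sne; split=> // [a b qab|a b qab].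
  rewrite !inE; case: eqP => [ax|_] /= => [_|aU]; last exact: c3.
  by rewrite ax; apply: sfar; rewrite -ax.
rewrite !inE; case: eqP => [ax|_] /= => [_|aU]; case: eqP => [bx|_] /=.
- by rewrite ax bx qi in qab.
- by move=> bU; apply: sne; rewrite // -ax.
- by move=> _; rewrite eq_sym; apply: sne => //; rewrite qs -bx.
- exact: c4.
Qed.

Definition add_star q x (K : {set V}) : rel V :=
  fun a b => [|| q a b, (a == x) && (b \in K) | (b == x) && (a \in K)].

Definition label_star ce x (K : {set V}) (c : V -> 'I_n) a b :=
  if (a == x) && (b \in K) then c b else if (b == x) && (a \in K) then c a else ce a b.

Lemma label_edges U q cv ce x (K : {set V}) (c : V -> 'I_n) :
    symmetric q -> plabel U q cv ce -> x \in U -> x \notin K ->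
    {in K, forall z, ~~ q x z} -> {in K &, injective c} ->
    (forall z t, z \in K -> q z t -> c z != ce z t) ->
    (forall z t, z \in K -> q x t -> c z != ce x t) ->
    (forall z, z \in K -> z \notin U -> far (cv z) (c z)) ->
  plabel U (add_star q x K) cv (label_star ce x K c).
Proof.
move=> qs [c1 c2 c3 c4] xU xK Kq cinj cz cx cfar.
have Kx z : z \in K -> (z == x) = false by move=> zK; apply: contraNF xK => /eqP <-.
have old a b : q a b -> label_star ce x K c a b = ce a b.
  move=> qab; rewrite /label_star; case: andP => [[/eqP ax bK]|_].
    by rewrite ax (negPf (Kq b bK)) in qab.
  case: andP => [[/eqP bx aK]|//].
  by rewrite bx qs (negPf (Kq a aK)) in qab.
have newl b : b \in K -> label_star ce x K c x b = c b.
  by move=> bK; rewrite /label_star eqxx bK.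
have newr a : a \in K -> label_star ce x K c a x = c a.
  by move=> aK; rewrite /label_star eqxx aK (negPf xK) andbF.
split.
- move=> a b /or3P[qab|/andP[/eqP-> bK]|/andP[/eqP-> aK]]; last by rewrite newl ?newr.
    by rewrite !old //; [apply: c1 | rewrite qs].
  by rewrite newl ?newr.
- move=> a b d /or3P[qab|/andP[/eqP ax bK]|/andP[/eqP bx aK]];
    case/or3P => [qad|/andP[/eqP ax' dK]|/andP[/eqP dx aK']] ne.
  + by rewrite !old //; apply: c2 ne.
  + by rewrite old // ax' newl // eq_sym; apply: cx => //; rewrite -ax'.
  + by rewrite old // dx newr // eq_sym; apply: cz.
  + by rewrite ax newl // old -?ax //; rewrite ax in qad *; apply: cx.
  + by rewrite ax !newl //; apply: contraNneq ne => /cinj->.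
  + by rewrite ax (negPf xK) in aK'.
  + by rewrite bx newr // old //; apply: cz.
  + by rewrite ax' (negPf xK) in aK.
  + by rewrite bx dx eqxx in ne.
- move=> a b /or3P[qab|/andP[/eqP-> bK]|/andP[/eqP-> aK]] aU.
  + by rewrite old //; apply: c3.
  + by rewrite xU in aU.
  + by rewrite newr //; apply: cfar.
- move=> a b /or3P[qab|/andP[/eqP-> bK]|/andP[/eqP-> aK]] aU bU.
  + exact: c4.
  + by rewrite xU in aU.
  + by rewrite xU in bU.
Qed.

End Labelling.

(** * Reducible configurations *)

Lemma card_nearsI n (s s' : 'I_n) : s != s' -> #|nears s :&: nears s'| <= 2.
Proof.
wlog lts : s s' / s < s'.
  move=> main ne; case: (ltngtP s s') => [lt|lt|/val_inj eq]; first exact: main.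
    by rewrite setIC; apply: main => //; rewrite eq_sym.
  by rewrite eq eqxx in ne.
move=> _.
have sub : nears s :&: nears s' \subset
    [set b : 'I_n | b == s' :> nat] :|: [set b : 'I_n | b.+1 == s' :> nat].
  by apply/subsetP => b; rewrite !inE /far; move: lts; clear; lia.
apply: leq_trans (subset_leq_card sub) _; apply: leq_trans (leq_card_setU _ _).1 _.
by rewrite !cardsE -(addn1 1) leq_add //; apply: card_ord_le1 => a b; lia.
Qed.

Section Minimal.
Variables (V : finType) (M : nat) (r : rel V).
Hypotheses (rs : symmetric r) (ri : irreflexive r) (M12 : 12 <= M).
Hypothesis degM : forall x, rdeg r x <= M.
Hypothesis Hmin : forall r' : rel V, symmetric r' -> (forall x y, r' x y -> r x y) ->
  (exists x y, r x y && ~~ r' x y) ->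
  exists (cv : V -> 'I_M.+3) ce, plabel set0 r' cv ce.
Hypothesis Hbad : forall (cv : V -> 'I_M.+3) ce, ~ plabel set0 r cv ce.

Local Notation nb := (nbhd r).
Local Notation deg := (rdeg r).
Implicit Types (u v w x y z : V) (U X : {set V}).

Definition remove u v : rel V :=
  fun a b => r a b && ~~ ((a == u) && (b == v) || (a == v) && (b == u)).

Lemma remove_sym u v : symmetric (remove u v).
Proof.
move=> a b; rewrite /remove rs; congr (_ && ~~ _).
by rewrite orbC [in RHS]andbC [(b == v) && _]andbC.
Qed.

Lemma deg_remove_l u v : r u v -> rdeg (remove u v) u < deg u.
Proof.
move=> ruv; apply/proper_card/properP; split.
  by apply/subsetP => z; rewrite !inE => /andP[].
by exists v; rewrite !inE ?ruv // /remove !eqxx andbF.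
Qed.

Lemma deg_remove_r u v : r u v -> rdeg (remove u v) v < deg v.
Proof.
move=> ruv; apply/proper_card/properP; split.
  by apply/subsetP => z; rewrite !inE => /andP[].
by exists u; rewrite !inE 1?rs ?ruv // /remove !eqxx orbT andbF.
Qed.

Definition edge_labels u v (cv : V -> 'I_M.+3) ce :=
  avail_edge (remove u v) cv ce v :\: ce u @: nbhd (remove u v) u.

(** Label the graph without uv and forget the label of u: the remaining choices for u and for uv
    are all incompatible. *)
Lemma no_recolouring u v : r u v ->
  exists (cv : V -> 'I_M.+3) ce,
    [/\ M.+3 <= #|edge_labels u v cv ce| + deg u + deg v + 1,
        M.+3 <= #|avail_vertex (nb u) (remove u v) cv ce u| + 4 * deg u - 3
      & forall s a, s \in avail_vertex (nb u) (remove u v) cv ce u ->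
           a \in edge_labels u v cv ce -> ~~ far s a].
Proof.
move=> ruv; have [|x y||cv [ce lab]] := Hmin (r' := remove u v).
- exact: remove_sym.
- by case/andP.
- by exists u, v; rewrite ruv /remove !eqxx andbF.
exists cv, ce; have ltu := deg_remove_l ruv; have ltv := deg_remove_r ruv; split.
- have h1 := card_avail_edge (remove u v) cv ce v.
  have h2 : #|avail_edge (remove u v) cv ce v| - rdeg (remove u v) u
             <= #|edge_labels u v cv ce|.
    rewrite cardsD leq_sub2l //; apply: leq_trans (subset_leq_card (subsetIr _ _)) _.
    exact: leq_imset_card.
  by move: ltu ltv h1 h2; clear; lia.
- have := card_avail_vertex (nb u) (remove u v) cv ce u.
  by rewrite -/(deg u); move: ltu; clear; lia.
move=> s a; rewrite !inE => /andP[/forall_inP sne /forallP sfar].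
case/andP=> [/imsetP anu /andP[afar /forallP anv]]; apply/negP => sa.
have uv : u != v by apply: contraTneq ruv => ->; rewrite ri.
have := @label_edges _ _ [set u] _ _ _ u [set v] (fun=> a) (@remove_sym u v)
          (plabel_sub (sub0set [set u]) lab).
case=> //.
- by rewrite inE.
- by rewrite inE.
- by move=> z; rewrite inE => /eqP ->; rewrite /remove !eqxx andbF.
- by move=> z t; rewrite !inE => /eqP -> /eqP ->.
- move=> z t; rewrite inE => /eqP -> qvt; exact: (implyP (anv t)).
- by move=> z t _ qut; apply/eqP => at'; apply: anu; exists t; rewrite ?inE.
- by move=> z; rewrite inE => /eqP ->.
set ce' := label_star _ _ _ _ => e1 e2 e3 e4.
have /eq_plabel : add_star (remove u v) u [set v] =2 r.
  move=> b c; rewrite /add_star /remove !inE.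
  apply/or3P/idP => [[/andP[]//|/andP[/eqP-> /eqP->]//|/andP[/eqP-> /eqP->]]|rbc].
    by rewrite rs.
  rewrite rbc /=; case: (boolP ((b == u) && (c == v))) => [|_]; first by constructor 2.
  by case: (boolP ((b == v) && (c == u))) => [/andP[-> ->]|_]; [constructor 3|constructor 1].
move=> /(_ _ [set u] cv ce'); case; first by split.
move=> c1 c2 c3 c4.
have := @label_vertex _ _ [set u] r cv ce' u s rs ri (And4 c1 c2 c3 c4).
rewrite setDv => bad; apply: Hbad (bad _ _).
  move=> y ruy; rewrite /ce' /label_star eqxx !inE /=; case: eqP => //= /eqP yv.
  rewrite (negPf uv) /= andbF; apply: (implyP (sfar y)); rewrite /remove ruy /=.
  by rewrite eqxx (negPf yv) (negPf uv).
by move=> y ruy _; apply: sne; rewrite inE.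
Qed.

Lemma deg_sum_le3 u v : r u v -> deg u <= 3 -> M + 2 <= deg u + deg v.
Proof.
move=> ruv du; rewrite leqNgt; apply/negP => small.
have [cv [ce [Abig Sbig no]]] := no_recolouring ruv.
have /set0Pn[a aA] : edge_labels u v cv ce != set0.
  by rewrite -card_gt0; move: Abig small; clear; lia.
set S := avail_vertex _ _ _ _ _ in Sbig no.
have /set0Pn[s] : S :\: nears a != set0.
  rewrite -card_gt0 cardsD; have := subset_leq_card (subsetIr S (nears a)).
  have := card_nears a; move: Sbig du M12; clear; lia.
rewrite inE => /andP[sa sS]; have := no s a sS aA.
by move: sa; rewrite inE negbK farC => ->.
Qed.

(** There are two candidates for the label of u, which together exclude at most two labels of uv,
    while uv has three candidates if deg v is small. *)
Lemma deg_nb4 u v : r u v -> deg u = 4 -> M - 4 <= deg v.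
Proof.
move=> ruv du; rewrite leqNgt; apply/negP => small.
have [cv [ce [Abig Sbig no]]] := no_recolouring ruv.
set S := avail_vertex _ _ _ _ _ in Sbig no; set A := edge_labels _ _ _ _ in Abig no.
have /card_gt1P[s [s' [sS s'S ne]]] : 1 < #|S| by move: Sbig du M12; clear; lia.
suff /subset_leq_card : A \subset nears s :&: nears s'.
  move=> /leq_trans/(_ (card_nearsI ne)).
  by move: Abig small du M12; clear; lia.
by apply/subsetP => a aA; rewrite !inE !no.
Qed.

Definition big x := M - 4 <= deg x.
Definition bignb x : {set V} := [set y in nb x | big y].

(** The vertices of degree 5 that can be completed after their edges to big vertices: at most two
    labels are then fixed around them, and two of their other edges have long lists. *)
Definition typeA x := [&& deg x == 5, #|bignb x| <= 2 &
  (2 <= #|[set y in nb x | deg y <= M - 6]|) || (0 < #|[set y in nb x | deg y <= M - 7]|)].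

Definition light x := (0 < deg x <= 3) || typeA x.

Lemma light_le5 x : light x -> deg x <= 5.
Proof. by case/orP => [/andP[]|/and3P[/eqP->]] //; lia. Qed.

Lemma big_not_light x : big x -> ~~ light x.
Proof. by rewrite /big => bx; apply/negP => /light_le5; move: bx M12; clear; lia. Qed.

Lemma low_nb_big x y : deg x <= 3 -> r x y -> big y.
Proof. by move=> dx rxy; have := deg_sum_le3 rxy dx; rewrite /big; move: dx M12; clear; lia. Qed.

Lemma bignb_le3 x : light x -> #|bignb x| <= 3.
Proof.
case/orP => [/andP[_ dx]|/and3P[_ le _]]; last exact: leq_trans le _.
apply: leq_trans dx; apply: subset_leq_card; apply/subsetP => y; by rewrite !inE => /andP[].
Qed.

(** The edges that are labelled when exactly the vertices of U remain to be completed: those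
    outside U, and those joining U to big vertices. *)
Definition done_edges U : rel V :=
  fun a b => [&& r a b, (a \in U) ==> big b & (b \in U) ==> big a].

Lemma done_edges_sym U : symmetric (done_edges U).
Proof. by move=> a b; rewrite /done_edges rs [X in _ && X]andbC. Qed.

Lemma done_edges_irr U : irreflexive (done_edges U).
Proof. by move=> a; rewrite /done_edges ri. Qed.

Section OneVertex.
Variables (U : {set V}) (cv : V -> 'I_M.+3) (ce : V -> V -> 'I_M.+3) (x : V).
Hypotheses (lightU : {in U, forall z, light z}) (xU : x \in U).
Hypothesis lab : plabel U (done_edges U) cv ce.

Let q := done_edges U.
Let small : {set V} := [set z in nb x | (z \notin U) && ~~ big z].

Lemma big_notin z : big z -> z \notin U.
Proof. by move/big_not_light; apply: contraNN; apply: lightU. Qed.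

Lemma done_x t : q x t = (t \in bignb x).
Proof.
rewrite /q /done_edges !inE xU /=; case: (boolP (big t)) => bt; rewrite ?andbF //=.
by rewrite (negPf (big_notin bt)).
Qed.

Lemma done_step : add_star q x small =2 done_edges (U :\ x).
Proof.
have bx : ~~ big x by apply: contraL xU => /big_notin.
have half a b : a = x -> add_star q x small a b = done_edges (U :\ x) a b.
  move=> ->; rewrite /add_star eqxx /= done_x /done_edges !inE eqxx /=.
  rewrite ri /= (negPf bx) !andbF !implybF negb_and negbK.
  case: (eqVneq b x) => [->|_] /=; first by rewrite ri.
  case: (boolP (r x b)) => //= rxb.
  case: (boolP (big b)) => bb /=; first by rewrite (big_notin bb).
  by rewrite orbF andbT.
have stC a b : add_star q x small a b = add_star q x small b a.
  rewrite /add_star [q a b](done_edges_sym U) -/q; congr (_ || _); exact: orbC.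
move=> a b; have [ax|ax] := eqVneq a x; first exact: half.
have [bx'|bx'] := eqVneq b x; first by rewrite stC done_edges_sym half.
by rewrite /add_star /q /done_edges !inE (negPf ax) (negPf bx') /= orbF.
Qed.

Lemma finish_vertex (c : V -> 'I_M.+3) s :
    {in small &, injective c} ->
    s \in avail_vertex (nb x) q cv ce x ->
    {in small, forall z, c z \in (avail_edge q cv ce z :\: ce x @: bignb x) :\: nears s} ->
  exists (cv' : V -> 'I_M.+3) ce', plabel (U :\ x) (done_edges (U :\ x)) cv' ce'.
Proof.
move=> cinj; rewrite inE => /andP[/forall_inP sne /forallP sfar] cok.
have smallx z : z \in small -> r x z by rewrite !inE => /andP[].
have xsmall : x \notin small by rewrite !inE ri.
have := label_edges (@done_edges_sym U) lab xU xsmall _ cinj.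
case.
- by move=> z; rewrite -/q done_x !inE => /and3P[_ _ /negPf->]; rewrite andbF.
- move=> z t /cok; rewrite !inE => /and3P[_ _ /andP[_ /forallP/(_ t)/implyP]]; exact.
- move=> z t /cok; rewrite !inE => /and3P[_ nim _]; rewrite -/q done_x => tb.
  by apply: contraNneq nim => ->; apply: imset_f.
- by move=> z /cok; rewrite !inE => /and3P[_ _ /andP[]].
move=> l1 l2 l3 l4; exists (fun z => if z == x then s else cv z), (label_star ce x small c).
have /eq_plabel := done_step; apply.
apply: label_vertex => //.
- by move=> a b; rewrite !done_step done_edges_sym.
- by move=> a; rewrite done_step done_edges_irr.
- move=> y; rewrite /add_star eqxx (negPf xsmall) andbF orbF /=.
  case/orP => [qxy|ys]; rewrite /label_star eqxx (negPf xsmall) andbF /=.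
    rewrite ifN; first by have := sfar y; rewrite -/q in qxy *; rewrite qxy.
    by move: qxy; rewrite -/q done_x !inE => /andP[_ ->]; rewrite !andbF.
  by rewrite ys; have := cok y ys; rewrite !inE negbK => /andP[].
- by move=> y; rewrite done_step => /and3P[rxy _ _] _; apply: sne; rewrite inE.
Qed.

(** A vertex of degree at most 3 only needs a label.  For a vertex x of degree 5, choose its label so
    that one of the two edges with long lists keeps one more label than the worst case allows;
    then the edges that remain at x have lists from which distinct labels can be chosen
    greedily, by increasing length. *)
Lemma label_light_vertex : exists (cv' : V -> 'I_M.+3) ce', plabel (U :\ x) (done_edges (U :\ x)) cv' ce'.
Proof.
have Sbig := card_avail_vertex (nb x) q cv ce x.
have degq : rdeg q x = #|bignb x| by apply: eq_card => t; rewrite inE done_x.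
rewrite degq -/(deg x) in Sbig; set S := avail_vertex _ _ _ _ _ in Sbig.
case/orP: (lightU xU) => [/andP[_ dx]|/and3P[/eqP dx f2 pat]].
  have s0 : small = set0.
    apply/setP => z; rewrite !inE; case: (boolP (r x z)) => //= rxz.
    by rewrite (low_nb_big dx rxz) andbF.
  have /set0Pn[s sS] : S != set0.
    rewrite -card_gt0; have := bignb_le3 (lightU xU); move: Sbig dx M12; clear; lia.
  by apply: (finish_vertex (c := fun=> ord0) _ sS) => [z t|z]; rewrite s0 inE.
have {}Sbig : 10 - 3 * #|bignb x| <= #|S| by move: Sbig dx M12; clear; lia.
pose rest := nb x :\: bignb x.
have restE z : (z \in rest) = r x z && ~~ big z.
  by rewrite !inE; case: (r x z); rewrite ?andbF ?andbT.
have crest : #|rest| = 5 - #|bignb x|.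
  rewrite cardsD -dx; congr (_ - _); apply: eq_card => z; rewrite !inE.
  by case: (r x z).
(* The edges to p and w have long lists. *)
have [p [w [pr wr pw dpw]]] : exists p w, [/\ p \in rest, w \in rest, p != w
    & (deg p <= M - 5) && (deg w <= M - 7) || (deg p <= M - 6) && (deg w <= M - 6)].
  case/orP: pat => [/card_gt1P[p [w [+ + pw]]]|].
    rewrite !inE => /andP[rp dp] /andP[rw dw]; exists p, w.
    by rewrite !restE rp rw pw dp dw orbT /big -!ltnNge; split=> //; move: dp dw M12; clear; lia.
  rewrite card_gt0 => /set0Pn[w]; rewrite !inE => /andP[rw dw].
  have wrest : w \in rest by rewrite restE rw /big -ltnNge; move: dw M12; clear; lia.
  have /set0Pn[p] : rest :\ w != set0.
    have := cardsD1 w rest; rewrite wrest -card_gt0; move: crest f2; clear; lia.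
  rewrite in_setD1 => /andP[pw prest]; exists p, w; split=> //.
  rewrite dw andbT; apply/orP; left.
  by move: prest; rewrite restE /big -ltnNge => /andP[_]; clear; lia.
have small_rest z : z \in small -> z \in rest by rewrite restE !inE => /and3P[-> _ ->].
have Lbig z : z \in small -> M.+1 - deg z <= #|avail_edge q cv ce z|.
  move=> zs; have := card_avail_edge q cv ce z.
  suff : rdeg q z < deg z by clear; lia.
  apply/proper_card/properP; split; first by apply/subsetP => t; rewrite !inE => /and3P[].
  exists x; rewrite !inE; first by rewrite rs; move: zs; rewrite inE => /andP[]; rewrite inE.
  by rewrite /q (done_edges_sym U) -/q done_x !inE; move: zs; rewrite !inE => /and3P[_ _ /negPf->]; rewrite andbF.
pose Phi := ce x @: bignb x.
have cPhi : #|Phi| <= #|bignb x| by apply: leq_imset_card.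
pose N s z := (avail_edge q cv ce z :\: Phi) :\: nears s.
have Nbig s z : z \in small -> M.+1 - deg z - #|bignb x| - 3 <= #|N s z|.
  move=> zs; have := Lbig z zs.
  have h1 : #|avail_edge q cv ce z| - #|bignb x| <= #|avail_edge q cv ce z :\: Phi|.
    by rewrite cardsD leq_sub2l // (leq_trans (subset_leq_card (subsetIr _ _))).
  have h2 : #|avail_edge q cv ce z :\: Phi| - 3 <= #|N s z|.
    rewrite [leqRHS]cardsD leq_sub2l // (leq_trans (subset_leq_card (subsetIr _ _))) //.
    exact: card_nears.
  move: h1 h2; clear; lia.
have [s [sS Np Nw]] : exists s, [/\ s \in S, p \in small -> 4 - #|bignb x| <= #|N s p|
                                  & w \in small -> 5 - #|bignb x| <= #|N s w|].
  have [s0 s0S] : exists s, s \in S.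
    by apply/set0Pn; rewrite -card_gt0; move: f2 Sbig; clear; lia.
  case/orP: dpw => /andP[dp dw].
    have Nw s : w \in small -> 5 - #|bignb x| <= #|N s w|.
      by move/(Nbig s); move: dw M12 f2; clear; lia.
    case: (boolP (p \in small)) => ps; last by exists s0; split=> [//|ps'|]; [by case/negP: ps|]; exact: Nw.
    have l6 : 6 <= #|avail_edge q cv ce p| by move: (Lbig p ps) dp M12; clear; lia.
    have [//|s sS le] := good_vertex_label f2 _ Sbig l6 cPhi.
    exists s; split=> [//|_|]; last exact: Nw.
    by move: le; rewrite -/(N s p); move: f2; clear; lia.
  have Np s : p \in small -> 4 - #|bignb x| <= #|N s p|.
    by move/(Nbig s); move: dp M12 f2; clear; lia.
  case: (boolP (w \in small)) => ws; last by exists s0; split=> [//||ws']; [|by case/negP: ws]; exact: Np.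
  have l7 : 7 <= #|avail_edge q cv ce w| by move: (Lbig w ws) dw M12; clear; lia.
  have [//|s sS le] := good_vertex_label f2 _ Sbig l7 cPhi.
  exists s; split=> [//||_]; first exact: Np.
  by move: le; rewrite -/(N s w); move: f2; clear; lia.
have [|c cinj cN] := @greedy_sdr _ _ ord0 (N s) small; last first.
  by apply: (finish_vertex cinj sS) => z zs; apply: cN.
move=> j.
have N3 z : z \in small -> 3 - #|bignb x| <= #|N s z|.
  move=> zs; have := Nbig s z zs; have := small_rest z zs.
  by rewrite restE /big -ltnNge => /andP[_]; move: M12 f2; clear; lia.
set T := [set z in small | _].
have subT (B : {set V}) : T \subset B -> #|B| <= j -> #|T| <= j.
  by move/subset_leq_card/leq_trans; apply.
have Trest : T \subset rest by apply/subsetP => z; rewrite inE => /andP[/small_rest].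
case: (ltnP j (3 - #|bignb x|)) => [lt|j3].
  rewrite (_ : T = set0) ?cards0 //; apply/setP => z; rewrite in_set0.
  apply/negP; rewrite in_set => /andP[zs le].
  by have := leq_trans (N3 z zs) le; rewrite leqNgt lt.
have cw : #|rest :\ w| = 4 - #|bignb x|.
  have := cardsD1 w rest; rewrite wr crest; move: f2; clear; lia.
case: (ltnP j (4 - #|bignb x|)) => [lt|j4].
  apply: (subT (rest :\ w :\ p)).
    apply/subsetP => z zT; have zr := subsetP Trest z zT.
    rewrite !in_setD1 zr andbT; move: zT; rewrite inE => /andP[zs le].
    apply/andP; split; apply: contraTneq le => zE; rewrite -ltnNge zE.
      by apply: leq_trans (Np _); rewrite -?zE.
    by apply: leq_trans (Nw _); rewrite -?zE // (leq_trans lt) // leq_sub2r.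
  have := cardsD1 p (rest :\ w); rewrite in_setD1 pw pr cw; move: f2 j3; clear; lia.
case: (ltnP j (5 - #|bignb x|)) => [lt|j5]; last by apply: subT Trest _; rewrite crest.
apply: (subT (rest :\ w)); last by rewrite cw.
apply/subsetP => z zT; have zr := subsetP Trest z zT.
rewrite in_setD1 zr andbT; move: zT; rewrite inE => /andP[zs le].
apply: contraTneq le => zw; rewrite -ltnNge.
by rewrite zw; apply: leq_trans (Nw _); rewrite -?zw.
Qed.

End OneVertex.

Lemma no_partial_labelling U (cv : V -> 'I_M.+3) ce :
  {in U, forall z, light z} -> ~ plabel U (done_edges U) cv ce.
Proof.
have [k] := ubnP #|U|; elim: k => // k IHk in U cv ce * => /ltnSE-leU lightU lab.
have [U0|[x xU]] := set_0Vmem U.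
  apply: (@Hbad cv ce); rewrite U0 in lab; apply: eq_plabel lab => a b.
  by rewrite /done_edges !inE andbT.
have [cv' [ce' lab']] := label_light_vertex lightU xU lab.
apply: IHk lab' => [|z]; first by move: (cardsD1 x U) leU; rewrite xU; clear; lia.
by rewrite in_setD1 => /andP[_]; apply: lightU.
Qed.

Definition private X (m : V -> V) y := [set x in X | (m x == y) && (y \in bignb x)].

(** The edges between X and the big vertices are coloured from lists: the list of xy has at least
    #|N| + M - deg y labels, where N is the set of neighbours of y in X.  Let x prefer y if x is
    private to y, and let y prefer the vertices that are not private to it.  The edge to a
    private vertex is then dominated at y only, and any other edge xy is dominated by at most
    k - 1 edges at x and by no private edge at y. *)
Lemma no_alternator X (m : V -> V) k : X != set0 -> {in X, forall x, light x} ->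
    {in X, forall x, #|bignb x| <= k} ->
    (forall x y, x \in X -> y \in bignb x -> k <= #|private X m y| + (M - deg y) + 1) ->
  False.
Proof.
case/set0Pn => x0 x0X lightX lek priv.
pose r' : rel V := fun a b => [&& r a b, a \notin X & b \notin X].
have [|a b||cv [ce [c1 c2 c3 c4]]] := Hmin (r' := r').
- by move=> a b; rewrite /r' rs andbA [_ && (b \notin X)]andbAC -andbA.
- by case/andP.
- have /set0Pn[y] : nb x0 != set0.
    by rewrite -card_gt0; case/orP: (lightX _ x0X) => [/andP[]//|/and3P[/eqP dx _ _]]; rewrite -/(deg x0) dx.
  by rewrite inE => rxy; exists x0, y; rewrite rxy /r' x0X andbF.
have bigX y : big y -> y \notin X by move/big_not_light; apply: contraNN; apply: lightX.
pose D : {set V * V} := [set e | (e.1 \in X) && (e.2 \in bignb e.1)].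
pose ox (e : V * V) := if m e.1 == e.2 then 0 else (enum_rank e.2 : nat).+1.
pose oy (e : V * V) := if m e.1 == e.2 then #|V| + enum_rank e.1 else enum_rank e.1.
have ox_inj (e e' : V * V) : e.1 = e'.1 -> ox e = ox e' -> e = e'.
  case: e e' => [a b] [a' b'] /= <-; rewrite /ox /=.
  case: eqP => [<-|_]; case: eqP => [<-|_] // [] /val_inj/enum_rank_inj -> //.
have oy_inj (e e' : V * V) : e.2 = e'.2 -> oy e = oy e' -> e = e'.
  case: e e' => [a b] [a' b'] /= <-; rewrite /oy /=.
  have h1 : enum_rank a < #|V| := ltn_ord _; have h2 : enum_rank a' < #|V| := ltn_ord _.
  case: eqP => [_|_]; case: eqP => [_|_].
  - by move/addnI/val_inj/enum_rank_inj ->.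
  - by move=> h; have := leq_addr (enum_rank a) #|V|; rewrite h leqNgt h2.
  - by move=> h; have := leq_addr (enum_rank a') #|V|; rewrite -h leqNgt h1.
  - by move/val_inj/enum_rank_inj ->.
pose L (e : V * V) := avail_edge r' cv ce e.2.
have [|c cL cprop] := @galvin_list_colouring _ _ _ _ (ord0 : 'I_M.+3) _ _ _ _ ox_inj oy_inj L D.
  case=> x y; rewrite inE /= => /andP[xX yx].
  have by_ : big y by move: yx; rewrite inE => /andP[].
  pose Ny := [set x' in X | r x' y].
  have cL : M - deg y + #|Ny| <= #|L (x, y)|.
    have := card_avail_edge r' cv ce y; rewrite -/(L (x, y)).
    suff : rdeg r' y + #|Ny| <= deg y by have := degM y; clear; lia.
    rewrite -cardsUI (_ : _ :&: _ = set0) ?cards0 ?addn0; last first.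
      apply/setP => t; rewrite !inE; apply/negP => /andP[/and3P[_ _ tX]].
      by rewrite (negPf tX).
    apply: subset_leq_card; apply/subsetP => t; rewrite !inE.
    by case/orP => [/andP[]//|/andP[_]]; rewrite rs.
  have NyE x' : (x' \in Ny) = (x' \in X) && (y \in bignb x').
    by rewrite !inE by_ andbT.
  have xNy : x \in Ny by rewrite NyE xX.
  apply: leq_trans cL; rewrite /dominators.
  have sub2 : [set e in D | prefy snd oy e (x, y)] \subset [set (x', y) | x' in Ny :\ x].
    apply/subsetP => -[x' y']; rewrite !inE /= => /andP[/andP[x'X /andP[rxy' _]]].
    case/andP => /eqP /= yy; rewrite yy in rxy' *; move=> lt; apply/imsetP; exists x' => //.
    rewrite in_setD1 NyE x'X !inE rxy' by_ !andbT.
    by apply: contraTneq lt => ->; rewrite ltnn.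
  have le2 := leq_trans (subset_leq_card sub2) (leq_imset_card _ _).
  have cNy := cardsD1 x Ny; rewrite xNy in cNy.
  case: (eqVneq (m x) y) => [mxy|mxy].
    rewrite (_ : [set k0 in D | prefx _ _ _ _] = set0); last first.
      by apply/setP => e; rewrite !inE /prefx /ox /= mxy eqxx ltn0 !andbF.
    rewrite cards0 add0n (leq_ltn_trans le2) // cNy; clear; lia.
  have sub1 : [set e in D | prefx fst ox e (x, y)] \subset [set (x, y') | y' in bignb x :\ y].
    apply/subsetP => -[x' y']; rewrite !inE /= => /andP[/andP[x'X h]].
    case/andP => /eqP /= xx; rewrite xx in h *; move=> lt; apply/imsetP; exists y' => //.
    rewrite in_setD1 !inE h andbT.
    by apply: contraTneq lt => ->; rewrite ltnn.
  have le1 := leq_trans (subset_leq_card sub1) (leq_imset_card _ _).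
  have cbx := cardsD1 y (bignb x); rewrite yx in cbx.
  have sub3 : [set e in D | prefy snd oy e (x, y)] \subset
      [set (x', y) | x' in (Ny :\ x) :\: private X m y].
    apply/subsetP => e eD; have /imsetP[x' x'N eE] := subsetP sub2 e eD.
    apply/imsetP; exists x' => //; rewrite inE x'N andbT; apply/negP; rewrite inE.
    case/and3P => x'X /eqP mx' _; move: eD; rewrite eE !inE => /and3P[_ _].
    rewrite /oy /= mx' eqxx (negPf mxy).
    rewrite ltnNge ltnW // (leq_trans _ (leq_addr _ _)) //; exact: ltn_ord.
  have le3 := leq_trans (subset_leq_card sub3) (leq_imset_card _ _).
  have subP : private X m y \subset Ny :\ x.
    apply/subsetP => x'; rewrite [x' \in private _ _ _]inE in_setD1 NyE => /and3P[-> /eqP mx' ->].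
    by rewrite !andbT; apply: contraNneq mxy => <-; apply/eqP.
  move: le3; rewrite cardsD (setIidPr subP) => le3.
  apply: leq_ltn_trans (leq_add le1 le3) _.
  have := priv x y xX yx; have := lek x xX; have := subset_leq_card subP.
  by move: cbx cNy; clear; lia.
pose ce0 a b := if a \in X then c (a, b) else if b \in X then c (b, a) else ce a b.
apply: (@no_partial_labelling X cv ce0) => //.
have inD a b : a \in X -> done_edges X a b -> [/\ (a, b) \in D, b \notin X & r a b].
  move=> aX /and3P[rab]; rewrite aX /= => bb _.
  by rewrite !inE aX rab bb bigX.
have cok a b : a \in X -> done_edges X a b ->
    far (cv b) (c (a, b)) /\ forall t, r' b t -> c (a, b) != ce b t.
  move=> aX eab; have [abD _ _] := inD a b aX eab.
  have := cL _ abD; rewrite inE /= => /andP[-> /forallP h]; split=> // t.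
  by apply/implyP.
split.
- move=> a b eab; rewrite /ce0.
  case: ifPn => aX; case: ifPn => bX //; last by apply: c1; case/and3P: eab => rab _ _; rewrite /r' rab aX.
  by have [_] := inD a b aX eab; rewrite bX.
- move=> a b d eab ead bd; rewrite /ce0; case: ifPn => aX.
    have [abD _ _] := inD a b aX eab; have [adD _ _] := inD a d aX ead.
    by apply: cprop => //=; rewrite ?eqxx // xpair_eqE eqxx.
  rewrite done_edges_sym in eab; rewrite done_edges_sym in ead.
  have rba : r b a by case/and3P: eab.
  have rda : r d a by case/and3P: ead.
  case: ifPn => bX; case: ifPn => dX.
  + have [baD _ _] := inD b a bX eab; have [daD _ _] := inD d a dX ead.
    by apply: cprop => //=; rewrite ?eqxx ?orbT // xpair_eqE negb_and bd.
  + by apply: (cok b a bX eab).2; rewrite /r' rs rda aX dX.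
  + by rewrite eq_sym; apply: (cok d a dX ead).2; rewrite /r' rs rba aX bX.
  + by apply: c2 => //; rewrite /r' rs ?rba ?rda aX ?bX ?dX.
- move=> a b eab aX; rewrite /ce0 (negPf aX); case: ifPn => bX.
    by apply: (cok b a bX _).1; rewrite done_edges_sym.
  by apply: c3; rewrite ?inE // /r' aX bX; case/and3P: eab => ->.
- move=> a b eab aX bX; apply: c4; rewrite ?inE //.
  by rewrite /r' aX bX; case/and3P: eab => ->.
Qed.

(** Make u private to v, and x to w. *)
Lemma no_twins u x v w : deg u = 2 -> deg x = 2 -> u != x -> v != w ->
  r u v -> r u w -> r x v -> r x w -> False.
Proof.
move=> du dx ux vw ruv ruw rxv rxw.
have nbE z : deg z = 2 -> r z v -> r z w -> forall y, r z y -> (y == v) || (y == w).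
  move=> dz rzv rzw y rzy.
  have /eqP nbz : [set v; w] == nb z.
    rewrite eqEcard cards2 vw -/(deg z) dz leqnn andbT.
    by apply/subsetP => t /set2P[] ->; rewrite inE.
  have : y \in [set v; w] by rewrite nbz inE.
  by rewrite !inE.
pose m z := if z == u then v else w.
have lightX : {in [set u; x], forall z, light z}.
  by move=> z /set2P[] ->; rewrite /light ?du ?dx.
have inb z y : deg z = 2 -> r z y -> y \in bignb z.
  by move=> dz rzy; rewrite !inE rzy (low_nb_big _ rzy) // dz.
apply: (@no_alternator [set u; x] m 2) => //.
- by apply/set0Pn; exists u; rewrite set21.
- move=> z zX; have dz : deg z = 2 by case/set2P: zX => ->.
  by rewrite -dz; apply: subset_leq_card; apply/subsetP => y; rewrite !inE => /andP[].
move=> z y zX; rewrite inE => /andP[rzy _].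
suff : 0 < #|private [set u; x] m y| by clear; lia.
have : (y == v) || (y == w).
  by case/set2P: zX rzy => ->; rewrite inE => rzy; [apply: (nbE u)|apply: (nbE x)].
rewrite card_gt0 => /orP[]/eqP ->; apply/set0Pn.
  by exists u; rewrite inE set21 /m !eqxx inb.
by exists x; rewrite inE set22 /m [x == u]eq_sym (negPf ux) eqxx inb.
Qed.

(** A vertex of degree M has two tokens, a vertex of degree M - 1 has one. *)
Definition token (p : V * bool) := (deg p.1 == M) || (deg p.1 == M.-1) && ~~ p.2.

Definition tokens X : {set V * bool} :=
  [set p | token p & [exists x in X, p.1 \in bignb x]].

Lemma tokensP X y b x : token (y, b) -> x \in X -> y \in bignb x -> (y, b) \in tokens X.
Proof. by move=> tp xX yx; rewrite inE tp; apply/exists_inP; exists x. Qed.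

(** In a smallest set X of light vertices that exceeds its tokens, removing the neighbours of a set
    of tokens shows that this set satisfies Hall's condition.  So the tokens have distinct
    representatives in X, which serve as private vertices. *)
Lemma light_le_tokens X : {in X, forall x, light x} -> #|X| <= #|tokens X|.
Proof.
have [k] := ubnP #|X|; elim: k => // k IHk in X * => /ltnSE-leX lightX.
rewrite leqNgt; apply/negP => viol.
have [x0 x0X] : exists x, x \in X.
  by apply/set0Pn; rewrite -card_gt0; apply: leq_ltn_trans viol.
pose N (p : V * bool) := [set x in X | p.1 \in bignb x].
have [S sSD|f finj fN] := @hall_marriage _ _ x0 N (tokens X).
  have [->|[p0 p0S]] := set_0Vmem S; first by rewrite cards0.
  set U := \bigcup_(p in S) N p.
  have sUX : U \subset X by apply/bigcupsP => p _; apply/subsetP => x; rewrite inE => /andP[].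
  have cX := cardsD X U; rewrite (setIidPr sUX) in cX.
  have cT := cardsD (tokens X) S; rewrite (setIidPr sSD) in cT.
  have U0 : 0 < #|U|.
    have := subsetP sSD p0 p0S; rewrite inE => /andP[_ /exists_inP[x xX xp]].
    by rewrite card_gt0; apply/set0Pn; exists x; apply/bigcupP; exists p0; rewrite // inE xX.
  have leU := subset_leq_card sUX; have leS := subset_leq_card sSD.
  have IH : #|X :\: U| <= #|tokens (X :\: U)|.
    apply: IHk => [|x]; first by move: cX leX U0 leU; clear; lia.
    by rewrite inE => /andP[_]; apply: lightX.
  have sub : tokens (X :\: U) \subset tokens X :\: S.
    apply/subsetP => p; rewrite [p \in tokens _]inE => /andP[tp /exists_inP[x]].
    rewrite !in_setD => /andP[xU xX] px; apply/andP; split.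
      by apply: contra xU => pS; apply/bigcupP; exists p; rewrite // inE xX.
    by rewrite inE tp; apply/exists_inP; exists x.
  by have := leq_trans IH (subset_leq_card sub); move: cX cT viol leU leS; clear; rewrite /reverse_coercion; lia.
pose m x := if [pick p in tokens X | f p == x] is Some p then p.1 else x.
have mf p : p \in tokens X -> m (f p) = p.1.
  move=> pT; rewrite /m; case: pickP => [p' /andP[p'T /eqP ff]|/(_ p)].
    by rewrite (finj _ _ p'T pT ff).
  by rewrite /= pT eqxx.
have priv p y : p \in tokens X -> p.1 = y -> f p \in private X m y.
  move=> pT py; have := fN p pT; rewrite inE => /andP[fX pf].
  by rewrite inE fX mf // py eqxx -py.
apply: (@no_alternator X m 3) => //.
- by apply/set0Pn; exists x0.
- by move=> x /lightX/bignb_le3.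
move=> x y xX yx; have dyM := degM y.
have [dy|dy] := eqVneq (deg y) M.
  suff : 1 < #|private X m y| by clear; lia.
  have t1 : (y, true) \in tokens X by apply: tokensP yx; rewrite // /token /= dy eqxx.
  have t2 : (y, false) \in tokens X by apply: tokensP yx; rewrite // /token /= dy eqxx.
  apply/card_gt1P; exists (f (y, true)), (f (y, false)); split; try exact: priv.
  by apply: contraTneq isT => /(finj _ _ t1 t2).
have [dy'|dy'] := eqVneq (deg y) M.-1; last by move: dy dy' dyM; clear; lia.
suff : 0 < #|private X m y| by move: dy' M12; clear; lia.
have t2 : (y, false) \in tokens X by apply: tokensP yx; rewrite // /token /= dy' eqxx orbT.
by rewrite card_gt0; apply/set0Pn; exists (f (y, false)); apply: priv.
Qed.

Lemma card_light :
  #|[set x | light x]| <= 2 * #|[set y | deg y == M]| + #|[set y | deg y == M.-1]|.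
Proof.
apply: leq_trans (light_le_tokens _) _; first by move=> x; rewrite inE.
have sub : tokens [set x | light x] \subset
    setX [set y | deg y == M] [set: bool] :|: setX [set y | deg y == M.-1] [set false].
  by apply/subsetP => -[y b]; rewrite !inE /token /= => /andP[/orP[->|/andP[-> /negPf->]] _]; rewrite ?orbT.
apply: leq_trans (subset_leq_card sub) _; apply: leq_trans (leq_card_setU _ _).1 _.
by rewrite !cardsX cardsT card_bool cards1 muln1 mulnC.
Qed.
End Minimal.

(** * Discharging *)

Ltac distinct :=
  rewrite /= ?inE ?xpair_eqE ?eqxx;
  repeat match goal with H : is_true (?a != ?b) |- _ =>
    rewrite ?(negPf H) ?[b == a]eq_sym ?(negPf H); clear H end;
  rewrite ?(andbF, orbF, andbT).

Section SymmetricSets.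
Variable V : finType.
Implicit Types C : {set V * V}.

Lemma uniq_leq_card (T : finType) (A : {set T}) (s : seq T) :
  uniq s -> {subset s <= A} -> size s <= #|A|.
Proof.
move=> us sA; rewrite cardE; apply: uniq_leq_size => // x xs.
by rewrite mem_enum sA.
Qed.

Lemma symmetric_set_half C (P : rel V) :
    (forall x y, (x, y) \in C -> (y, x) \in C) ->
    (forall x y, (x, y) \in C -> P x y -> ~~ P y x) ->
  2 * #|[set p in C | P p.1 p.2]| <= #|C|.
Proof.
move=> symC asymP; set A := [set p in C | _].
pose sw (p : V * V) := (p.2, p.1).
have swK : involutive sw by case.
have -> : 2 * #|A| = #|A| + #|sw @: A|.
  by rewrite (card_imset _ (inv_inj swK)) mul2n addnn.
rewrite -cardsUI (_ : A :&: sw @: A = set0) ?cards0 ?addn0; last first.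
  apply/setP => p; rewrite !inE; apply/negP => /andP[/andP[pC Pp]].
  case/imsetP => [[x y]]; rewrite inE => /andP[/= xyC Pxy] pE.
  by have := asymP x y xyC Pxy; rewrite pE /= in Pp *; rewrite Pp.
apply: subset_leq_card; apply/subsetP => p; rewrite inE => /orP[|].
  by rewrite inE => /andP[].
by case/imsetP => -[x y]; rewrite inE => /andP[/= xyC _] ->; apply: symC.
Qed.

Lemma symmetric_set_even C :
    (forall x y, (x, y) \in C -> (y, x) \in C) -> (forall x, (x, x) \notin C) ->
  ~~ odd #|C|.
Proof.
move=> symC irrC.
pose A := [set p in C | enum_rank p.1 < enum_rank p.2].
pose B := [set p in C | enum_rank p.2 < enum_rank p.1].
pose sw (p : V * V) := (p.2, p.1).
have swK : involutive sw by case.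
have BE : B = sw @: A.
  apply/setP => -[x y]; apply/idP/imsetP => [|[[x' y']]]; rewrite !inE /=.
    by case/andP => xyC lt; exists (y, x) => //; rewrite !inE symC.
  by case/andP => xyC lt [-> ->]; rewrite symC.
have -> : C = A :|: B.
  apply/setP => -[x y]; rewrite !inE -andb_orr /=; case: (boolP (_ \in C)) => //= xyC.
  by rewrite -neq_ltn; apply/esym; apply: contraNneq (irrC x) => /val_inj/enum_rank_inj {2}->.
have dAB : A :&: B = set0.
  by apply/setP => p; rewrite !inE; apply/negP => /andP[/andP[_ lt] /andP[_]]; rewrite ltnNge ltnW.
rewrite cardsU dAB cards0 subn0 BE (card_imset _ (inv_inj swK)) addnn.
by rewrite odd_double.
Qed.

End SymmetricSets.

Section EvenSets.
Variables (V : finType) (C : {set V * V}).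
Hypotheses (symC : forall x y, (x, y) \in C -> (y, x) \in C)
           (irrC : forall x, (x, x) \notin C)
           (evenC : forall x, ~~ odd #|[set y | (x, y) \in C]|).

Lemma dart_neq x y : (x, y) \in C -> x != y.
Proof. by move=> xyC; apply: contraTneq xyC => ->; apply: irrC. Qed.

Lemma another_dart x y : (x, y) \in C -> exists2 z, z != y & (x, z) \in C.
Proof.
move=> xyC; have := evenC x; rewrite (cardsD1 y) inE xyC oddS negbK => odd_rest.
have /set0Pn[z] : [set z | (x, z) \in C] :\ y != set0.
  by rewrite -card_gt0; case: #|_| odd_rest.
by rewrite !inE => /andP[zy xzC]; exists z.
Qed.

Lemma card_even_set_ge6 : C != set0 -> 6 <= #|C|.
Proof.
case/set0Pn => -[u w] uwC; have uw := dart_neq uwC.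
have [z zw uzC] := another_dart uwC; have [t tu wtC] := another_dart (symC uwC).
have uz := dart_neq uzC; have wt := dart_neq wtC.
suff : 5 <= #|C|.
  have := symmetric_set_even symC irrC; rewrite [5 <= _]leq_eqVlt.
  by case: eqP => [<-|].
apply: (@uniq_leq_card _ C [:: (u, w); (w, u); (u, z); (z, u); (w, t)]).
  by distinct.
by move=> p; rewrite !inE => /or4P[|||/orP[]] /eqP-> //; apply: symC.
Qed.

Definition triangle (u w z : V) : {set V * V} :=
  [set p in [:: (u, w); (w, u); (u, z); (z, u); (w, z); (z, w)]].

(** Sets of edges are represented as symmetric sets of ordered pairs, so that a set of three
    edges has size 6. *)
Lemma card6_triangle u w : #|C| = 6 -> (u, w) \in C ->
  exists z, [/\ z != u, z != w & C = triangle u w z].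
Proof.
move=> c6 uwC; have uw := dart_neq uwC.
have [z zw uzC] := another_dart uwC.
have uz := dart_neq uzC.
have [y yu zyC] := another_dart (symC uzC).
have yz := dart_neq zyC.
have [yw|yw] := eqVneq y w; last first.
  have [t tu wtC] := another_dart (symC uwC); have wt := dart_neq wtC.
  suff : 7 <= #|C| by rewrite c6.
  apply: (@uniq_leq_card _ C [:: (u, w); (w, u); (u, z); (z, u); (z, y); (y, z); (w, t)]).
    by distinct.
  by move=> p; rewrite !inE => /or4P[||| /or4P[]] /eqP-> //; apply: symC.
have wzC : (w, z) \in C by rewrite -yw symC.
exists z; split; rewrite 1?eq_sym // ; first by rewrite eq_sym.
apply/esym/eqP; rewrite eqEcard c6; apply/andP; split.
  by apply/subsetP => p; rewrite !inE => /or4P[|||/or3P[]] /eqP-> //; apply: symC.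
rewrite cardsE; apply/eq_leq/esym/(card_uniqP _).
by distinct.
Qed.

End EvenSets.

Section Discharging.
Variables (V : finType) (M : nat) (r : rel V) (S : {set {set V * V}}).
Hypotheses (rs : symmetric r) (ri : irreflexive r) (M12 : 12 <= M).
Local Notation deg := (rdeg r).
Local Notation nb := (nbhd r).
Hypothesis degM : forall x, deg x <= M.
Hypothesis deg_le3 : forall u v, r u v -> deg u <= 3 -> M + 2 <= deg u + deg v.
Hypothesis deg_eq4 : forall u v, r u v -> deg u = 4 -> M - 4 <= deg v.
Hypothesis no_twin : forall u x v w, deg u = 2 -> deg x = 2 -> u != x -> v != w ->
  r u v -> r u w -> r x v -> r x w -> False.
Hypothesis few_light : #|[set x | light M r x]| <=
  2 * #|[set y | deg y == M]| + #|[set y | deg y == M.-1]|.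
Hypothesis subS : forall C x y, C \in S -> (x, y) \in C -> r x y.
Hypothesis symS : forall C x y, C \in S -> (x, y) \in C -> (y, x) \in C.
Hypothesis S0 : set0 \notin S.
Hypothesis evenS : forall C x, C \in S -> ~~ odd #|[set y | (x, y) \in C]|.
Hypothesis twoS : forall x y, #|[set C in S | (x, y) \in C]| <= 2.
Implicit Types (C : {set V * V}) (u v w x y z : V).

Definition low x := 0 < deg x <= 5.
Definition high x := 6 <= deg x.

Lemma r_deg x y : r x y -> 0 < deg x.
Proof. by move=> rxy; rewrite card_gt0; apply/set0Pn; exists y; rewrite inE. Qed.

Lemma low_or_high x y : r x y -> low x = ~~ high x.
Proof. by move=> rxy; rewrite /low /high (r_deg rxy) -leqNgt. Qed.

Lemma irrS C : C \in S -> forall x, (x, x) \notin C.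
Proof. by move=> CS x; apply/negP => /(subS CS); rewrite ri. Qed.

Lemma nb_deg2 u w : r u w -> deg u = 2 -> deg w = M.
Proof. by move=> ruw du; have := deg_le3 ruw; have := degM w; rewrite du; lia. Qed.

Lemma nb_le3 u w : r u w -> deg u <= 3 -> 11 <= deg w.
Proof. by move=> ruw du; have := deg_le3 ruw du; move: du M12; clear; lia. Qed.

Lemma nb_le4 u w : r u w -> deg u <= 4 -> 8 <= deg w.
Proof.
move=> ruw; rewrite leq_eqVlt => /orP[/eqP du|du]; last by have := nb_le3 ruw du; lia.
by have := deg_eq4 ruw du; move: M12; clear; lia.
Qed.

Lemma low_ge2 u w : r u w -> 2 <= deg u.
Proof.
move=> ruw; have := deg_le3 ruw; have := degM w; have := r_deg ruw.
by case: (deg u) => [|[|n]] //; clear; lia.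
Qed.

(** In a triangle with vertices u, w, z that contains the edge uw, this says that z is low. *)
Definition third_low C u w := [exists z, [&& low z, z != u & (w, z) \in C]].

(** What a face gives to the low vertex u through one of its edges at u.  Triangles have no charge;
    a quadrilateral has 16 units and meets at most one vertex of degree 2. *)
Definition from_face C u :=
  if #|C| == 6 then 0 else if #|C| == 8 then (if deg u == 2 then 6 else 2) else 8.

(** What the high vertex w gives to the low vertex u through the edge uw of a face: at most two units
    per face around w, shared if two low vertices of a triangle compete. *)
Definition from_vertex C u w : nat :=
  if #|C| == 6 then
    (if third_low C u w then (8 <= deg w : nat) else if 8 <= deg w then 2 else deg w == 7)
  else if (#|C| == 8) && (deg u == 2) then 2 else 0.

Definition slot u w := [&& r u w, low u & high w].

Lemma slot_asym x y : slot x y -> ~~ slot y x.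
Proof. by case/and3P => _ /andP[_ lx] _; apply/negP => /and3P[_ _]; rewrite /high leqNgt ltnS lx. Qed.

(** A face contains both edges at each of its vertices of degree 2.  Four edges leave no room for
    others, so two vertices of degree 2 on a quadrilateral would have the same neighbours. *)
Lemma one_deg2 C u u' x x' : C \in S -> #|C| = 8 -> deg u = 2 -> deg x = 2 ->
  (u, u') \in C -> (x, x') \in C -> u = x.
Proof.
move=> CS c8 du dx uuC xxC; apply/eqP/negPn/negP => ux.
have sC := symS CS; have iC := irrS CS; have eC x := evenS x CS.
have two a a' : deg a = 2 -> (a, a') \in C ->
    exists v w, [/\ v != w, (a, v) \in C, (a, w) \in C, r a v & r a w].
  move=> da aaC; have [z za azC] := another_dart eC aaC.
  by exists z, a'; split=> //; apply: (subS CS).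
have [v [w [vw uvC uwC ruv ruw]]] := two u u' du uuC.
have [v' [w' [vw' xvC xwC rxv rxw]]] := two x x' dx xxC.
have nadj y : r u y -> y != x.
  by move=> ruy; apply/eqP => yx; move: dx M12; rewrite -yx (nb_deg2 ruy du) => ->.
have nadj' y : r x y -> y != u.
  by move=> rxy; apply/eqP => yu; move: du M12; rewrite -yu (nb_deg2 rxy dx) => ->.
suff common y : (u, y) \in C -> r u y -> r x y.
  by apply: (@no_twin u x v w) => //; apply: common.
move=> uyC ruy; apply: contraT => nrxy.
have [t tu ytC] := another_dart eC (sC _ _ uyC).
have yx := nadj y ruy; have uy := dart_neq iC uyC.
have yv' : y != v' by apply: contraNneq nrxy => ->.
have yw' : y != w' by apply: contraNneq nrxy => ->.
have [y2 y2y uy2C] := another_dart eC uyC.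
have y2x := nadj y2 (subS CS uy2C); have uy2 := dart_neq iC uy2C.
have v'u := nadj' v' rxv; have w'u := nadj' w' rxw.
have xv' := dart_neq iC xvC; have xw' := dart_neq iC xwC.
suff : 9 <= #|C| by rewrite c8.
apply: (@uniq_leq_card _ C [:: (u, y); (u, y2); (y, u); (y2, u); (x, v'); (x, w'); (v', x); (w', x); (y, t)]).
  by distinct.
by move=> p; rewrite !inE => /or4P[||| /or4P[||| /or3P[]]] /eqP-> //; apply: sC.
Qed.

Definition cap w : nat := if 8 <= deg w then 2 else deg w == 7.

(** In a triangle the two neighbours of w share what w pays, and in a quadrilateral at most one of
    them has degree 2. *)
Lemma vertex_pays_face C w : C \in S ->
  \sum_(u | slot u w && ((u, w) \in C)) from_vertex C u w
    <= cap w * (0 < #|[set y | (w, y) \in C]|).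
Proof.
move=> CS; have sC := symS CS; have iC := irrS CS; have eC x := evenS x CS.
case: (pickP (fun u => slot u w && ((u, w) \in C))) => [u0 /andP[slu0 u0C]|none]; last first.
  by rewrite big_pred0.
have -> : 0 < #|[set y | (w, y) \in C]|.
  by rewrite card_gt0; apply/set0Pn; exists u0; rewrite inE sC.
rewrite muln1; have /and3P[ru0 lu0 hw] := slu0.
case: (eqVneq #|C| 6) => [c6|c6].
  have [z [zu zw CE]] := card6_triangle sC iC eC c6 u0C.
  have u0w := dart_neq iC u0C.
  have wE y : ((y, w) \in C) = (y == u0) || (y == z).
    rewrite CE !inE !xpair_eqE eqxx [w == u0]eq_sym (negPf u0w) [w == z]eq_sym (negPf zw).
    by rewrite !andbF !andbT.
  have wE' y : ((w, y) \in C) = (y == u0) || (y == z).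
    by rewrite -wE; apply/idP/idP; apply: sC.
  have zC : (z, w) \in C by rewrite wE eqxx orbT.
  have t0 : third_low C u0 w = low z.
    apply/existsP/idP => [[y /and3P[ly yu]]|lz]; last by exists z; rewrite lz zu sC.
    by rewrite wE' (negPf yu) => /eqP <-.
  have tz : third_low C z w = low u0.
    apply/existsP/idP => [[y /and3P[ly yz]]|lu]; first by rewrite wE' (negPf yz) orbF => /eqP <-.
    by exists u0; rewrite lu sC // eq_sym zu.
  rewrite (bigD1 u0) /=; last by rewrite slu0.
  have rz : r z w by apply: (subS CS).
  have rest : (fun u => slot u w && ((u, w) \in C) && (u != u0)) =1
              (fun u => (u == z) && low z).
    move=> u /=; rewrite wE; case: (eqVneq u u0) => [->|_]; rewrite ?andbF ?andbT /=.
      by rewrite eq_sym (negPf zu).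
    by case: (eqVneq u z) => [->|_]; rewrite ?andbF // /slot rz hw !andbT.
  rewrite (eq_bigl _ _ rest) /from_vertex c6 eqxx t0 /cap.
  case: (boolP (low z)) => lz.
    rewrite (eq_bigl (fun u => u == z)) => [|u]; last by rewrite andbT.
    by rewrite big_pred1_eq tz lu0; case: (8 <= _).
  by rewrite big_pred0 ?addn0 // => u; rewrite andbF.
case: (pickP (fun u => slot u w && ((u, w) \in C) && (from_vertex C u w != 0))) => [u1|none].
  case/andP => /andP[/and3P[ru1 _ _] u1C].
  rewrite {1}/from_vertex (negPf c6); case: ifP => // /andP[/eqP c8 /eqP du1] _.
  rewrite (bigD1 u1) /=; last by rewrite u1C /slot ru1 /low du1 hw.
  rewrite big1 ?addn0 => [|u /andP[/andP[_ uC] uu1]].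
    rewrite /from_vertex (negPf c6) c8 du1 /= /cap (nb_deg2 ru1 du1).
    by rewrite (leq_trans _ M12).
  rewrite /from_vertex (negPf c6); case: ifP => // /andP[_ /eqP du].
  by case/eqP: uu1; apply: (one_deg2 CS c8 du du1 uC u1C).
rewrite big1 // => u su; apply/eqP/negPn/negP => nz.
by have := none u; rewrite su nz.
Qed.

(** A face around w uses at least two of the edges at w, and each edge lies in at most two faces, so
    that there are at most deg w faces around w. *)
Lemma vertex_pays w :
  \sum_(u | slot u w) \sum_(C in S | (u, w) \in C) from_vertex C u w <= cap w * deg w.
Proof.
rewrite (exchange_big_dep (fun C => C \in S)) /=; last by move=> u C _ /andP[].
have le1 : \sum_(C in S) \sum_(u | slot u w && ((C \in S) && ((u, w) \in C))) from_vertex C u w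
    <= \sum_(C in S) cap w * (0 < #|[set y | (w, y) \in C]|).
  apply: leq_sum => C CS; apply: leq_trans (vertex_pays_face w CS).
  by apply: eq_leq; apply: eq_bigl => u; rewrite CS.
apply: leq_trans le1 _; rewrite -big_distrr leq_mul2l; apply/orP; right.
rewrite -(leq_pmul2l (isT : 0 < 2)) big_distrr /=.
apply: (@leq_trans (\sum_(C in S) #|[set y | (w, y) \in C]|)).
  apply: leq_sum => C CS; case: posnP => [->//|pos]; rewrite muln1.
  move: pos; rewrite card_gt0 => /set0Pn[y]; rewrite inE => wyC.
  have [z zy wzC] := another_dart (fun x => evenS x CS) wyC.
  by apply/card_gt1P; exists z, y; rewrite !inE.
have -> : \sum_(C in S) #|[set y | (w, y) \in C]| = \sum_(C in S) \sum_(y | (w, y) \in C) 1.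
  by apply: eq_bigr => C _; rewrite sum1dep_card.
rewrite (exchange_big_dep (fun y => y \in nb w)) /=; last by move=> C y CS /(subS CS); rewrite inE.
rewrite mulnC -sum_nat_const; apply: leq_sum => y _.
by rewrite sum1dep_card; apply: leq_trans (twoS w y); apply: subset_leq_card; apply/subsetP => C; rewrite !inE.
Qed.

Lemma face_size C : C \in S -> 6 <= #|C| /\ ~~ odd #|C|.
Proof.
move=> CS; have sC := symS CS; have iC := irrS CS; have eC x := evenS x CS.
split; last exact: symmetric_set_even.
by apply: card_even_set_ge6 => //; apply: contraNneq S0 => <-.
Qed.

Lemma few_slots C : C \in S -> 2 * #|[set p in C | slot p.1 p.2]| <= #|C|.
Proof.
move=> CS; apply: symmetric_set_half => [x y|x y _]; first exact: symS.
exact: slot_asym.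
Qed.

(** Low vertices are joined to high ones in an even set of edges by an even number of edges; hence a
    pentagon has at most four of them. *)
Lemma even_slots C : C \in S -> ~~ odd #|[set p in C | slot p.1 p.2]|.
Proof.
move=> CS; pose A := [set p in C | low p.1]; pose B := [set p in C | low p.1 && low p.2].
have evB : ~~ odd #|B|.
  apply: symmetric_set_even => [x y|x].
    by rewrite !inE /= => /and3P[/(symS CS)-> -> ->].
  by rewrite inE (negPf (irrS CS x)).
have evA : ~~ odd #|A|.
  have -> : #|A| = \sum_(x | low x) #|[set y | (x, y) \in C]|.
    under eq_bigr do rewrite -sum1dep_card.
    rewrite pair_big_dep /= sum1dep_card; apply: eq_card => -[x y].
    by rewrite !inE /= andbC.
  elim/big_ind: _ => // [a b /negPf ea /negPf eb|x _]; last exact: evenS.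
  by rewrite oddD ea eb.
have -> : [set p in C | slot p.1 p.2] = A :\: B.
  apply/setP => -[x y]; rewrite !inE /=; case: (boolP (_ \in C)) => //= xyC.
  have rxy := subS CS xyC; rewrite /slot rxy /=; case: (low x) => //=.
  by rewrite (@low_or_high y x) 1?rs // negbK andbT.
rewrite cardsD (setIidPr _); last by apply/subsetP => p; rewrite !inE => /and3P[-> ->].
rewrite oddB ?(negPf evA) ?(negPf evB) //; apply: subset_leq_card.
by apply/subsetP => p; rewrite !inE => /and3P[-> ->].
Qed.

(** The slots of a face are at most half of its darts, and in a quadrilateral at most two of them
    are at a vertex of degree 2. *)
Lemma face_pays C : C \in S ->
  \sum_(p | slot p.1 p.2 && (p \in C)) from_face C p.1 <= 8 * (#|C| - 6).
Proof.
move=> CS; have [ge6 evenc] := face_size CS.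
have half := few_slots CS; have ev := even_slots CS.
set T := [set p in C | slot p.1 p.2] in half ev.
have sumT : \sum_(p | slot p.1 p.2 && (p \in C)) from_face C p.1 = \sum_(p in T) from_face C p.1.
  by apply: eq_bigl => p; rewrite inE andbC.
rewrite sumT /from_face; case: eqP => [->|/eqP c6]; first by rewrite big1.
case: eqP => [c8|/eqP c8]; last first.
  rewrite sum_nat_const mulnC leq_mul2l /=.
  have arith c t : 6 <= c -> ~~ odd c -> 2 * t <= c -> ~~ odd t -> c != 6 -> c != 8 -> t <= c - 6.
    by clear; lia.
  exact: arith.
pose T2 := [set p in T | deg p.1 == 2].
have -> : \sum_(p in T) (if deg p.1 == 2 then 6 else 2) = 2 * #|T| + 4 * #|T2|.
  rewrite -!sum1_card !big_distrr /=.
  have -> : \sum_(i in T2) 4 * 1 = \sum_(i in T) (if deg i.1 == 2 then 4 else 0).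
    by rewrite -big_mkcondr; apply: eq_bigl => p; rewrite [p \in T2]inE.
  by rewrite -big_split; apply: eq_bigr => p _; case: eqP.
have leT2 : #|T2| <= 2.
  have [->|[[x y] xyT]] := set_0Vmem T2; first by rewrite cards0.
  move: (xyT); rewrite !inE /= => /andP[/andP[xyC _] /eqP dx].
  have <- : #|nb x| = 2 by exact: dx.
  apply: leq_trans (leq_imset_card (pair x) _).
  apply: subset_leq_card; apply/subsetP => -[x' y']; rewrite !inE /= => /andP[/andP[xyC' _] /eqP dx'].
  have xx := one_deg2 CS c8 dx dx' xyC xyC'; rewrite -xx in xyC' *.
  by apply: imset_f; rewrite inE; apply: (subS CS).
by rewrite c8 in half *; move: half leT2; rewrite /reverse_coercion; clear; lia.
Qed.

Definition mult u w := #|[set C in S | (u, w) \in C]|.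

(** A side of uw without a face counts as a face that gives 16 units. *)
Definition receipts u w :=
  \sum_(C in S | (u, w) \in C) (from_face C u + from_vertex C u w) + 16 * (2 - mult u w).

Lemma sum_mult u w b : \sum_(C in S | (u, w) \in C) b = mult u w * b.
Proof. by rewrite sum_nat_const; congr (_ * _); apply: eq_card => C; rewrite !inE. Qed.

Lemma receipts_ge b u w : b <= 16 ->
    (forall C, C \in S -> (u, w) \in C -> b <= from_face C u + from_vertex C u w) ->
  2 * b <= receipts u w.
Proof.
move=> b16 ge; have : mult u w * b <= \sum_(C in S | (u, w) \in C) (from_face C u + from_vertex C u w).
  by rewrite -sum_mult; apply: leq_sum => C /andP[]; apply: ge.
have := twoS u w; rewrite -/(mult u w) /receipts; move: (mult u w) => k.
by case: k => [|[|[|k]]] // _; move: b16; clear; lia.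
Qed.

Lemma third_nb C u w : C \in S -> #|C| = 6 -> (u, w) \in C -> third_low C u w ->
  exists z, [/\ low z, r u z & C = triangle u w z].
Proof.
move=> CS c6 uwC /existsP[y /and3P[ly yu wyC]].
have sC := symS CS; have iC := irrS CS; have eC x := evenS x CS.
have [z [zu zw CE]] := card6_triangle sC iC eC c6 uwC.
have uw := dart_neq iC uwC.
have yz : y = z.
  move: wyC; rewrite CE !inE !xpair_eqE eqxx (negPf yu) [w == u]eq_sym (negPf uw).
  by rewrite [w == z]eq_sym (negPf zw) !andbF /= orbF => /eqP.
exists z; split=> //; first by rewrite -yz.
by apply: (subS CS); rewrite CE !inE eqxx !orbT.
Qed.

Lemma receive_ge2 C u w : C \in S -> (u, w) \in C -> 8 <= deg w -> ~~ third_low C u w ->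
  2 <= from_face C u + from_vertex C u w.
Proof.
move=> CS uwC dw nt; rewrite /from_face /from_vertex (negPf nt) dw.
by case: ifP => // _; case: ifP => // _; case: ifP.
Qed.

Lemma receive_small C u w : C \in S -> (u, w) \in C -> deg u <= 4 ->
  2 <= from_face C u + from_vertex C u w.
Proof.
move=> CS uwC du; have dw := nb_le4 (subS CS uwC) du.
have [c6|c6] := eqVneq #|C| 6; last first.
  by rewrite /from_face (negPf c6); case: ifP => // _; case: ifP.
apply: receive_ge2 => //; apply/negP => t.
have [z [lz ruz _]] := third_nb CS c6 uwC t.
by have := nb_le4 ruz du; case/andP: lz => _; clear; lia.
Qed.

(** A triangle through uw also contains the other edge at u, so there is at most one of them; the
    other side of uw gives at least 8. *)
Lemma receipts_deg2 u w : r u w -> deg u = 2 -> 10 <= receipts u w.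
Proof.
move=> ruw du.
pose tri := [set C in S | ((u, w) \in C) && (#|C| == 6)].
have tri1 : #|tri| <= 1.
  apply/card_le1P => C; rewrite inE => /and3P[CS uwC /eqP c6] C'; rewrite [RHS]inE.
  apply/idP/eqP => [|->]; last by rewrite inE CS uwC c6 eqxx.
  rewrite inE => /and3P[C'S uwC' /eqP c6'].
  have struct D : D \in S -> (u, w) \in D -> #|D| = 6 ->
      exists z, [/\ z \in nb u :\ w & D = triangle u w z].
    move=> DS uwD d6.
    have [z [zu zw DE]] := card6_triangle (fun x y => @symS D x y DS) (irrS DS) (fun x => evenS x DS) d6 uwD.
    by exists z; split=> //; rewrite !inE zw; apply: (subS DS); rewrite DE !inE eqxx !orbT.
  have [z [zN ->]] := struct C CS uwC c6; have [z' [z'N ->]] := struct C' C'S uwC' c6'.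
  have c1 : #|nb u :\ w| <= 1.
    by have := cardsD1 w (nb u); rewrite -/(deg u) du inE ruw; clear; lia.
  by rewrite (card_le1_eqP c1 z z').
have ge : mult u w * 8 <= \sum_(C in S | (u, w) \in C) (from_face C u + from_vertex C u w) + 6 * #|tri|.
  rewrite -sum_mult -[#|tri|]sum1_card big_distrr /=.
  have -> : \sum_(C in tri) 6 * 1 = \sum_(C in S | (u, w) \in C) (if #|C| == 6 then 6 else 0).
    by rewrite -big_mkcondr; apply: eq_bigl => C; rewrite inE andbA.
  rewrite -big_split; apply: leq_sum => C /andP[CS uwC] /=.
  case: eqP => [c6|/eqP c6].
    by rewrite (leq_add (receive_small CS uwC _)) // du.
  rewrite /from_face /from_vertex (negPf c6) du /= andbT.
  by case: eqP.
have := twoS u w; rewrite -/(mult u w) /receipts; move: ge tri1; move: (mult u w) => k.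
rewrite /reverse_coercion; case: k => [|[|[|k]]] // h1 h2 _; move: h1 h2; clear; lia.
Qed.

(** If u has three big neighbours, each of them gives 4 units, except for one unit lost in every
    triangle that contains u and another low vertex; at most two triangles contain a given edge
    at u, so that at most 2 (5 - f) units are lost when u has f big neighbours.  Otherwise no
    neighbour of u is low and four of them have degree at least 7. *)
Lemma receipts_big_nbs u : u \notin [set x | light M r x] -> deg u = 5 ->
  8 <= \sum_(w | slot u w) receipts u w.
Proof.
rewrite inE => nl du.
have lu : low u by rewrite /low du.
have {nl} : ~~ typeA M r u by apply: contra nl => t; rewrite /light t orbT.
rewrite /typeA du eqxx /= negb_and -ltnNge => /orP[f3|].
- pose aff C w := (#|C| == 6) && third_low C u w.
  have slot_big w : w \in bignb M r u -> slot u w && (8 <= deg w).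
    rewrite !inE /big /slot lu => /andP[-> dw] /=; rewrite /high.
    by move: dw M12; clear; lia.
  have one w : w \in bignb M r u ->
      4 <= receipts u w + \sum_(C in S | (u, w) \in C) (aff C w : nat).
    move=> wb; have /andP[/and3P[ruw _ _] dw] := slot_big w wb.
    have : mult u w * 2 <= \sum_(C in S | (u, w) \in C) (from_face C u + from_vertex C u w)
              + \sum_(C in S | (u, w) \in C) (aff C w : nat).
      rewrite -sum_mult -big_split; apply: leq_sum => C /andP[CS uwC] /=.
      rewrite /aff; case: (boolP (third_low C u w)) => t; last first.
        by rewrite andbF addn0; apply: receive_ge2.
      rewrite /from_face /from_vertex t dw andbT; case: eqP => // _.
      by case: ifP => // _; case: ifP.
    have := twoS u w; rewrite -/(mult u w) /receipts; move: (mult u w) => k.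
    by case: k => [|[|[|k]]] // _; clear; lia.
  have affle : \sum_(w in bignb M r u) \sum_(C in S | (u, w) \in C) (aff C w : nat)
                 <= 2 * #|nb u :\: bignb M r u|.
    rewrite (exchange_big_dep (fun C => C \in S)) /=; last by move=> w C _ /andP[].
    apply: (@leq_trans (\sum_(C in S) #|[set z in nb u :\: bignb M r u | (u, z) \in C]|)).
      apply: leq_sum => C CS.
      case: (pickP (fun w => [&& w \in bignb M r u, (u, w) \in C & aff C w])) => [w|none]; last first.
        rewrite big1 // => w /and3P[wb _ uwC]; have := none w.
        by rewrite wb uwC /= => ->.
      case/and3P => wb uwC /andP[/eqP c6 t].
      have [z [lz ruz CE]] := third_nb CS c6 uwC t.
      have uE y : (u, y) \in C -> (y == w) || (y == z).
        rewrite CE !inE !xpair_eqE eqxx.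
        have uz : u != z by apply: contraTneq ruz => ->; rewrite ri.
        have uw := dart_neq (irrS CS) uwC.
        by rewrite (negPf uz) (negPf uw) /= ?orbF ?andbF ?orbF.
      have zb : z \notin bignb M r u.
        by rewrite inE /big negb_and -ltnNge; case/andP: lz => _ dz; rewrite (leq_ltn_trans dz) ?orbT //; move: M12; clear; lia.
      apply: (@leq_trans 1).
        rewrite (bigD1 w) /=; last by rewrite wb CS uwC.
        rewrite big1 ?addn0; first by rewrite leq_b1.
        move=> y /andP[/and3P[yb _ uyC] yw]; case/orP: (uE y uyC) => [/eqP ye|/eqP ye].
          by rewrite ye eqxx in yw.
        by rewrite ye (negPf zb) in yb.
      rewrite card_gt0; apply/set0Pn; exists z; rewrite !inE ruz.
      have -> : (u, z) \in C by rewrite CE !inE eqxx !orbT.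
      by move: zb; rewrite !inE ruz /= => ->.
    have -> : \sum_(C in S) #|[set z in nb u :\: bignb M r u | (u, z) \in C]| =
        \sum_(C in S) \sum_(z in nb u :\: bignb M r u | (u, z) \in C) 1.
      by apply: eq_bigr => C _; rewrite -sum1_card; apply: eq_bigl => z; rewrite !inE.
    rewrite (exchange_big_dep (fun z => z \in nb u :\: bignb M r u)) /=; last by move=> C z _ /andP[].
    rewrite mulnC -sum_nat_const; apply: leq_sum => z zN.
    rewrite sum1dep_card; apply: leq_trans (twoS u z); apply: subset_leq_card.
    by apply/subsetP => C; rewrite !inE => /and3P[-> _ ->].
  have total : 4 * #|bignb M r u| <= \sum_(w in bignb M r u) receipts u w
      + \sum_(w in bignb M r u) \sum_(C in S | (u, w) \in C) (aff C w : nat).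
    by rewrite -big_split mulnC -sum_nat_const; apply: leq_sum => w; apply: one.
  have sub : \sum_(w in bignb M r u) receipts u w <= \sum_(w | slot u w) receipts u w.
    rewrite [leqRHS](bigID (fun w => w \in bignb M r u)) /=; apply: leq_trans (leq_addr _ _).
    apply: eq_leq; apply: eq_bigl => w; case: (boolP (w \in bignb _ _ _)) => wb; rewrite ?andbF ?andbT //.
    by case/andP: (slot_big w wb).
  have c5 : #|nb u :\: bignb M r u| + #|bignb M r u| = 5.
    rewrite -du addnC; have := cardsID (bignb M r u) (nb u); rewrite (setIidPr _) => [->//|].
    by apply/subsetP => w; rewrite inE => /andP[].
  move: total affle sub f3 c5; clear; lia.
rewrite negb_or -leqNgt -eqn0Ngt cards_eq0 => /andP[m6 /eqP m7].
have dnb w : r u w -> M - 6 <= deg w.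
  move=> ruw; rewrite leqNgt; apply/negP => lt.
  have : w \in [set y in nb u | deg y <= M - 7] by rewrite !inE ruw /=; move: lt M12; clear; lia.
  by rewrite m7 inE.
pose B := [set w in nb u | M - 5 <= deg w].
have cB : 4 <= #|B|.
  have := cardsID B (nb u); rewrite -/(deg u) du.
  have -> : nb u :&: B = B by apply/setIidPr/subsetP => w; rewrite inE => /andP[].
  have : nb u :\: B \subset [set y in nb u | deg y <= M - 6].
    apply/subsetP => w; rewrite !inE => /andP[+ rw]; rewrite rw /= -ltnNge.
    by move: M12; clear; lia.
  by move/subset_leq_card; move: m6; clear; lia.
apply: (@leq_trans (\sum_(w in B) receipts u w)).
  apply: (@leq_trans (\sum_(w in B) 2)); first by rewrite sum_nat_const; move: cB; clear; lia.
  apply: leq_sum => w; rewrite !inE => /andP[ruw dw].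
  apply: (@receipts_ge 1) => // C CS uwC; rewrite /from_face /from_vertex.
  case: eqP => [c6|_]; last by case: ifP => // _; case: ifP.
  rewrite ifN; first by rewrite add0n; case: ifP => //; move: dw M12; clear; lia.
  apply/negP => t; have [z [lz ruz _]] := third_nb CS c6 uwC t.
  by have := dnb z ruz; case/andP: lz => _; move: M12; clear; lia.
rewrite [leqRHS](bigID (fun w => w \in B)) /=; apply: leq_trans (leq_addr _ _).
apply: eq_leq; apply: eq_bigl => w; case: (boolP (w \in B)) => wb; rewrite ?andbF ?andbT //.
move: wb; rewrite !inE /slot lu => /andP[-> dw]; rewrite /high.
by move: dw M12; clear; lia.
Qed.

Lemma low_vertex_demand u : low u ->
  8 * (6 - deg u) <= \sum_(w | slot u w) receipts u w + 12 * light M r u.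
Proof.
move=> lu.
have all_slots : deg u <= 4 -> forall b, (forall w, r u w -> b <= receipts u w) ->
    deg u * b <= \sum_(w | slot u w) receipts u w.
  move=> d4 b ge; apply: (@leq_trans (\sum_(w in nb u) b)).
    by rewrite sum_nat_const.
  rewrite (eq_bigl (fun w => slot u w)) => [|w]; last first.
    rewrite inE /slot lu /high; case: (boolP (r u w)) => //= ruw.
    by have := nb_le4 ruw d4; clear; lia.
  by apply: leq_sum => w /and3P[ruw _ _]; apply: ge.
have ge4 : deg u <= 4 -> forall w, r u w -> 4 <= receipts u w.
  by move=> d4 w ruw; apply: (@receipts_ge 2) => // C CS uwC; apply: receive_small.
have /andP[d0 d5] := lu.
have [w ruw] : exists w, r u w by move: d0; rewrite card_gt0 => /set0Pn[w]; rewrite inE; exists w.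
have d2 := low_ge2 ruw.
case: (ltngtP (deg u) 3) => [lt3|gt3|d3].
- have du : deg u = 2 by move: d2 lt3; clear; lia.
  rewrite /light du /=.
  have := all_slots _ 10; rewrite du => /(_ isT).
  by move=> h; have := h (fun w ruw => receipts_deg2 ruw du); clear; lia.
- case: (eqVneq (deg u) 5) => [du|nd5].
    case: (boolP (u \in [set x | light M r x])) => [|nl].
      by rewrite inE => ->; rewrite du; clear; lia.
    by have := receipts_big_nbs nl du; rewrite du; clear; lia.
  have du : deg u = 4 by move: gt3 d5 nd5; clear; lia.
  by have := all_slots _ 4 (ge4 _); rewrite du => /(_ isT isT); clear; lia.
have := all_slots _ 4 (ge4 _); rewrite /light d3 /= => /(_ isT isT); clear; lia.
Qed.

(** The last two terms are the contributions to light vertices; for M = 12 and deg w = M the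
    budget is exact. *)
Lemma high_vertex_budget w : high w ->
  cap w * deg w + 24 * (deg w == M) + 12 * (deg w == M.-1) <= 8 * (deg w - 6).
Proof.
rewrite /high /cap => hw; have := degM w; case: (ltnP 7 (deg w)) => [d8|d7] dM.
  by case: eqP => e1; case: eqP => e2; move: e1 e2 d8 M12 dM; clear; lia.
have -> : (deg w == M) = false by apply/eqP; move: d7 M12; clear; lia.
have -> : (deg w == M.-1) = false by apply/eqP; move: d7 M12; clear; lia.
by case: eqP => [->|_] //=; rewrite mul0n.
Qed.

(** The hypothesis, Euler's inequality for the set S of faces with edges counted twice, makes the
    total charge negative, whereas the transfers leave nothing negative. *)
Theorem discharging_contradiction :
  ~ #|[set p : V * V | r p.1 p.2]| + 2 <= 2 * #|S| + 2 * #|[set x | 0 < deg x]|.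
Proof.
move=> euler.
pose D := [set p : V * V | r p.1 p.2].
pose A := \sum_(u | low u) 8 * (6 - deg u).
pose B := \sum_(u | low u) \sum_(w | slot u w) \sum_(C in S | (u, w) \in C) from_face C u.
pose W := \sum_(u | low u) \sum_(w | slot u w) \sum_(C in S | (u, w) \in C) from_vertex C u w.
pose G := \sum_(u | low u) \sum_(w | slot u w) 16 * (2 - mult u w).
pose L := #|[set x | light M r x]|.
have lowslot u w : slot u w -> low u by case/and3P.
have lowsum (F : V -> V -> nat) :
    \sum_(u | low u) \sum_(w | slot u w) F u w = \sum_(p | slot p.1 p.2) F p.1 p.2.
  rewrite pair_big_dep /=; apply: eq_bigl => -[u w] /=.
  by case: (boolP (slot u w)) => [/lowslot->|]; rewrite ?andbF.
have demand : A <= B + W + G + 12 * L.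
  have -> : 12 * L = \sum_u 12 * (light M r u).
    rewrite -big_distrr /=; congr (_ * _); rewrite /L -sum1dep_card big_mkcond.
    by apply: eq_bigr => u _; case: (light M r u).
  rewrite (bigID low) /= addnA; apply: leq_trans (leq_addr _ _).
  rewrite -!big_split /=; apply: leq_sum => u lu.
  apply: leq_trans (low_vertex_demand lu) _; rewrite leq_add2r -!big_split /=.
  by apply: leq_sum => w _; rewrite /receipts big_split.
have faces : B <= \sum_(C in S) 8 * (#|C| - 6).
  rewrite /B lowsum (exchange_big_dep (fun C => C \in S)) /=; last by move=> p C _ /andP[].
  apply: leq_sum => C CS; apply: leq_trans (face_pays CS); apply: eq_leq.
  by apply: eq_bigl => -[u w]; rewrite CS.
have vertices : W + 24 * #|[set y | deg y == M]| + 12 * #|[set y | deg y == M.-1]|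
                  <= \sum_(w | high w) 8 * (deg w - 6).
  have W_le : W <= \sum_(w | high w) cap w * deg w.
    rewrite /W (exchange_big_dep high) /=; last by move=> u w _ /and3P[].
    apply: leq_sum => w hw; apply: leq_trans (vertex_pays w); apply: eq_leq.
    by apply: eq_bigl => u; case: (boolP (slot u w)) => [/lowslot->|]; rewrite ?andbF.
  have count k : 6 <= k -> #|[set y | deg y == k]| = \sum_(w | high w) (deg w == k).
    move=> k6; rewrite -sum1dep_card big_mkcond [RHS]big_mkcond /=; apply: eq_bigr => w _.
    by rewrite /high; case: eqP => [->|]; rewrite ?k6 //; case: ifP.
  rewrite !count; [|by move: M12; clear; lia..].
  rewrite !big_distrr /=.
  apply: leq_trans (leq_add (leq_add W_le (leqnn _)) (leqnn _)) _.
  by rewrite -!big_split /=; apply: leq_sum => w; apply: high_vertex_budget.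
have sumC : \sum_(C in S) #|C| = \sum_(p in D) mult p.1 p.2.
  under eq_bigr do rewrite -sum1_card.
  rewrite (exchange_big_dep (fun p => p \in D)) /=; last first.
    by move=> C [x y] CS xyC; rewrite inE; apply: (subS CS).
  by apply: eq_bigr => -[x y] _; rewrite sum1dep_card; apply: eq_card => C; rewrite !inE.
have missing : 2 * G <= \sum_(p in D) 16 * (2 - mult p.1 p.2).
  have multC x y : mult x y = mult y x.
    apply: eq_card => C; rewrite !inE; case CS: (C \in S) => //=.
    by apply/idP/idP; apply: symS.
  pose sw (p : V * V) := (p.2, p.1).
  have swK : involutive sw by case.
  have G2 : G = \sum_(p | slot p.2 p.1) 16 * (2 - mult p.1 p.2).
    rewrite /G lowsum (reindex_inj (inv_inj swK)) /=.
    by apply: eq_bigr => p _; rewrite multC.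
  rewrite mul2n -addnn {1}G2 /G lowsum.
  rewrite [leqRHS](bigID (fun p : V * V => slot p.2 p.1)) /= leq_add //.
    apply: eq_leq; apply: eq_bigl => p; rewrite inE rs andbC.
    by case: (boolP (slot _ _)) => //= /and3P[->].
  rewrite [leqRHS](bigID (fun p : V * V => slot p.1 p.2)) /=; apply: leq_trans (leq_addr _ _).
  apply: eq_leq; apply: eq_bigl => p; rewrite inE.
  case: (boolP (slot p.1 p.2)) => sl; rewrite ?andbF // (slot_asym sl) !andbT.
  by case/and3P: sl => ->.
have Dsum : #|D| = \sum_(x | 0 < deg x) deg x.
  rewrite -sum1dep_card -(pair_big_dep xpredT (fun x y => r x y) (fun _ _ => 1)) /=.
  rewrite (bigID (fun x => 0 < deg x)) /= [X in _ + X]big1 ?addn0.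
    by apply: eq_bigr => x _; rewrite sum1dep_card.
  move=> x; rewrite -eqn0Ngt cards_eq0 => /eqP nb0; rewrite big_pred0 // => y.
  by have := in_set0 y; rewrite -nb0 inE.
have degrees : \sum_(w | high w) 8 * (deg w - 6) + 48 * #|[set x | 0 < deg x]| = 8 * #|D| + A.
  rewrite Dsum -sum1dep_card !big_distrr /= /A.
  rewrite [X in _ + X = _](bigID high) /= [X in _ = X + _](bigID high) /=.
  have hE F : \sum_(w | (0 < deg w) && high w) F w = \sum_(w | high w) F w :> nat.
    by apply: eq_bigl => w; rewrite /high; case: (deg w).
  have lE F : \sum_(w | (0 < deg w) && ~~ high w) F w = \sum_(w | low w) F w :> nat.
    by apply: eq_bigl => w; rewrite /high /low -leqNgt.
  rewrite !hE !lE addnA -[in RHS]addnA -!big_split /=.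
  congr (_ + _); apply: eq_bigr => w; first by rewrite /high; clear; lia.
  by case/andP => _; clear; lia.
have facesum : \sum_(C in S) 8 * (#|C| - 6) + 48 * #|S| = 8 * \sum_(C in S) #|C|.
  rewrite mulnC -sum_nat_const -big_split big_distrr /=; apply: eq_bigr => C /face_size[ge6 _].
  have arith n : 6 <= n -> 8 * (n - 6) + 48 = 8 * n by clear; lia.
  exact: arith.
have missum : \sum_(p in D) 16 * (2 - mult p.1 p.2) + 16 * \sum_(p in D) mult p.1 p.2 = 32 * #|D|.
  rewrite big_distrr -big_split /= mulnC -sum_nat_const; apply: eq_bigr => p _.
  by have := twoS p.1 p.2; rewrite -/(mult p.1 p.2); move: (mult _ _) => k; clear; lia.
move: demand faces vertices few_light sumC missing degrees facesum missum euler.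
rewrite -/D -/L /reverse_coercion.
move: (\sum_(C in S) 8 * (#|C| - 6)) (\sum_(C in S) #|C|) (\sum_(p in D) mult p.1 p.2)
  (\sum_(w | high w) 8 * (deg w - 6)) (\sum_(p in D) 16 * (2 - mult p.1 p.2)) => a b c d e.
move: #|S| #|D| => s dd; clear; lia.
Qed.

End Discharging.

(** * Faces of a minor of a plane graph *)

Lemma xor_odd (I : Type) (s : seq I) (P : pred I) (F : I -> nat) :
  \big[addb/false]_(i <- s | P i) odd (F i) = odd (\sum_(i <- s | P i) F i).
Proof. exact/esym/(big_morph odd oddD). Qed.

Lemma xor_card (T : finType) (P b : pred T) :
  \big[addb/false]_(i | P i) b i = odd #|[set i | P i && b i]|.
Proof.
rewrite -sum1dep_card big_mkcondr -xor_odd; apply: eq_bigr => i _.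
by case: (b i).
Qed.

Lemma xor_symmetric (T : finType) (k : T -> T -> bool) :
  (forall p p', k p p' = k p' p) -> (forall p, k p p = false) ->
  \big[addb/false]_p \big[addb/false]_p' k p p' = false.
Proof.
move=> ks ki; rewrite pair_big /= (xor_card _ (fun pp => k pp.1 pp.2)).
apply/negbTE; apply: symmetric_set_even => [x y|x]; rewrite !inE /= ?ki //.
by rewrite ks.
Qed.

Section Host.
Variables (P Q : finType) (e : rel P) (inn : pred P) (s1 s2 : P -> P -> Q).
Hypotheses (es : symmetric e) (ei : irreflexive e).
Hypotheses (s1C : forall p p', s1 p p' = s1 p' p) (s2C : forall p p', s2 p p' = s2 p' p).
Hypothesis local_faces : forall (chi : Q -> bool) p, inn p ->
  \big[addb/false]_(p' | e p p') (chi (s1 p p') (+) chi (s2 p p')) = false.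
Hypothesis cycles_bound : forall h : P -> P -> bool,
  (forall p p', h p p' = h p' p) -> (forall p p', h p p' -> [&& e p p', inn p & inn p']) ->
  (forall p, \big[addb/false]_p' h p p' = false) ->
  exists f : Q -> bool, forall p p', e p p' -> h p p' = f (s1 p p') (+) f (s2 p p').

Variables (V : finType) (r : rel V).
Hypotheses (rs : symmetric r) (ri : irreflexive r).
Variables (blk : P -> option V) (root : V -> P) (g : V -> V -> P).
(** The blocks are the connected sets of pixels that are contracted to the vertices of the minor; [g]
    chooses, for an edge xy of the minor, the end in the block of x of an edge of the host. *)
Definition in_block v p p' := [&& e p p', blk p == Some v & blk p' == Some v].
Hypothesis blk_inn : forall p v, blk p = Some v -> inn p.
Hypothesis blk_conn : forall p v, blk p = Some v -> connect (in_block v) (root v) p.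
Hypothesis blk_g : forall x y, r x y -> blk (g x y) = Some x.
Hypothesis adj_g : forall x y, r x y -> e (g x y) (g y x).

Implicit Types (p q : P) (c : Q) (x y v : V) (Z : {set V * V}).

(** The edges of the host that survive in the minor, either contracted or as edges.  The other edges
    are deleted, which merges the cells on their two sides. *)
Definition wall p p' := [exists v, (blk p == Some v) && (blk p' == Some v)] ||
  [exists x, [exists y, [&& r x y, p == g x y & p' == g y x]]].

Definition open_to c c' := [exists p, [exists p', [&& e p p', ~~ wall p p' &
  ((c == s1 p p') && (c' == s2 p p')) || ((c' == s1 p p') && (c == s2 p p'))]]].

Lemma open_to_sym : symmetric open_to.
Proof.
move=> c c'; rewrite /open_to; apply: eq_existsb => p; apply: eq_existsb => p'.
by rewrite [X in _ && (_ && X)]orbC.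
Qed.

Lemma open_csym : connect_sym open_to.
Proof. exact: sym_connect_sym open_to_sym. Qed.

Lemma open_sides p p' : e p p' -> ~~ wall p p' -> open_to (s1 p p') (s2 p p').
Proof.
by move=> epp nw; apply/existsP; exists p; apply/existsP; exists p'; rewrite epp nw !eqxx.
Qed.

Definition left_of x y := s1 (g x y) (g y x).
Definition right_of x y := s2 (g x y) (g y x).

Definition face c : {set V * V} :=
  [set z | r z.1 z.2 && (connect open_to c (left_of z.1 z.2)
                     (+) connect open_to c (right_of z.1 z.2))].

Definition faces : {set {set V * V}} := [set face c | c : Q] :\ set0.

Lemma face_conn c c' : connect open_to c c' -> face c = face c'.
Proof.
move=> cc; apply/setP => z; rewrite !inE; congr (_ && (_ (+) _));
  exact: (same_connect open_csym cc).
Qed.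

Lemma facesP C : C \in faces -> exists c, C = face c.
Proof. by rewrite inE => /andP[_ /imsetP[c _ ->]]; exists c. Qed.

Lemma face_sub C x y : C \in faces -> (x, y) \in C -> r x y.
Proof. by move/facesP => [c ->]; rewrite inE => /andP[]. Qed.

Lemma face_sym C x y : C \in faces -> (x, y) \in C -> (y, x) \in C.
Proof.
move/facesP => [c ->]; rewrite !inE /= rs => /andP[-> /=].
by rewrite /left_of /right_of s1C s2C.
Qed.

Lemma face_two x y : #|[set C in faces | (x, y) \in C]| <= 2.
Proof.
apply: (@leq_trans #|[set face (left_of x y); face (right_of x y)]|); last by rewrite cards2; case: (_ != _).
apply: subset_leq_card; apply/subsetP => C; rewrite !inE => /andP[/andP[_ /imsetP[c _ ->]]].
rewrite inE /= => /andP[_]; case: (boolP (connect _ _ _)) => [/face_conn ->|_].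
  by rewrite eqxx.
by move=> /= /face_conn ->; rewrite eqxx orbT.
Qed.

(** Sum the differences of sides over all edges of the host with an end in the block of x.  The sum
    vanishes around every pixel.  Edges inside the block are counted twice and deleted edges have
    the same face on both sides, so only the edges of the minor at x remain. *)
Lemma face_even C x : C \in faces -> ~~ odd #|[set y | (x, y) \in C]|.
Proof.
move/facesP => [c ->]; pose chi (q : Q) := connect open_to c q.
pose d p p' := chi (s1 p p') (+) chi (s2 p p').
have dC p p' : d p p' = d p' p by rewrite /d s1C s2C.
have d0 p p' : e p p' -> ~~ wall p p' -> d p p' = false.
  move=> epp nw; rewrite /d /chi ![connect _ c _]open_csym.
  by rewrite (same_connect open_csym (connect1 (open_sides epp nw))) addbb.
have tot : \big[addb/false]_(p | blk p == Some x) \big[addb/false]_(p' | e p p') d p p' = false.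
  by rewrite big1 // => p /eqP bp; apply: local_faces; apply: blk_inn bp.
have inner : \big[addb/false]_(p | blk p == Some x)
     \big[addb/false]_(p' | e p p' && (blk p' == Some x)) d p p' = false.
  rewrite big_mkcond -[RHS](@xor_symmetric _ (fun p p' => in_block x p p' && d p p')).
  - apply: eq_bigr => p _; rewrite [RHS](eq_bigr (fun p' => if in_block x p p' then d p p' else false)).
      rewrite -big_mkcond /=; case: ifP => bp.
        by apply: eq_bigl => p'; rewrite /in_block bp.
      by rewrite big_pred0 // => p'; rewrite /in_block bp andbF.
    by move=> p' _; case: (in_block _ _ _).
  - by move=> p p'; rewrite dC /in_block es [(blk p == _) && _]andbC.
  - by move=> p; rewrite /in_block ei.
move: tot; under eq_bigr do rewrite (bigID (fun p' => blk p' == Some x)) /=.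
rewrite big_split inner /= => outer.
have := outer; rewrite pair_big_dep /= (bigID (fun pp => wall pp.1 pp.2)) /=.
rewrite [X in _ (+) X]big1 ?addbF; last first.
  by move=> [p p'] /= /andP[/and3P[_ epp _] nw]; apply: d0.
rewrite (reindex_onto (fun y => (g x y, g y x)) (fun pp => odflt x (blk pp.2))) /=; last first.
  move=> [p p'] /= /andP[/and3P[/eqP bp epp bp'] /orP[]].
    by case/existsP => v /andP[]; rewrite bp => /eqP[<-]; rewrite (negPf bp').
  case/existsP => x' /existsP[y /and3P[rxy /eqP pE /eqP p'E]].
  move: bp; rewrite pE blk_g // => -[xx]; rewrite p'E blk_g 1?rs //= xx.
  by rewrite -xx.
move=> sum0; apply/negP; rewrite -(xor_card xpredT (fun y => (x, y) \in face c)) => odd1.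
suff : true = false by [].
apply: etrans (esym odd1) (etrans _ sum0).
rewrite [RHS]big_mkcond /=; apply: eq_bigr => y _.
rewrite inE /=; case: (boolP (r x y)) => rxy /=.
  rewrite (blk_g rxy) adj_g // blk_g 1?rs // !eqxx /=.
  have yx : Some y != Some x by apply: contraTneq rxy => -[->]; rewrite ri.
  rewrite yx (_ : wall _ _ = true) //; apply/orP; right.
  by apply/existsP; exists x; apply/existsP; exists y; rewrite rxy !eqxx.
case: ifP => // /andP[/andP[/and3P[/eqP bx epp by_] /orP[]]].
  by case/existsP => v /andP[]; rewrite bx => /eqP[<-]; rewrite (negPf by_).
case/existsP => x' /existsP[y' /and3P[rxy' /eqP pE /eqP p'E]].
move: bx; rewrite pE blk_g // => -[xx]; rewrite p'E blk_g 1?rs //= => /eqP yy.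
by rewrite -xx -yy rxy' in rxy.
Qed.

(** Inside a block every pixel is joined to the root by a chain, i.e. an edge set with
    exactly these two odd vertices. *)
Lemma connect_chain (k : rel P) p q : (forall p p', k p p' -> e p p') -> symmetric k ->
  connect k p q -> exists A : P -> P -> bool,
    [/\ forall a b, A a b = A b a, forall a b, A a b -> k a b
      & forall a, \big[addb/false]_b A a b = (a == p) (+) (a == q)].
Proof.
move=> ke ks /connectP[s]; elim: s p => [|p' s IH] p /=.
  by move=> _ ->; exists (fun _ _ => false); split=> // a; rewrite big1 ?addbb.
case/andP => kpp /IH{}IH /IH[A [As Ak Ab]].
exists (fun a b => A a b (+) (((a == p) && (b == p')) || ((a == p') && (b == p)))).
have npp : p != p' by apply: contraTneq (ke _ _ kpp) => ->; rewrite ei.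
split=> [a b|a b|a].
- by rewrite As orbC ![_ && (b == _)]andbC.
- case: (boolP (A a b)) => [/Ak//|_] /= /orP[] /andP[/eqP-> /eqP->] //.
  by rewrite ks.
- rewrite big_split Ab /= (eq_bigr (fun b => ((a == p) && (b == p')) (+) ((a == p') && (b == p)))).
    have one (t : P) z : \big[addb/false]_b (z && (b == t)) = z.
      by rewrite (bigD1 t) //= eqxx andbT big1 ?addbF // => b /negPf->; rewrite andbF.
    by rewrite big_split !one /=; case: (a == p); case: (a == p'); case: (a == q).
  move=> b _; case: (eqVneq a p) => [->|_] //=; rewrite (negPf npp) /= orbF addbF //.
Qed.

Definition cycle Z := [/\ forall x y, (x, y) \in Z -> r x y,
  forall x y, (x, y) \in Z -> (y, x) \in Z & forall x, ~~ odd #|[set y | (x, y) \in Z]|].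

Lemma blk_inj x y x' y' : r x y -> r x' y' -> g x y = g x' y' -> x = x'.
Proof. by move=> rxy rxy' eqg; have := blk_g rxy; rewrite eqg blk_g // => -[]. Qed.

(** Join the ends of the edges of Z inside the blocks by chains through the roots; as Z is even, each
    root is used an even number of times. *)
Lemma cycle_lift Z : cycle Z -> exists h : P -> P -> bool,
  [/\ forall p p', h p p' = h p' p, forall p p', h p p' -> [&& e p p', inn p & inn p'],
      forall p, \big[addb/false]_p' h p p' = false,
      forall p p', e p p' -> ~~ wall p p' -> h p p' = false
    & forall x y, r x y -> h (g x y) (g y x) = ((x, y) \in Z)].
Proof.
case=> Zr Zs Ze.
have [K Kok] : exists K : V * V -> P -> P -> bool, forall z, r z.1 z.2 ->
    [/\ forall a b, K z a b = K z b a, forall a b, K z a b -> in_block z.1 a b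
      & forall a, \big[addb/false]_b K z a b = (a == root z.1) (+) (a == g z.1 z.2)].
  apply: (fin_all_exists (P := fun z (k : P -> P -> bool) => r z.1 z.2 ->
    [/\ forall a b, k a b = k b a, forall a b, k a b -> in_block z.1 a b
      & forall a, \big[addb/false]_b k a b = (a == root z.1) (+) (a == g z.1 z.2)])) => -[x y] /=.
  case: (boolP (r x y)) => [rxy|_]; last by exists (fun _ _ => false).
  have conn := blk_conn (blk_g rxy).
  have [||A Aok] := connect_chain _ _ conn; last by exists A.
    by move=> p p' /and3P[].
  by move=> p p'; rewrite /in_block es [(blk p == _) && _]andbC.
pose cross (z : V * V) p p' := (p == g z.1 z.2) && (p' == g z.2 z.1).
pose h p p' := \big[addb/false]_(z in Z) (K z p p' (+) cross z p p').
have Zok z : z \in Z -> r z.1 z.2 by case: z => x y; apply: Zr.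
have h_zero p p' : (forall z, z \in Z -> ~~ in_block z.1 p p') ->
    (forall z, z \in Z -> ~~ cross z p p') -> h p p' = false.
  move=> nb nc; rewrite /h big1 // => z zZ; rewrite (negPf (nc z zZ)) addbF.
  by have [_ Kb _] := Kok z (Zok z zZ); apply/negbTE; apply: contra (nb z zZ) => /Kb.
exists h; split.
- move=> p p'; rewrite /h !big_split /=; congr (_ (+) _).
    by apply: eq_bigr => z /Zok/Kok[Ks _ _]; apply: Ks.
  have swK : involutive (fun z : V * V => (z.2, z.1)) by case.
  rewrite (reindex_inj (inv_inj swK)) /=; apply: eq_big => [[x y]|[x y] _] /=.
    by apply/idP/idP; apply: Zs.
  by rewrite /cross /= andbC.
- move=> p p'; apply: contraLR => bad; rewrite h_zero // => z zZ.
    apply: contra bad => /and3P[-> /eqP b1 /eqP b2].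
    by rewrite (blk_inn b1) (blk_inn b2).
  apply: contra bad => /andP[/eqP-> /eqP->]; have rz := Zok z zZ.
  by rewrite adj_g // (blk_inn (blk_g rz)) (blk_inn (blk_g _)) // rs.
- move=> p; rewrite /h exchange_big /=.
  have -> : \big[addb/false]_(z in Z) \big[addb/false]_p' (K z p p' (+) cross z p p')
           = \big[addb/false]_(z in Z) (p == root z.1).
    apply: eq_bigr => z zZ; rewrite big_split /=.
    have [_ _ ->] := Kok z (Zok z zZ); rewrite /cross.
    rewrite (bigD1 (g z.2 z.1)) //= eqxx andbT big1 ?addbF => [|p' /negPf->]; last by rewrite andbF.
    by rewrite -addbA addbb addbF.
  rewrite (eq_bigl (fun z => xpredT z.1 && ((z.1, z.2) \in Z))) => [|[x y] //].
  rewrite -(pair_big_dep xpredT (fun x y => (x, y) \in Z) (fun x _ => p == root x)) /=.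
  rewrite big1 // => x _; rewrite (xor_card (fun y => (x, y) \in Z) (fun=> p == root x)).
  case: (p == root x); last first.
    by apply/negbTE; rewrite (_ : [set _ | _] = set0) ?cards0 //; apply/setP => y; rewrite !inE andbF.
  apply/negbTE; have := Ze x; congr (~~ odd _); apply: eq_card => y.
  by rewrite !inE andbT.
- move=> p p' epp nw; apply: h_zero => z zZ; apply: contra nw.
    by case/and3P => _ b1 b2; apply/orP; left; apply/existsP; exists z.1; rewrite b1 b2.
  case/andP => c1 c2; apply/orP; right; apply/existsP; exists z.1; apply/existsP; exists z.2.
  by rewrite Zok // c1 c2.
- move=> x y rxy; rewrite /h.
  have xy : x != y by apply: contraTneq rxy => ->; rewrite ri.
  rewrite (eq_bigr (fun z => z == (x, y))) => [|z zZ]; last first.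
    have [_ Kb _] := Kok z (Zok z zZ); rewrite (_ : K _ _ _ = false) /=; last first.
      apply/negbTE/negP => /Kb /and3P[_]; rewrite !blk_g // 1?rs // => /eqP[xE] /eqP[yE].
      by rewrite xE yE eqxx in xy.
    apply/andP/eqP => [[/eqP g1 /eqP g2]|->]; last by rewrite !eqxx.
    have rz := Zok z zZ; case: z {Kb} zZ g1 g2 rz => a b _ /= g1 g2 rab.
    rewrite (blk_inj rxy rab g1) (blk_inj _ _ g2) // rs //.
  case: (boolP ((x, y) \in Z)) => xyZ.
    by rewrite (bigD1 (x, y)) //= eqxx big1 // => z /andP[_ /negPf].
  by rewrite big1 // => z zZ; apply: contraNF xyZ => /eqP <-.
Qed.

(** Write the lift of Z as the boundary of a set f of cells.  Deleted edges are not in the lift, so f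
    is a union of classes of merged cells, and Z is the sum of the faces of these classes. *)
Lemma faces_span Z : cycle Z -> exists2 T : {set {set V * V}}, T \subset faces &
  forall z, (z \in Z) = \big[addb/false]_(C in T) (z \in C).
Proof.
move=> cZ; have [Zr _ _] := cZ; have [h [hs hi hb hw hg]] := cycle_lift cZ.
have [f hf] := cycles_bound hs hi hb.
have f_open c c' : connect open_to c c' -> f c = f c'.
  apply: (closed_connect (a := f)) => {}c {}c' /existsP[p /existsP[p' /and3P[epp nw]]].
  have eqf : f (s1 p p') = f (s2 p p').
    by have := hf p p' epp; rewrite hw //; case: (f _); case: (f _).
  by case/orP => /andP[/eqP-> /eqP->].
pose n (C : {set V * V}) := #|[set c | [&& roots open_to c, f c & face c == C]]|.
exists [set C in faces | odd (n C)]; first by apply/subsetP => C; rewrite inE => /andP[].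
move=> z; have -> : (z \in Z) = \big[addb/false]_(c | roots open_to c && f c) (z \in face c).
  case: (boolP (r z.1 z.2)) => rz; last first.
    rewrite big1 => [|c _]; last by rewrite inE (negPf rz).
    by apply: contraNF rz; case: z => x y; apply: Zr.
  have sum_f (q : Q) : \big[addb/false]_(c | roots open_to c && f c) connect open_to c q = f q.
    have rq : connect open_to q (fingraph.root open_to q) by apply: connect_root.
    case fq : (f q).
      rewrite (bigD1 (fingraph.root open_to q)) /=; last first.
        by rewrite (roots_root open_csym) -(f_open _ _ rq) fq.
      rewrite open_csym rq big1 // => c /andP[/andP[/eqP rc _] ne].
      apply: contraNF ne => cq; rewrite -rc; apply/eqP.
      by apply/(rootP open_csym).
    rewrite big1 // => c /andP[_ fc]; apply: contraTF fc => cq.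
    by rewrite (f_open _ _ cq) fq.
  under eq_bigr => c _ do rewrite inE rz /=.
  rewrite big_split /= !sum_f -(hf _ _ (adj_g rz)) hg //.
  by case: (z).
rewrite (partition_big face xpredT) //=.
rewrite [RHS](eq_bigl (fun C => (C \in faces) && odd (n C))) => [|C]; last by rewrite inE.
rewrite [RHS]big_mkcond; apply: eq_bigr => C _.
rewrite (eq_bigr (fun=> z \in C)) => [|c /andP[_ /eqP->]//].
rewrite (xor_card (fun c => roots open_to c && f c && (face c == C)) (fun=> z \in C)).
case: (boolP (z \in C)) => zC; last first.
  rewrite (_ : [set _ | _] = set0) ?cards0 //=; first by case: ifP.
  by apply/setP => c; rewrite !inE andbF.
have -> : [set c | roots open_to c && f c && (face c == C) && true] =
          [set c | [&& roots open_to c, f c & face c == C]].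
  by apply/setP => c; rewrite !inE andbT andbA.
rewrite -/(n C); case: (boolP (C \in faces)) => [_|nC] /=; first by case: (odd _).
rewrite /n (_ : [set _ | _] = set0) ?cards0 //.
apply/setP => c; rewrite !inE; apply: contraNF nC => /and3P[_ _ /eqP cC].
rewrite !inE -cC imset_f // andbT; apply/set0Pn; exists z; by rewrite cC.
Qed.

(** Choose one side of every edge, and a vertex v0.  A set A of edges is determined by the set of its odd
    vertices other than v0 and by the faces whose sum is the difference of A and a fixed set with
    the same odd vertices.  This injection bounds the number of sets of edges by that of pairs of
    a set of faces and a set of vertices without v0. *)
Theorem maclane_faces : (exists x y, r x y) ->
  #|[set p : V * V | r p.1 p.2]| + 2 <= 2 * #|faces| + 2 * #|[set x | [exists y, r x y]]|.
Proof.
case=> v0 [w0 rv0]; set D := [set p : V * V | _]; set V' := [set x | _].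
have v0V : v0 \in V' by rewrite inE; apply/existsP; exists w0.
pose sw (p : V * V) := (p.2, p.1).
have swK : involutive sw by case.
pose D1 := [set p in D | enum_rank p.1 < enum_rank p.2].
have rank_neq x y : r x y -> (enum_rank x < enum_rank y) || (enum_rank y < enum_rank x).
  by move=> rxy; rewrite -neq_ltn; apply: contraTneq rxy => /val_inj/enum_rank_inj->; rewrite ri.
have cardD : #|D| = 2 * #|D1|.
  rewrite mul2n -addnn -[X in _ = _ + X](card_imset _ (inv_inj swK)) -cardsUI.
  rewrite (_ : D1 :&: sw @: D1 = set0) ?cards0 ?addn0; last first.
    apply/setP => p; rewrite !inE; apply/negP => /andP[/andP[_ lt]].
    case/imsetP => q; rewrite inE => /andP[_ lt'] pE.
    by move: lt; rewrite pE /= ltnNge ltnW.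
  apply: eq_card => -[x y]; rewrite !inE /=; apply/idP/orP => [rxy|[/andP[]//|]].
    case/orP: (rank_neq x y rxy) => lt; [left|right]; first by rewrite rxy.
    by apply/imsetP; exists (y, x); rewrite // !inE /= rs rxy.
  by case/imsetP => -[a b]; rewrite !inE /= => /andP[rab _] [-> ->]; rewrite rs.
pose sy (A : {set V * V}) := [set p | (p \in A) || (sw p \in A)].
pose par (A : {set V * V}) x := odd #|[set y | (x, y) \in sy A]|.
pose phi A := [set x in V' :\ v0 | par A x].
pose sum (A B : {set V * V}) := [set p | (p \in sy A) (+) (p \in sy B)].
have sy_sym A x y : ((x, y) \in sy A) = ((y, x) \in sy A) by rewrite !inE orbC.
have sum_cycle (A B : {set V * V}) : A \subset D1 -> B \subset D1 -> phi A = phi B -> cycle (sum A B).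
  move=> sA sB eqphi; pose Z := sum A B.
  have syr (E : {set V * V}) x y : E \subset D1 -> (x, y) \in sy E -> r x y.
    move=> sE; rewrite inE => /orP[] /(subsetP sE); rewrite !inE /= => /andP[] //.
    by rewrite rs.
  have Zr x y : (x, y) \in Z -> r x y.
    rewrite inE; case: (boolP (_ \in sy A)) => [/(syr _ _ _ sA)//|_] /=; exact: syr.
  have ZE x y : ((x, y) \in Z) = ((x, y) \in sy A) (+) ((x, y) \in sy B) by rewrite [LHS]inE.
  have Zs x y : (x, y) \in Z -> (y, x) \in Z by rewrite !ZE !(sy_sym _ y x).
  have odd_sum x : odd #|[set y | (x, y) \in Z]| = par A x (+) par B x.
    have card_xor (F : {set V * V}) : odd #|[set y | (x, y) \in F]| = \big[addb/false]_y ((x, y) \in F).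
      by rewrite (xor_card xpredT (fun y => (x, y) \in F)).
    rewrite /par !card_xor -big_split /=; apply: eq_bigr => y _; by rewrite [LHS]inE.
  have even_off x : x != v0 -> ~~ odd #|[set y | (x, y) \in Z]|.
    move=> xv; case: (boolP (x \in V')) => xV.
      have phiE E : (x \in phi E) = par E x by rewrite in_set in_setD1 xv xV.
      by rewrite odd_sum -!phiE eqphi addbb.
    rewrite (_ : [set _ | _] = set0) ?cards0 //; apply/setP => y; rewrite in_set in_set0.
    by apply: contraNF xV => /Zr rxy; rewrite inE; apply/existsP; exists y.
  split=> // x; case: (eqVneq x v0) => [->|]; last exact: even_off.
  have : ~~ odd #|Z|.
    by apply: symmetric_set_even => // z; apply/negP => /Zr; rewrite ri.
  have -> : #|Z| = \sum_x #|[set y | (x, y) \in Z]|.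
    under eq_bigr do rewrite -sum1dep_card.
    by rewrite pair_big_dep /= sum1dep_card; apply: eq_card => -[a b]; rewrite !inE.
  rewrite -xor_odd (bigD1 v0) //= big1 ?addbF // => z zv.
  exact/negbTE/even_off.
have [T TZ] : exists T : {set V * V} -> {set {set V * V}}, forall Z, cycle Z ->
    T Z \subset faces /\ forall z, (z \in Z) = \big[addb/false]_(C in T Z) (z \in C).
  apply: (fin_all_exists (P := fun Z (T : {set {set V * V}}) => cycle Z ->
    T \subset faces /\ forall z, (z \in Z) = \big[addb/false]_(C in T) (z \in C))) => Z.
  case: (boolP [exists T : {set {set V * V}}, (T \subset faces) &&
     [forall z, (z \in Z) == \big[addb/false]_(C in T) (z \in C)]]).
    by case/existsP => T /andP[sT /forallP spanT]; exists T => _; split=> // z; apply/eqP.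
  move=> no; exists set0 => /faces_span[T sT spanT]; case/existsP: no; exists T.
  by rewrite sT; apply/forallP => z; rewrite spanT.
pose rep t := odflt set0 [pick A : {set V * V} | (A \subset D1) && (phi A == t)].
have repP (A : {set V * V}) : A \subset D1 -> rep (phi A) \subset D1 /\ phi (rep (phi A)) = phi A.
  move=> sA; rewrite /rep; case: pickP => [B /andP[sB /eqP]//|/(_ A)].
  by rewrite sA eqxx.
pose code A := (T (sum A (rep (phi A))), phi A).
have code_inj : {in powerset D1 &, injective code}.
  move=> A B; rewrite !inE => sA sB [eqT eqphi].
  have [srA phA] := repP A sA; have [srB phB] := repP B sB.
  have [_ spA] := TZ _ (sum_cycle A _ sA srA (esym phA)).
  have [_ spB] := TZ _ (sum_cycle B _ sB srB (esym phB)).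
  have eqsy z : (z \in sy A) = (z \in sy B).
    have : (z \in sum A (rep (phi A))) = (z \in sum B (rep (phi B))).
      by rewrite spA spB eqT.
    rewrite eqphi [LHS]inE [RHS]inE.
    by case: (z \in sy A); case: (z \in sy B); case: (z \in sy _).
  have back (E : {set V * V}) z : E \subset D1 -> (z \in E) = (z \in sy E) && (enum_rank z.1 < enum_rank z.2).
    move=> sE; apply/idP/andP => [zE|[]].
      by rewrite inE zE; split=> //; have := subsetP sE z zE; rewrite inE => /andP[].
    rewrite inE => /orP[//|/(subsetP sE)]; rewrite inE => /andP[_ lt] /ltnW.
    by rewrite leqNgt lt.
  by apply/setP => z; rewrite (back A) // (back B) // eqsy.
have : #|powerset D1| <= #|setX (powerset faces) (powerset (V' :\ v0))|.
  rewrite -(card_in_imset code_inj); apply: subset_leq_card.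
  apply/subsetP => _ /imsetP[A + ->]; rewrite !inE => sA.
  have [srA phA] := repP A sA.
  have [-> _] := TZ _ (sum_cycle A _ sA srA (esym phA)).
  by apply/subsetP => x; rewrite inE => /andP[].
rewrite cardsX !card_powerset -expnD leq_exp2l //.
by have := cardsD1 v0 V'; rewrite v0V cardD /reverse_coercion; clear; lia.
Qed.

End Host.

(** * The square grid as a plane graph *)

Section Grid.
Variable m : nat.
Local Notation pixel := ('I_m.+1 * 'I_m.+1)%type.
Implicit Types p q : pixel.

Definition grid_adj p q : bool :=
  (p.1 == q.1) && ((p.2.+1 == q.2 :> nat) || (q.2.+1 == p.2 :> nat)) ||
  (p.2 == q.2) && ((p.1.+1 == q.1 :> nat) || (q.1.+1 == p.1 :> nat)).

Definition inner p := (0 < p.1 < m) && (0 < p.2 < m).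

Definition pix i j : pixel := (inord i, inord j).

(** The cells are indexed by their lower left corners. *)
Definition side1 p q : pixel := pix (minn p.1 q.1) (minn p.2 q.2).

Definition side2 p q : pixel :=
  if p.2 == q.2 then pix (minn p.1 q.1) (minn p.2 q.2).-1
  else pix (minn p.1 q.1).-1 (minn p.2 q.2).

Lemma grid_adj_sym : symmetric grid_adj.
Proof.
move=> p q; rewrite /grid_adj eq_sym [p.2 == _]eq_sym.
by rewrite [(p.2.+1 == _) || _]orbC [(p.1.+1 == _) || _]orbC.
Qed.

Lemma grid_adj_irr : irreflexive grid_adj.
Proof. by move=> p; rewrite /grid_adj !eqxx /=; lia. Qed.

Lemma side1C p q : side1 p q = side1 q p.
Proof. by rewrite /side1 minnC [minn p.2 _]minnC. Qed.

Lemma side2C p q : side2 p q = side2 q p.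
Proof. by rewrite /side2 eq_sym minnC [minn p.2 _]minnC. Qed.

Lemma pixK p : pix p.1 p.2 = p.
Proof. by case: p => a b; rewrite /pix !inord_val. Qed.

Lemma pix_eq p i j : i <= m -> j <= m -> (p == pix i j) = (p.1 == i :> nat) && (p.2 == j :> nat).
Proof. by move=> im jm; case: p => a b; rewrite xpair_eqE -!val_eqE /= !inordK. Qed.

Lemma sum_neighbours (F : pixel -> bool) i j : 0 < i < m -> 0 < j < m ->
  \big[addb/false]_(q | grid_adj (pix i j) q) F q =
  F (pix i.+1 j) (+) (F (pix i.-1 j) (+) (F (pix i j.+1) (+) F (pix i j.-1))).
Proof.
move=> /andP[i0 im] /andP[j0 jm].
have adjE q : grid_adj (pix i j) q =
    [|| q == pix i.+1 j, q == pix i.-1 j, q == pix i j.+1 | q == pix i j.-1].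
  rewrite !pix_eq; try by move: i0 im j0 jm; clear; lia.
  by rewrite /grid_adj -!val_eqE /= !inordK; move: i0 im j0 jm; clear; lia.
rewrite (bigD1 (pix i.+1 j)) /=; last by rewrite adjE eqxx.
rewrite (bigD1 (pix i.-1 j)) /=; last first.
  by rewrite adjE eqxx orbT pix_eq /= ?inordK; move: i0 im j0 jm; clear; lia.
rewrite (bigD1 (pix i j.+1)) /=; last first.
  by rewrite adjE eqxx !orbT !pix_eq /= ?inordK; move: i0 im j0 jm; clear; lia.
rewrite (bigD1 (pix i j.-1)) /=; last first.
  by rewrite adjE eqxx !orbT !pix_eq /= ?inordK; move: i0 im j0 jm; clear; lia.
rewrite big_pred0 ?addbF // => q; rewrite adjE.
by case: (q == _); case: (q == _); case: (q == _); case: (q == _).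
Qed.

Lemma grid_local_faces (chi : pixel -> bool) p : inner p ->
  \big[addb/false]_(q | grid_adj p q) (chi (side1 p q) (+) chi (side2 p q)) = false.
Proof.
case/andP => h1 h2; have := h1; have := h2; move=> /andP[j0 jm] /andP[i0 im].
rewrite -{1}(pixK p) sum_neighbours //.
have vr : (inord p.1.+1 : 'I_m.+1) = p.1.+1 :> nat by rewrite inordK.
have vl : (inord p.1.-1 : 'I_m.+1) = p.1.-1 :> nat by rewrite inordK //; move: im; clear; lia.
have vu : (inord p.2.+1 : 'I_m.+1) = p.2.+1 :> nat by rewrite inordK.
have vd : (inord p.2.-1 : 'I_m.+1) = p.2.-1 :> nat by rewrite inordK //; move: jm; clear; lia.
rewrite /side1 /side2 /pix /= !inord_val !eqxx -!val_eqE /= vr vl vu vd.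
have -> : (nat_of_ord p.2 == p.2.+1) = false by clear; lia.
have -> : (nat_of_ord p.2 == p.2.-1) = false by move: j0; clear; lia.
have -> : minn p.1 p.1.+1 = p.1 by clear; lia.
have -> : minn p.1 p.1.-1 = p.1.-1 by clear; lia.
have -> : minn p.2 p.2.+1 = p.2 by clear; lia.
have -> : minn p.2 p.2.-1 = p.2.-1 by clear; lia.
rewrite !minnn !inord_val.
by case: (chi _); case: (chi _); case: (chi _); case: (chi _).
Qed.

(** The set f contains the cells above an odd number of horizontal edges of h. *)
Lemma grid_cycles_bound (h : pixel -> pixel -> bool) :
    (forall p q, h p q = h q p) -> (forall p q, h p q -> [&& grid_adj p q, inner p & inner q]) ->
    (forall p, \big[addb/false]_q h p q = false) ->
  exists f : pixel -> bool, forall p q, grid_adj p q -> h p q = f (side1 p q) (+) f (side2 p q).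
Proof.
move=> hs hi hb.
pose hz i k := (i < m) && h (pix i k) (pix i.+1 k).
pose vt i k := (k < m) && h (pix i k) (pix i k.+1).
pose f p := \big[addb/false]_(k < p.2.+1) hz p.1 k.
have innE i j : i <= m -> j <= m -> inner (pix i j) = (0 < i < m) && (0 < j < m).
  by move=> im jm; rewrite /inner /= !inordK.
have h0 p q : ~~ inner p -> h p q = false.
  by move=> np; apply: contraNF np => /hi/and3P[].
have h0' p q : ~~ inner q -> h p q = false by rewrite hs; apply: h0.
have even i j : 0 < i -> i <= m -> 0 < j -> j <= m ->
    (hz i j (+) hz i.-1 j) = (vt i j (+) vt i j.-1).
  move=> i0 im j0 jm; case: (boolP (inner (pix i j))) => inn; last first.
    rewrite /hz /vt !(h0 (pix i j)) //.
    by rewrite [h (pix i.-1 j) _]h0' ?[h (pix i j.-1) _]h0' ?prednK // !andbF.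
  have := hb (pix i j); rewrite (bigID (grid_adj (pix i j))) /=.
  rewrite [X in _ (+) X]big1 ?addbF; last by move=> q; apply: contraNF => /hi/and3P[].
  move: inn; rewrite innE // => /andP[ii jj]; rewrite sum_neighbours //.
  move: ii jj => /andP[_ lti] /andP[_ ltj]; rewrite /hz /vt lti ltj.
  rewrite (leq_ltn_trans (leq_pred _) lti) (leq_ltn_trans (leq_pred _) ltj) !prednK //=.
  rewrite [h (pix i.-1 j) _]hs [h (pix i j.-1) _]hs.
  by case: (h _ _); case: (h _ _); case: (h _ _); case: (h _ _).
have vsum i j : 0 < i -> i <= m -> j <= m ->
    \big[addb/false]_(k < j.+1) (hz i k (+) hz i.-1 k) = vt i j.
  move=> i0 im; elim: j => [|j IH] jm.
    rewrite big_ord1 /hz /vt !h0 ?andbF // innE // ?ltnn ?andbF //.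
    by move: im; clear; lia.
  by rewrite big_ord_recr /= IH 1?ltnW // even //= addbC addbK.
exists f => p q pq.
wlog : p q pq / (p.2 == q.2) && (p.1.+1 == q.1 :> nat) || (p.1 == q.1) && (p.2.+1 == q.2 :> nat).
  move=> main; case/orP: (pq) => /andP[/eqP e1 /orP[] e2].
  - by apply: main; rewrite // e1 e2 eqxx orbT.
  - by rewrite hs side1C side2C; apply: main; rewrite 1?grid_adj_sym // e1 e2 eqxx orbT.
  - by apply: main; rewrite // e1 e2 eqxx.
  - by rewrite hs side1C side2C; apply: main; rewrite 1?grid_adj_sym // e1 e2 eqxx.
case: p q pq => [a b] [a' b'] /= _; case/orP => /andP[/eqP e1 /eqP e2].
  (* The cells on the two sides of a horizontal edge differ by that edge alone. *)
  rewrite -e1 /side1 /side2 /= eqxx minnn.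
  have -> : minn a a' = a by move: e2; clear; lia.
  have am : a < m by have := ltn_ord a'; rewrite -e2 ltnS.
  have hE : h (a, b) (a', b) = hz a b.
    by rewrite /hz am /pix e2 !inord_val.
  rewrite hE /pix !inord_val /f /=; case: (posnP b) => b0.
    rewrite b0 /= -b0 inord_val addbb /hz h0 ?andbF //.
    by rewrite innE ?b0 ?andbF // -ltnS.
  rewrite inordK; last by have := ltn_ord b; clear; lia.
  by rewrite prednK // big_ord_recr /= addbAC addbb.
rewrite -e1 /side1 /side2 /= minnn.
have -> : (b == b') = false by rewrite -val_eqE /=; move: e2; clear; lia.
have -> : minn b b' = b by move: e2; clear; lia.
have bm : b < m by have := ltn_ord b'; rewrite -e2 ltnS.
have hE : h (a, b) (a, b') = vt a b.
  by rewrite /vt bm /pix e2 !inord_val.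
rewrite hE /pix !inord_val /f /=; case: (posnP a) => a0.
  rewrite a0 /= -a0 inord_val addbb /vt h0 ?andbF //.
  by rewrite innE ?a0 // -ltnS.
rewrite inordK; last by have := ltn_ord a; clear; lia.
by rewrite -big_split /= vsum // -ltnS.
Qed.

End Grid.

(** * Labelling the minors of grids *)

Record grid_model (V : finType) (r : rel V) (m : nat) := GridModel {
  blk : 'I_m.+1 * 'I_m.+1 -> option V;
  root : V -> 'I_m.+1 * 'I_m.+1;
  gate : V -> V -> 'I_m.+1 * 'I_m.+1;
  blk_inner : forall p v, blk p = Some v -> inner p;
  blk_connect : forall p v, blk p = Some v -> connect (in_block (@grid_adj m) blk v) (root v) p;
  blk_gate : forall x y, r x y -> blk (gate x y) = Some x;
  gate_adj : forall x y, r x y -> grid_adj (gate x y) (gate y x) }.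

Lemma grid_model_sub (V : finType) (r r' : rel V) m :
  (forall x y, r' x y -> r x y) -> grid_model r m -> grid_model r' m.
Proof.
move=> sub [b ro g h1 h2 h3 h4]; apply: (@GridModel _ _ _ b ro g) => // x y /sub.
  exact: h3.
exact: h4.
Qed.

(** Induction on the number of edges: a counterexample all of whose proper subgraphs are
    labelled satisfies the hypotheses of the discharging argument. *)
Lemma labelling_of_grid_model (V : finType) (r : rel V) m M :
    symmetric r -> irreflexive r -> 12 <= M -> (forall x, rdeg r x <= M) -> grid_model r m ->
  exists (cv : V -> 'I_M.+3) ce, plabel set0 r cv ce.
Proof.
have [k] := ubnP #|[set p : V * V | r p.1 p.2]|.
elim: k => // k IHk in r * => /ltnSE-ler rs ri M12 degM model.
apply: boolp.contrapT => none.
have Hbad (cv : V -> 'I_M.+3) ce : ~ plabel set0 r cv ce.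
  by move=> lab; apply: none; exists cv, ce.
have Hmin (r' : rel V) : symmetric r' -> (forall x y, r' x y -> r x y) ->
    (exists x y, r x y && ~~ r' x y) -> exists (cv : V -> 'I_M.+3) ce, plabel set0 r' cv ce.
  move=> r's sub [x [y /andP[rxy nr'xy]]]; apply: IHk => //.
  - apply: leq_trans ler; apply/proper_card/properP; split.
      by apply/subsetP => -[a b]; rewrite !inE /=; apply: sub.
    by exists (x, y); rewrite !inE.
  - by move=> z; apply/negbTE/negP => /sub; rewrite ri.
  - move=> z; apply: leq_trans (degM z); apply: subset_leq_card.
    by apply/subsetP => y'; rewrite !inE; apply: sub.
  - exact: grid_model_sub model.
have [v0 [w0 rvw]] : exists x y, r x y.
  apply: boolp.contrapT => no; apply: (@Hbad (fun=> ord0) (fun _ _ => ord0)).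
  by split=> x y; intros; exfalso; apply: no; exists x, y.
case: model => b ro g h1 h2 h3 h4.
have a1 := @grid_adj_sym m; have a2 := @grid_adj_irr m.
have a3 := @side1C m; have a4 := @side2C m.
have a5 := @grid_local_faces m; have a6 := @grid_cycles_bound m.
pose S := faces (@grid_adj m) (@side1 m) (@side2 m) r b g.
have euler : #|[set p : V * V | r p.1 p.2]| + 2 <= 2 * #|S| + 2 * #|[set x | [exists y, r x y]]|.
  by apply: (maclane_faces a1 a2 a6 rs ri h1 h2 h3 h4); exists v0, w0.
apply: (@discharging_contradiction V M r S rs ri M12 degM).
- by move=> u v; apply: (deg_sum_le3 rs ri M12 Hmin Hbad).
- by move=> u v; apply: (deg_nb4 rs ri M12 Hmin Hbad).
- by move=> u x v w; apply: (no_twins rs ri M12 degM Hmin Hbad).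
- by apply: (card_light rs ri M12 degM Hmin Hbad).
- by move=> C x y; apply: face_sub.
- by move=> C x y; apply: face_sym.
- by rewrite !inE eqxx.
- by move=> C x; apply: (face_even _ _ _ _ a5 _ _ h1).
- by move=> x y; apply: face_two.
have <- : [set x | [exists y, r x y]] = [set x | 0 < rdeg r x]; last exact: euler.
apply/setP => x; rewrite !inE card_gt0; apply/existsP/set0Pn => -[y].
  by exists y; rewrite inE.
by rewrite inE; exists y.
Qed.

(** * From sampled arcs to a minor of a grid *)

Section DiscreteDrawing.
Variables (V E : finType) (r : rel V) (m n : nat).
Local Notation pixel := ('I_m.+1 * 'I_m.+1)%type.
Variables (src tgt : E -> V) (path_of : E -> nat -> pixel) (point : V -> pixel).
Local Notation q := path_of.
Implicit Types (a b : E) (v w x y : V) (p : pixel) (i j : nat).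

(** The samples 0, ..., 6 n of an arc are cut in three parts.  The first and the last part belong to the
    stars of the ends, which are disjoint; the middle parts of distinct arcs are disjoint. *)
Definition outer_part v a i := (src a == v) && (i <= 2 * n) || (tgt a == v) && (4 * n <= i <= 6 * n).
Definition middle_part i := 2 * n <= i <= 4 * n.

Hypothesis edges_r : forall x y, r x y ->
  exists a, (src a = x /\ tgt a = y) \/ (src a = y /\ tgt a = x).
Hypothesis ends_inj : forall a b,
  (src a = src b /\ tgt a = tgt b) \/ (src a = tgt b /\ tgt a = src b) -> a = b.
Hypothesis src_tgt : forall a, src a != tgt a.
Hypothesis q_step : forall a i, i < 6 * n -> (q a i == q a i.+1) || grid_adj (q a i) (q a i.+1).
Hypothesis q_inner : forall a i, inner (q a i).
Hypothesis q_src : forall a, q a 0 = point (src a).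
Hypothesis q_tgt : forall a, q a (6 * n) = point (tgt a).
Hypothesis outer_outer : forall v w a b i j, outer_part v a i -> outer_part w b j ->
  q a i = q b j -> v = w.
Hypothesis middle_middle : forall a b i j, middle_part i -> middle_part j -> q a i = q b j -> a = b.
Hypothesis middle_outer : forall v a b i j, middle_part i -> outer_part v b j ->
  q a i = q b j -> (v == src a) || (v == tgt a).

Definition star v p := [exists a, [exists i : 'I_(6 * n).+1, outer_part v a i && (q a i == p)]].

Lemma starP v p : reflect (exists a i, outer_part v a i /\ q a i = p) (star v p).
Proof.
apply: (iffP existsP) => [[a /existsP[i /andP[o /eqP <-]]]|[a [i [o <-]]]]; first by exists a, i.
have lti : i < (6 * n).+1 by move: o; rewrite /outer_part; clear; lia.
by exists a; apply/existsP; exists (Ordinal lti); rewrite o eqxx.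
Qed.

Lemma outer_star v a i : outer_part v a i -> star v (q a i).
Proof. by move=> o; apply/starP; exists a, i. Qed.

Lemma hit_ex a : exists j, (2 * n <= j) && star (tgt a) (q a j).
Proof.
exists (4 * n); rewrite outer_star /outer_part ?eqxx /=; first by clear; lia.
by apply/orP; right; clear; lia.
Qed.

(** The first sample of the middle part lying in the star of the target. *)
Definition hit a := ex_minn (hit_ex a).

Lemma hitP a : [/\ star (tgt a) (q a (hit a)), 2 * n < hit a <= 4 * n &
  forall j, 2 * n <= j < hit a -> ~~ star (tgt a) (q a j)].
Proof.
rewrite /hit; case: ex_minnP => h /andP[h2 sh] hmin.
have h4 : h <= 4 * n.
  apply: hmin; rewrite outer_star /outer_part ?eqxx /=; first by clear; lia.
  by apply/orP; right; clear; lia.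
split=> // [|j /andP[j2 jh]]; last first.
  by apply/negP => sj; have := hmin j; rewrite j2 sj leqNgt jh => /(_ isT).
rewrite h4 andbT ltn_neqAle h2 andbT; apply/negP => /eqP he.
move: sh; rewrite -he => /starP[b [j [o eqq]]].
have o' : outer_part (src a) a (2 * n) by rewrite /outer_part eqxx leqnn.
by have := src_tgt a; rewrite (outer_outer o o' eqq) eqxx.
Qed.

Definition prefix v p :=
  [exists a, (src a == v) && [exists j : 'I_(hit a), (2 * n <= j) && (q a j == p)]].

Lemma prefixP v p :
  reflect (exists a j, [/\ src a = v, 2 * n <= j < hit a & q a j = p]) (prefix v p).
Proof.
apply: (iffP existsP) => [[a /andP[/eqP av /existsP[j /andP[j2 /eqP qj]]]]|[a [j [av /andP[j2 jh] qj]]]].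
  by exists a, j; rewrite j2 ltn_ord.
by exists a; rewrite av eqxx; apply/existsP; exists (Ordinal jh); rewrite /= j2 qj eqxx.
Qed.

Definition territory v p := star v p || prefix v p.

Lemma prefix_middle a j : 2 * n <= j < hit a -> middle_part j.
Proof. by have [_ h _] := hitP a; rewrite /middle_part; move: h; clear; lia. Qed.

(** A middle part meets only the stars of its ends, and its prefix avoids the star of the target. *)
Lemma star_prefix v w p : star v p -> prefix w p -> v = w.
Proof.
move=> sv /prefixP[a [j [aw jh qj]]]; have [_ _ before] := hitP a.
have /starP[b [i [o qi]]] := sv.
case/orP: (middle_outer (prefix_middle jh) o (etrans qj (esym qi))) => /eqP vE.
  by rewrite vE.
by have := before j jh; rewrite -vE qj sv.
Qed.

Lemma territory_inj v w p : territory v p -> territory w p -> v = w.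
Proof.
case/orP => [sv|pv]; case/orP => [sw|pw].
- case/starP: sv => a [i [o qi]]; case/starP: sw => b [j [o' qj]].
  by apply: outer_outer o o' _; rewrite qi qj.
- exact: star_prefix sv pw.
- exact/esym/(star_prefix sw pv).
- case/prefixP: pv => a [i [<- hi qi]]; case/prefixP: pw => b [j [<- hj qj]].
  by rewrite (middle_middle (prefix_middle hi) (prefix_middle hj) (etrans qi (esym qj))).
Qed.

Definition owner p := [pick v | territory v p].

Lemma ownerE p v : (owner p == Some v) = territory v p.
Proof.
rewrite /owner; case: pickP => [w tw|none]; last by rewrite none.
by apply/eqP/idP => [[<-]//|tv]; rewrite (territory_inj tw tv).
Qed.

Lemma owner_some p v : owner p = Some v -> territory v p.
Proof. by rewrite -ownerE => ->. Qed.

Local Notation within_block v := (in_block (@grid_adj m) owner v).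

Lemma segment_connect v a i j : i <= j <= 6 * n ->
  (forall k, i <= k <= j -> territory v (q a k)) -> connect (within_block v) (q a i) (q a j).
Proof.
case/andP; elim: j => [|j IH]; first by rewrite leqn0 => /eqP->.
rewrite leq_eqVlt => /orP[/eqP-> //|]; rewrite ltnS => ij jn tk.
apply: connect_trans (IH ij (ltnW jn) _) _.
  by move=> k /andP[ik kj]; apply: tk; rewrite ik leqW.
case/orP: (q_step a jn) => [/eqP->//|adj]; apply: connect1.
by rewrite /in_block adj !ownerE !tk // ?ij ?leqnn ?leqW.
Qed.

Lemma block_csym v : connect_sym (within_block v).
Proof.
apply: sym_connect_sym => x y; rewrite /in_block grid_adj_sym.
by rewrite [(owner x == _) && _]andbC.
Qed.

Lemma territory_connect v p : territory v p -> connect (within_block v) (point v) p.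
Proof.
case/orP => [/starP[a [i [/orP[/andP[/eqP sa i2]|/andP[/eqP ta /andP[i4 i6]]] <-]]]|].
- rewrite -sa -q_src; apply: segment_connect; first by move: i2; clear; lia.
  move=> k /andP[_ ki]; apply/orP; left; apply: outer_star.
  by rewrite /outer_part eqxx (leq_trans ki i2).
- rewrite -ta -q_tgt block_csym; apply: segment_connect; first by rewrite i6 leqnn.
  move=> k /andP[ik k6]; apply/orP; left; apply: outer_star.
  by rewrite /outer_part eqxx k6 (leq_trans i4 ik) orbT.
case/prefixP => a [j [<- /andP[j2 jh] <-]]; rewrite -q_src.
have [_ h _] := hitP a.
apply: segment_connect; first by move: jh h; clear; lia.
move=> k /andP[_ kj]; case: (leqP k (2 * n)) => k2.
  by apply/orP; left; apply: outer_star; rewrite /outer_part eqxx k2.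
apply/orP; right; apply/prefixP; exists a, k; split=> //.
by rewrite ltnW //= (leq_ltn_trans kj jh).
Qed.

Definition arc_from_to x y := [pick a | (src a == x) && (tgt a == y)].

Definition gate_of x y : pixel :=
  if arc_from_to x y is Some a then q a (hit a).-1
  else if arc_from_to y x is Some a then q a (hit a) else pix m 0 0.

Lemma gates x y : r x y -> exists a,
  (src a = x /\ tgt a = y /\ gate_of x y = q a (hit a).-1 /\ gate_of y x = q a (hit a)) \/
  (src a = y /\ tgt a = x /\ gate_of x y = q a (hit a) /\ gate_of y x = q a (hit a).-1).
Proof.
have arcE a : arc_from_to (src a) (tgt a) = Some a.
  rewrite /arc_from_to; case: pickP => [b /andP[/eqP sb /eqP tb]|/(_ a)]; last by rewrite !eqxx.
  by congr Some; apply: ends_inj; left.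
have arcN a : arc_from_to (tgt a) (src a) = None.
  rewrite /arc_from_to; case: pickP => // b /andP[/eqP sb /eqP tb].
  have ab : b = a by apply: ends_inj; right.
  by have := src_tgt a; rewrite -tb ab eqxx.
by case/edges_r => a [[<- <-]|[<- <-]]; exists a; [left|right]; rewrite /gate_of arcE arcN.
Qed.

Lemma territory_gates a :
  territory (src a) (q a (hit a).-1) /\ territory (tgt a) (q a (hit a)).
Proof.
have [s h _] := hitP a; rewrite /territory s; split=> //.
by apply/orP; right; apply/prefixP; exists a, (hit a).-1; split=> //; move: h; clear; lia.
Qed.

Lemma grid_adj_gates a : grid_adj (q a (hit a).-1) (q a (hit a)).
Proof.
have [_ h _] := hitP a; have [t1 t2] := territory_gates a.
have lt6 : (hit a).-1 < 6 * n by move: h; clear; lia.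
have := q_step a lt6; rewrite prednK; last by move: h; clear; lia.
case/orP => // /eqP eqq; rewrite eqq in t1.
by have := src_tgt a; rewrite (territory_inj t1 t2) eqxx.
Qed.

Lemma grid_model_of_discrete_drawing : grid_model r m.
Proof.
apply: (@GridModel _ _ _ owner point gate_of).
- move=> p v /owner_some; case/orP => [/starP[a [i [_ <-]]]|/prefixP[a [i [_ _ <-]]]];
  exact: q_inner.
- by move=> p v /owner_some; apply: territory_connect.
- move=> x y rxy; apply/eqP; rewrite ownerE.
  by have [a [[<- [_ [-> _]]]|[_ [<- [-> _]]]]] := gates rxy; case: (territory_gates a).
- move=> x y rxy; have [a [[_ [_ [-> ->]]]|[_ [_ [-> ->]]]]] := gates rxy.
    exact: grid_adj_gates.
  by rewrite grid_adj_sym grid_adj_gates.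
Qed.

End DiscreteDrawing.

From mathcomp Require Import all_order all_algebra lra.
From mathcomp Require Import all_classical all_reals all_analysis.

(** * Sampling a drawing in the plane *)

Section PlaneArcs.
Import Order.TTheory GRing.Theory Num.Theory numFieldNormedType.Exports.
Local Open Scope classical_set_scope.
Local Open Scope ring_scope.

Section Arcs.
Variable R : realType.
Implicit Types (f g : R -> R * R) (p q : R * R) (e s t : R).

Definition close e p q := (`|p.1 - q.1| < e) && (`|p.2 - q.2| < e).

Lemma close_sym e p q : close e p q = close e q p.
Proof. by rewrite /close distrC [`|p.2 - _|]distrC. Qed.

Lemma close_trans e1 e2 p q u : close e1 p q -> close e2 q u -> close (e1 + e2) p u.
Proof.
move=> /andP[a b] /andP[c d]; apply/andP; split.
  by rewrite (le_lt_trans (ler_distD q.1 _ _)) // ltrD.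
by rewrite (le_lt_trans (ler_distD q.2 _ _)) // ltrD.
Qed.

Lemma close_le e1 e2 p q : e1 <= e2 -> close e1 p q -> close e2 p q.
Proof. by move=> le /andP[a b]; rewrite /close !(lt_le_trans _ le). Qed.

Lemma not_close_dist p q : p != q -> exists2 e, 0 < e & ~~ close e p q.
Proof.
case: p q => [p1 p2] [q1 q2]; rewrite xpair_eqE negb_and => /orP[ne|ne].
  by exists `|p1 - q1|; rewrite ?normr_gt0 ?subr_eq0 // /close /= ltxx.
by exists `|p2 - q2|; rewrite ?normr_gt0 ?subr_eq0 // /close /= ltxx andbF.
Qed.

Lemma arc_near f s e : {within `[0, 1], continuous f} -> s \in `[0, 1] -> 0 < e ->
  \forall s' \near s, s' \in `[0, 1] -> close e (f s) (f s').
Proof.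
move=> /subspace_continuousP cf sI e0.
have sI' : `[0, 1]%classic s by [].
have /cvg_ballP/(_ e e0) := cf s sI'.
rewrite near_withinE; apply: filterS => s' h s'I.
have [h1 h2] := h s'I; rewrite /close; apply/andP; split.
  by move: h1; rewrite -ball_normE.
by move: h2; rewrite -ball_normE.
Qed.

(** Compactness of the rectangle of parameters, applied to the property that f and g keep a
    distance around a given pair of parameters. *)
Lemma arcs_separated f g a b c d :
    {within `[0, 1], continuous f} -> {within `[0, 1], continuous g} ->
    {subset `[a, b] <= `[0, 1]} -> {subset `[c, d] <= `[0, 1]} ->
    (forall s t, s \in `[a, b] -> t \in `[c, d] -> f s != g t) ->
  exists2 e, 0 < e & forall s t, s \in `[a, b] -> t \in `[c, d] -> ~~ close e (f s) (g t).
Proof.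
move=> cf cg ab cd dis.
have cK : compact (`[a, b]%classic `*` `[c, d]%classic).
  by apply: compact_setX; apply: segment_compact.
have /compact_near_coveringP cov := cK.
have H := cov R (0^'+) (fun e st => st.1 \in `[a, b] -> st.2 \in `[c, d] -> ~~ close e (f st.1) (g st.2)) _.
have [|e [e0 He]] := filter_ex (filterI (nbhs_right_gt (0 : R)) (H _ _)).
  move=> [s t] [/= sI tJ].
  have [e e0 ne] := not_close_dist (dis s t sI tJ).
  have e3 : 0 < e / 3 by rewrite divr_gt0.
  have ns := arc_near cf (ab _ sI) e3; have nt := arc_near cg (cd _ tJ) e3.
  exists ([set x | (x.1 \in `[0, 1] -> close (e / 3) (f s) (f x.1)) /\
                   (x.2 \in `[0, 1] -> close (e / 3) (g t) (g x.2))], [set d | d < e / 3]).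
    split=> /=; last exact: nbhs_right_lt.
    by apply: filterI; [exact: (cvg_fst ns) | exact: (cvg_snd nt)].
  move=> [[s' t'] d'] /= [[c1 c2] d3] s'I t'J; apply: contra ne => cl.
  have {}c1 := c1 (ab _ s'I); have {}c2 := c2 (cd _ t'J).
  have c3 := close_le (ltW d3) cl; rewrite close_sym in c2.
  have -> : e = e / 3 + e / 3 + e / 3 by lra.
  exact: close_trans (close_trans c1 c3) c2.
by exists e => // s t sI tJ; apply: (He (s, t)).
Qed.

Lemma arc_uniform f e : {within `[0, 1], continuous f} -> 0 < e ->
  exists2 d, 0 < d & forall s t, s \in `[0, 1] -> t \in `[0, 1] -> `|s - t| < d ->
    close e (f s) (f t).
Proof.
move=> cf e0; have e2 : 0 < e / 2 by rewrite divr_gt0.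
have /compact_near_coveringP cov := @segment_compact R 0 1.
have H := cov R (0^'+) (fun d s => forall t, s \in `[0, 1] -> t \in `[0, 1] -> `|s - t| < d ->
  close e (f s) (f t)) _.
have [|d [d0 Hd]] := filter_ex (filterI (nbhs_right_gt (0 : R)) (H _ _)).
  move=> s sI; have := arc_near cf sI e2 => /nbhs_ballP[r r0 Hr].
  have r2 : 0 < r / 2 by rewrite divr_gt0.
  exists (ball s (r / 2), [set d | d < r / 2]) => /=.
    by split; [apply: nbhsx_ballx | exact: nbhs_right_lt].
  move=> [s' d] /= [ss' dr] t s'I tI st.
  move: ss'; rewrite -ball_normE /= => ss'.
  have c1 : close (e / 2) (f s) (f s').
    apply: Hr => //; rewrite -ball_normE /=; apply: lt_trans ss' _; lra.
  have c2 : close (e / 2) (f s) (f t).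
    apply: Hr => //; rewrite -ball_normE /=.
    have := ler_distD s' s t; lra.
  rewrite close_sym in c1; have -> : e = e / 2 + e / 2 by lra.
  exact: close_trans c1 c2.
by exists d => // s t sI tI; apply: Hd.
Qed.

End Arcs.

Lemma common_bound (R : realType) (I : finType) (P : I -> R -> Prop) :
    (forall i, exists2 e, 0 < e & P i e) -> (forall i d e, 0 < d -> d <= e -> P i e -> P i d) ->
  exists2 d, 0 < d & forall i, P i d.
Proof.
move=> ex mono; have /choice[e eP] : forall i, exists e, 0 < e /\ P i e.
  by move=> i; have [e e0 Pe] := ex i; exists e.
have d0 : 0 < \big[Num.min/1]_i e i.
  elim/big_ind: _ => // [x y x0 y0|i _]; first by rewrite lt_min x0.
  by case: (eP i).
exists (\big[Num.min/1]_i e i) => // i.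
apply: (mono i _ (e i)) => //; last by case: (eP i).
exact: bigmin_le_cond.
Qed.

Section Sampling.
Variables (R : realType) (G : sgraph) (pos : G -> R * R) (arc : edge G -> R -> R * R).
Hypothesis drawing : plane_drawing pos arc.
Implicit Types (a b : edge G) (v w x y : G) (s t : R).

Lemma arc_ends : exists st : edge G -> G * G, forall a,
  [/\ arc a 0 = pos (st a).1, arc a 1 = pos (st a).2, (st a).1 != (st a).2
    & val a = [set (st a).1; (st a).2]%SET].
Proof.
have [pinj contarc ends _ _] := drawing.
suff /choice[f fP] : forall a, exists st : G * G, [/\ arc a 0 = pos st.1, arc a 1 = pos st.2, st.1 != st.2
    & val a = [set st.1; st.2]%SET] by exists f.
move=> a.
have E := ends a.
have : [set pos x | x in [set x | incident x a]] (arc a 0) by rewrite -E; left.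
case=> u /= ua pu.
have : [set pos x | x in [set x | incident x a]] (arc a 1) by rewrite -E; right.
case=> w /= wa pw.
have uw : u != w.
  apply/eqP => uw; have [_ inj] := contarc a.
  have := inj 0 1; rewrite -pu -pw uw !in_itv /= !lexx ler01 => /(_ isT isT erefl).
  by move/eqP; rewrite eq_sym oner_eq0.
exists (u, w); split=> //.
case: a ua wa {E pu pw ends} => A A_edge /=; rewrite /incident /= => uA wA.
move: A_edge; rewrite /edge_set => /imsetP[[x y]]; rewrite inE /= => xy AE.
move: uA wA uw; rewrite AE !inE => /orP[]/eqP-> /orP[]/eqP->; rewrite ?eqxx // => _.
by rewrite finset.setUC.
Qed.

(** Distinct arcs meet only in common ends. *)
Lemma crossing_ends a b s t : s \in `[0, 1] -> t \in `[0, 1] -> a != b -> arc a s = arc b t ->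
  (s == 0) || (s == 1).
Proof.
have [pinj contarc ends novertex nocross] := drawing.
move=> sI tI ab eqst; apply: contraT; rewrite negb_or => /andP[s0 s1].
have sO : s \in `]0, 1[.
  by move: sI; rewrite !in_itv /= !lt_neqAle s1 eq_sym s0 => /andP[-> ->].
case: (boolP (t \in `]0, 1[)) => tO; first by case: (nocross a b s t ab sO tO).
have [st stP] := arc_ends; have [e0 e1 _ _] := stP b.
have : (t == 0) || (t == 1).
  move: tI tO; rewrite !in_itv /= !lt_neqAle => /andP[t0 t1]; rewrite t0 t1 !andbT.
  by rewrite negb_and !negbK eq_sym.
case/orP => /eqP tE.
  by case: (novertex a (st b).1 s sO); rewrite eqst tE.
by case: (novertex a (st b).2 s sO); rewrite eqst tE.
Qed.

Definition third (k : nat) s := (k%:R / 3 <= s) && (s <= k.+1%:R / 3).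

Lemma third_unit k s : (k < 3)%N -> third k s -> s \in `[0, 1].
Proof.
move=> k3 /andP[lo hi]; rewrite in_itv /=; apply/andP; split.
  by apply: le_trans lo; rewrite divr_ge0.
by apply: (le_trans hi); rewrite ler_pdivrMr // mul1r ler_nat.
Qed.

(** A distance that separates all pairs of thirds of arcs that do not meet. *)
Lemma gap : exists2 d, 0 < d & forall a b (k l : 'I_3) s t, third k s -> third l t ->
  close d (arc a s) (arc b t) -> exists s' t', [/\ third k s', third l t' & arc a s' = arc b t'].
Proof.
have [_ contarc _ _ _] := drawing.
pose P (i : (edge G * edge G) * ('I_3 * 'I_3)) d := forall s t, third i.2.1 s -> third i.2.2 t ->
  close d (arc i.1.1 s) (arc i.1.2 t) ->
  exists s' t', [/\ third i.2.1 s', third i.2.2 t' & arc i.1.1 s' = arc i.1.2 t'].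
have [||d d0 Pd] := @common_bound R _ P.
- move=> [[a b] [k l]]; rewrite /P /=.
  have [[s' [t' meet]]|none] := pselect (exists s' t', [/\ third k s', third l t' & arc a s' = arc b t']).
    by exists 1 => // *; exists s', t'.
  have sub (i : 'I_3) : {subset `[i%:R / 3, i.+1%:R / 3] <= `[(0 : R), 1]}.
    by move=> s; rewrite in_itv /= => /(third_unit (ltn_ord i)).
  have [|e e0 far] := arcs_separated (contarc a).1 (contarc b).1 (sub k) (sub l).
    move=> s t; rewrite !in_itv /= => sk tl; apply/eqP => eqst; apply: none.
    by exists s, t.
  exists e => // s t sk tl cl; have := far s t; rewrite !in_itv /= => /(_ sk tl).
  by rewrite cl.
- move=> i d e _ de Pe s t sk tl cl; apply: (Pe s t) => //; exact: close_le cl.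
by exists d => // a b k l; apply: (Pd ((a, b), (k, l))).
Qed.

(** Sample all arcs at 3 n + 1 parameters, so that consecutive samples are closer than a third e of
    [gap], and read the coordinates in units of e.  Going first horizontally and then vertically
    from each sample to the next one gives a path in the grid, whose pixels stay within e of the
    arc; two equal pixels come from points at distance less than 3 e, so that the paths meet
    only where the arcs do. *)
Lemma grid_model_of_drawing : exists m, inhabited (grid_model (@adj G) m).
Proof.
have [st stP] := arc_ends; pose src a := (st a).1; pose tgt a := (st a).2.
have [d d0 gapP] := gap; pose e := d / 3; have e0 : 0 < e by rewrite divr_gt0.
have [pinj contarc _ _ _] := drawing.
have [h h0 unifP] : exists2 h, 0 < h & forall a s t, s \in `[0, 1] -> t \in `[0, 1] ->
    `|s - t| < h -> close e (arc a s) (arc a t).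
  apply: (@common_bound R _ (fun a h => forall s t, s \in `[0, 1] -> t \in `[0, 1] ->
    `|s - t| < h -> close e (arc a s) (arc a t))) => [a|a h h' _ hh Hh s t sI tI lt].
    exact: (arc_uniform (contarc a).1 e0).
  by apply: Hh => //; apply: lt_le_trans hh.
pose n := (Num.truncn h^-1).+1.
have n0 : (0 < n)%N by [].
pose N := (3 * n)%N.
have N0 : (0 : R) < N%:R by rewrite ltr0n muln_gt0.
have Nh : N%:R^-1 < h.
  rewrite invf_plt ?posrE //; apply: (@lt_le_trans _ _ n%:R).
    by have := truncnS_gt h^-1.
  by rewrite ler_nat /N leq_pmull.
pose tm i : R := (minn i N)%:R / N%:R.
have tmI i : tm i \in `[0, 1].
  rewrite in_itv /= /tm divr_ge0 ?ler0n //= ler_pdivrMr // mul1r ler_nat.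
  exact: geq_minr.
have tm_step i : `|tm i - tm i.+1| < h.
  apply: le_lt_trans Nh; rewrite /tm -mulrBl normrM [X in _ * X]ger0_norm ?invr_ge0 ?ler0n //.
  apply: ler_piMl; rewrite ?invr_ge0 ?ler0n // distrC.
  have : (minn i.+1 N = minn i N \/ minn i.+1 N = (minn i N).+1)%N by clear; lia.
  by case=> ->; rewrite ?subrr ?normr0 // -natr1 addrAC subrr add0r normr1.
have tm0 : tm 0%N = 0 by rewrite /tm min0n mul0r.
have tm1 : tm N = 1 by rewrite /tm minnn divff // gt_eqF.
(* Coordinates in units of e, shifted by K so that they are positive. *)
pose K : R := e + \sum_a \sum_(i < N.+1) (`|(arc a (tm i)).1| + `|(arc a (tm i)).2|).
pose c (x : R) : nat := Num.truncn ((x + K) / e).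
have sample_le a (i : nat) : e <= (arc a (tm i)).1 + K /\ e <= (arc a (tm i)).2 + K.
  have [i' ->] : exists i' : 'I_N.+1, tm i = tm i'.
    have lt : (minn i N < N.+1)%N by rewrite ltnS geq_minr.
    by exists (Ordinal lt); rewrite /tm /=; congr (_%:R / _); clear; lia.
  have le : `|(arc a (tm i')).1| + `|(arc a (tm i')).2| <= K - e.
    rewrite /K addrAC subrr add0r (bigD1 a) //= (bigD1 i') //= -addrA lerDl.
    rewrite addr_ge0 // ?sumr_ge0 // => *; rewrite ?sumr_ge0 // => *; exact: addr_ge0.
  have := ler_norm (- (arc a (tm i')).1); have := ler_norm (- (arc a (tm i')).2).
  rewrite !normrN; have := normr_ge0 (arc a (tm i')).1; have := normr_ge0 (arc a (tm i')).2.
  by move: le; clear; lra.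
have c_pos (x : R) : e <= x + K -> (0 < c x)%N.
  by move=> le; rewrite /c truncn_gt0 ler_pdivlMr // mul1r.
have c_itv (x : R) : e <= x + K -> (c x)%:R * e <= x + K < (c x).+1%:R * e.
  move=> le; have : 0 <= (x + K) / e.
    by apply: divr_ge0; [exact: le_trans (ltW e0) le | exact: ltW].
  by move/truncn_itv; rewrite ler_pdivlMr // ltr_pdivrMr.
have c_eq (x y : R) : e <= x + K -> e <= y + K -> c x = c y -> `|x - y| < e.
  move=> /c_itv ix /c_itv iy cxy; rewrite cxy in ix.
  move: ix iy; rewrite -natr1 mulrDl mul1r; move: ((c y)%:R * e) => z.
  by move=> /andP[a1 a2] /andP[a3 a4]; rewrite ltr_norml; apply/andP; split; lra.
have c_near (x y : R) : e <= x + K -> e <= y + K -> `|x - y| < e -> (c x <= (c y).+1)%N.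
  move=> /c_itv/andP[ix _] /c_itv/andP[_ iy]; rewrite ltr_norml => /andP[_ xy].
  rewrite -ltnS -(ltr_nat R) -(ltr_pM2r e0).
  apply: le_lt_trans ix _; rewrite -natr1 mulrDl mul1r.
  by move: iy xy; clear; lra.
pose X a i := c (arc a (tm i)).1; pose Y a i := c (arc a (tm i)).2.
have X0 a i : (0 < X a i)%N by apply: c_pos; case: (sample_le a i).
have Y0 a i : (0 < Y a i)%N by apply: c_pos; case: (sample_le a i).
pose m := (\sum_a \sum_(i < N.+1) (X a i + Y a i)).+1%N.
have XY a i : (X a i + Y a i < m)%N.
  have [i' tE] : exists i' : 'I_N.+1, tm i = tm i'.
    have lt : (minn i N < N.+1)%N by rewrite ltnS geq_minr.
    by exists (Ordinal lt); rewrite /tm /=; congr (_%:R / _); clear; lia.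
  by rewrite /X /Y tE ltnS /m (bigD1 a) //= (bigD1 i') //= -addnA leq_addr.
have Xm a i : (X a i < m)%N by apply: leq_ltn_trans (XY a i); apply: leq_addr.
have Ym a i : (Y a i < m)%N by apply: leq_ltn_trans (XY a i); apply: leq_addl.
have near_c a i : ((X a i <= (X a i.+1).+1) && (X a i.+1 <= (X a i).+1) &&
                   (Y a i <= (Y a i.+1).+1) && (Y a i.+1 <= (Y a i).+1))%N.
  have := unifP a _ _ (tmI i) (tmI i.+1) (tm_step i) => /andP[hx hy].
  have [s1 s2] := sample_le a i; have [s3 s4] := sample_le a i.+1.
  by rewrite /X /Y !c_near // distrC.
pose q a j := pix m (X a (uphalf j)) (Y a j./2).
have qE a i b j : q a i = q b j -> X a (uphalf i) = X b (uphalf j) /\ Y a i./2 = Y b j./2.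
  move=> [/(congr1 val) /= + /(congr1 val) /=]; rewrite !inordK //; exact: leqW.
exists m; constructor.
pose point v := pix m (c (pos v).1) (c (pos v).2).
have tm_third (k j : nat) : (k < 3)%N -> (k * n <= j <= k.+1 * n)%N -> third k (tm j).
  move=> k3 /andP[lo hi]; rewrite /third /tm (minn_idPl _); last first.
    by rewrite (leq_trans hi) // leq_mul2r k3 orbT.
  have kE (k' : nat) : k'%:R / 3 * N%:R = (k' * n)%N%:R :> R.
    by rewrite /N !natrM mulrA divfK ?pnatr_eq0.
  by rewrite ler_pdivlMr // kE ler_nat lo ler_pdivrMr // kE ler_nat.
have part_third v a i : outer_part n src tgt v a i ->
    exists2 k : 'I_3, third k (tm i./2) & (k = 0%N :> nat /\ v = src a) \/ (k = 2%N :> nat /\ v = tgt a).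
  case/orP => [/andP[/eqP <- i2]|/andP[/eqP <- i46]].
    by exists ord0; [apply: tm_third => //=; move: i2; clear; lia | left].
  by exists ord_max; [apply: tm_third => //=; move: i46; clear; lia | right].
have part_end v a k s : (k = 0%N :> nat /\ v = src a) \/ (k = 2%N :> nat /\ v = tgt a) ->
    third k s -> (s == 0) || (s == 1) -> arc a s = pos v.
  have [e0' e1' _ _] := stP a.
  by case=> -[-> ->] /andP[lo hi] /orP[] /eqP sE; rewrite sE //; exfalso; move: lo hi; rewrite sE; lra.
have mid_third i : middle_part n i -> third 1 (tm i./2).
  by move=> mid; apply: tm_third => //; move: mid; rewrite /middle_part; clear; lia.
have mid_end s : third 1 s -> (s == 0) || (s == 1) -> False.
  by move=> /andP[lo hi] /orP[] /eqP sE; move: lo hi; rewrite sE; lra.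
have half_step a i : close e (arc a (tm i./2)) (arc a (tm (uphalf i))).
  have [->|->] : (uphalf i = i./2 \/ uphalf i = (i./2).+1)%N by clear; lia.
    by rewrite /close !subrr normr0 e0.
  exact: unifP.
have meet a b (k l : 'I_3) i j : third k (tm i./2) -> third l (tm j./2) -> q a i = q b j ->
    exists s' t', [/\ third k s', third l t' & arc a s' = arc b t'].
  move=> ki lj /qE[eqX eqY]; apply: (gapP a b k l _ _ ki lj).
  have /andP[a1 _] := half_step a i; have /andP[b1 _] := half_step b j.
  have := c_eq _ _ (sample_le a (uphalf i)).1 (sample_le b (uphalf j)).1 eqX.
  have := c_eq _ _ (sample_le a i./2).2 (sample_le b j./2).2 eqY.
  move: a1 b1; rewrite /close !ltr_norml /e.
  by move=> /andP[? ?] /andP[? ?] /andP[? ?] /andP[? ?]; apply/andP; split; apply/andP; split; lra.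
have ends_val a : val a = [set src a; tgt a]%SET by case: (stP a).
apply: (@grid_model_of_discrete_drawing G (edge G) (@adj G) m n src tgt q point).
- move=> x y xy.
  have xyE : [set x; y]%SET \in edge_set G by apply/imsetP; exists (x, y); rewrite ?inE.
  pose a : edge G := exist (fun A : {set G} => A \in edge_set G) _ xyE.
  have xNy : x != y by apply: contraTneq xy => ->; rewrite adj_irrefl.
  exists a; have aE : val a = [set x; y]%SET by [].
  have sa : src a \in [set x; y]%SET by rewrite -aE ends_val set21.
  have ta : tgt a \in [set x; y]%SET by rewrite -aE ends_val set22.
  have st_neq : src a != tgt a by case: (stP a).
  case/set2P: sa st_neq => ->; case/set2P: ta => ->; rewrite ?eqxx //; by [left|right].
- move=> a b eqab; apply: val_inj; rewrite !ends_val.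
  by case: eqab => -[-> ->] //; rewrite finset.setUC.
- by move=> a; case: (stP a).
- move=> a i _; have := near_c a i./2; move: (Xm a i./2) (Xm a (i./2).+1) (Ym a i./2) (Ym a (i./2).+1).
  rewrite /q; case oi : (odd i).
    have -> : uphalf i = (i./2).+1 by move: oi; clear; lia.
    have -> : (i.+1)./2 = (i./2).+1 by move: oi; clear; lia.
    have -> : uphalf i.+1 = (i./2).+1 by move: oi; clear; lia.
    move=> x1 x2 y1 y2 nr; rewrite /grid_adj /pix xpair_eqE -!val_eqE /= !inordK; try exact: leqW.
    by move: nr; clear; lia.
  have -> : uphalf i = i./2 by move: oi; clear; lia.
  have -> : (i.+1)./2 = i./2 by move: oi; clear; lia.
  have -> : uphalf i.+1 = (i./2).+1 by move: oi; clear; lia.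
  move=> x1 x2 y1 y2 nr; rewrite /grid_adj /pix xpair_eqE -!val_eqE /= !inordK; try exact: leqW.
  by move: nr; clear; lia.
- move=> a i; rewrite /inner /q /= !inordK ?X0 ?Y0 ?Xm ?Ym //; exact: leqW.
- by move=> a; rewrite /q /X /Y tm0; case: (stP a) => ->.
- move=> a; rewrite /q.
  have -> : uphalf (6 * n) = N by rewrite /N; clear; lia.
  have -> : ((6 * n)./2 = N)%N by rewrite /N; clear; lia.
  by rewrite /X /Y tm1; case: (stP a) => _ ->.
- move=> v w a b i j /part_third[k kt kv] /part_third[l lt lw] eqq.
  have [s [t [ks lt' eqst]]] := meet a b k l i j kt lt eqq.
  have sI := third_unit (ltn_ord k) ks; have tI := third_unit (ltn_ord l) lt'.
  case: (eqVneq a b) => [ab|ab].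
    rewrite -ab in eqst lw; have st' := (contarc a).2 s t sI tI eqst; rewrite -st' in lt'.
    case: kv lw => -[kE ->] [] [lE ->] //; exfalso; move: ks lt'; rewrite /third kE lE.
      by move=> /andP[? ?] /andP[? ?]; lra.
    by move=> /andP[? ?] /andP[? ?]; lra.
  have send := crossing_ends sI tI ab eqst.
  have tend : (t == 0) || (t == 1) by apply: (crossing_ends tI sI _ (esym eqst)); rewrite eq_sym.
  by apply: pinj; rewrite -(part_end _ _ _ _ kv ks send) eqst (part_end _ _ _ _ lw lt' tend).
- move=> a b i j /mid_third mi /mid_third mj eqq.
  pose k1 : 'I_3 := Ordinal (isT : (1 < 3)%N).
  have [s [t [ks lt' eqst]]] := meet a b k1 k1 i j mi mj eqq.
  apply/eqP; apply: contraT => ab; case: (mid_end s ks).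
  exact: (crossing_ends (third_unit _ ks) (third_unit _ lt') ab eqst).
- move=> v a b i j /mid_third mi /part_third[l lt lw] eqq.
  pose k1 : 'I_3 := Ordinal (isT : (1 < 3)%N).
  have [s [t [ks lt' eqst]]] := meet a b k1 l i j mi lt eqq.
  have [ab|ab] := eqVneq a b; last first.
    by case: (mid_end s ks); apply: (crossing_ends (third_unit _ ks) (third_unit _ lt') ab eqst).
  by rewrite ab; case: lw => -[_ ->]; rewrite eqxx ?orbT.
Qed.

End Sampling.

End PlaneArcs.

(** * The labelling number *)

Section FromTotalFunctions.
Variables (G : sgraph) (M : nat) (cv : G -> 'I_M.+3) (ce : G -> G -> 'I_M.+3).
Hypothesis lab : plabel finset.set0 (@adj G) cv ce.

Definition edge_label (a : edge G) : 'I_M.+3 :=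
  if [pick p : G * G | adj p.1 p.2 && (val a == [set p.1; p.2]%SET)] is Some p
  then ce p.1 p.2 else ord0.

Lemma edge_labelE (a : edge G) x : incident x a ->
  exists y, [/\ adj x y, val a = [set x; y]%SET & edge_label a = ce x y].
Proof.
move=> xa; rewrite /edge_label; case: pickP => [[u w] /= /andP[uw /eqP aE]|none].
  have {}aE : val a = [set u; w]%SET by [].
  have [c1 _ _ _] := lab.
  move: xa; rewrite /incident aE => /finset.set2P[] ->; first by exists w.
  by exists u; rewrite c1 // adj_sym uw finset.setUC.
have /imsetP[[u w]] : val a \in edge_set G := svalP a.
rewrite inE /= => uw aE; have := none (u, w).
by rewrite /= uw aE eqxx.
Qed.

Lemma labelling_of_total_functions : has_labelling21 G (M + 2).
Proof.
rewrite addn2; have [_ c2 c3 c4] := lab.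
apply/andP; split=> //; apply/existsP.
exists [ffun z => match z with inl x => cv x | inr a => edge_label a end].
apply/and3P; split; apply/forallP => x; apply/forallP => y; apply/implyP; rewrite !ffunE.
- by move=> xy; apply: c4; rewrite ?inE.
- case/andP => ab /existsP[z /andP[za zb]].
  have [u [zu aE ->]] := edge_labelE za; have [w [zw bE ->]] := edge_labelE zb.
  apply: c2 => //; apply: contraNneq ab => uw.
  by apply/eqP/val_inj; rewrite aE bE uw.
- move=> xy; have [u [xu aE ->]] := edge_labelE xy.
  have := c3 x u xu; rewrite inE => /(_ isT); rewrite /far.
  by move: (nat_of_ord (cv x)) (nat_of_ord (ce x u)) => i j; clear; lia.
Qed.

End FromTotalFunctions.

Lemma card_nears_ge2 n (a : 'I_n.+2) : 2 <= #|nears a|.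
Proof.
have aa : a \in nears a by rewrite inE /far; lia.
have [b ba] : exists2 b : 'I_n.+2, b \in nears a & b != a.
  case: (ltnP a n.+1) => [lt|ge].
    have lt' : a.+1 < n.+2 by [].
    by exists (Ordinal lt'); rewrite ?inE -?val_eqE /= /far; lia.
  have lt' : a.-1 < n.+2 by rewrite (leq_ltn_trans (leq_pred _)).
  by exists (Ordinal lt'); rewrite ?inE -?val_eqE /= /far; lia.
by move=> nba; apply/card_gt1P; exists b, a.
Qed.

Lemma card_far n (a : 'I_n.+2) : #|~: nears a| <= n.
Proof. by rewrite cardsCs finset.setCK card_ord leq_subLR (leq_add (card_nears_ge2 a) (leqnn n)). Qed.

(** The labels of the edges at x are distinct and far from the label of x. *)
Lemma labelling_lower_bound (G : sgraph) k (x : G) : has_labelling21 G k -> degree x + 1 <= k.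
Proof.
case: k => [//|k] /andP[_ /existsP[c /and3P[_ /forallP c2 /forallP c3]]].
pose A := [set a : edge G | incident x a]%SET.
pose other (a : edge G) := odflt x [pick y | val a == [set x; y]%SET].
have leA : degree x <= #|A|.
  apply: leq_trans (leq_imset_card other A); apply: subset_leq_card.
  apply/fintype.subsetP => y; rewrite inE => xy; apply/imsetP.
  have xyE : [set x; y]%SET \in edge_set G by apply/imsetP; exists (x, y); rewrite ?inE.
  exists (exist (fun A : {set G} => A \in edge_set G) _ xyE : edge G).
    by rewrite inE /incident /= finset.set21.
  rewrite /other /=; case: pickP => [z /eqP E|/(_ y)]; last by rewrite eqxx.
  have := finset.set22 x y; rewrite E => /finset.set2P[yx|//].
  by rewrite yx adj_irrefl in xy.
have inj : {in A &, injective (fun a => c (inr a))}.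
  move=> a b; rewrite !inE => xa xb /eqP; apply: contraTeq => ab.
  have /forallP/(_ b)/implyP := c2 a; apply; rewrite /adjacent_edges ab.
  by apply/existsP; exists x; rewrite xa xb.
rewrite -(card_in_imset inj) in leA.
have sub : (fun a => c (inr a)) @: A \subset ~: nears (c (inl x)).
  apply/fintype.subsetP => y /imsetP[a]; rewrite inE => xa ->.
  have /forallP/(_ a)/implyP/(_ xa) := c3 x; rewrite !inE negbK /far.
  by move: (c (inl x)) (c (inr a)) => i j; clear; lia.
by rewrite addn1 ltnS (leq_trans leA) // (leq_trans (subset_leq_card sub)) // card_far.
Qed.

Theorem theorem1p5 (R : realType) (G : sgraph) (planarG : planar R G)
    (DeltaG : 12 <= max_degree G) :
  max_degree G + 1 <= lambda2T G <= max_degree G + 2.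
Proof.
have [pos [arc /grid_model_of_drawing[m [model]]]] := planarG.
have degM (x : G) : rdeg (@adj G) x <= max_degree G.
  by rewrite /max_degree (leq_bigmax x).
have [cv [ce lab]] := labelling_of_grid_model (@adj_sym G) (@adj_irrefl G) DeltaG degM model.
rewrite /lambda2T; case: ex_minnP => k labk kmin.
rewrite (kmin _ (labelling_of_total_functions lab)) andbT.
have [|x maxE] := @eq_bigmax G (@degree G); last first.
  rewrite /max_degree maxE; exact: labelling_lower_bound labk.
apply: contraTltn DeltaG; rewrite leqn0 => /eqP/card0_eq G0.
by rewrite /max_degree big_pred0.
Qed.
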